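(* For every integer $m\ge 1$ and every irreducible representation $\theta_{\kappa,\lambda,\rho}$ of $G$ (from the list in the context), the multiplicity $\langle \chi_{V_m},\chi_{\kappa,\lambda,\rho}\rangle$ of $\theta_{\kappa,\lambda,\rho}$ in $V_m=H^0(F_n,\Omega_{F_n}^{\otimes m})$ is \[ \langle \chi_{V_m},\chi_{\kappa,\lambda,\rho}\rangle=\frac{\dim\theta_{\kappa,\lambda,\rho}}{6}\left(m-\left\lceil\frac{3m-1}{n}\right\rceil+A^{(m)}_{\kappa,\lambda,\rho}\right)+\frac12 B^{(m)}_{\kappa,\lambda,\rho}+\frac13\Gamma^{(m)}_{\kappa,\lambda,\rho}, \] where: (1) For $(\kappa,\lambda)=(\frac{\nu n}{3},\frac{\nu n}{3})$, $\nu\in\{0,1,2\}$ ($\nu\ne0$ only if $3\mid n$), and $\rho\in\{\rho_{\mathrm{triv}},\rho_{\mathrm{sgn}},\rho_{\mathrm{stan}}\}$: $A^{(m)}_{\kappa,\lambda,\rho}=\alpha_{m-\frac{\nu n}{3},\,m-\frac{\nu n}{3}}$; and $B^{(m)}_{\kappa,\lambda,\rho}$ equals $\frac{(-1)^m}{n^2}J(m-\frac{\nu n}{3})$, $\frac{(-1)^{m+1}}{n^2}J(m-\frac{\nu n}{3})$, $0$ for $\rho=\rho_{\mathrm{triv}},\rho_{\mathrm{sgn}},\rho_{\mathrm{stan}}$ respectively; and \[ \Gamma^{(m)}_{\frac{\nu n}{3},\frac{\nu n}{3},\rho_{\mathrm{triv}}}=\Gamma^{(m)}_{\frac{\nu n}{3},\frac{\nu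 n}{3},\rho_{\mathrm{sgn}}}=-\Gamma^{(m)}_{\frac{\nu n}{3},\frac{\nu n}{3},\rho_{\mathrm{stan}}}=\begin{cases}1 & \text{if } 3\mid m-\nu,\\ -1 & \text{if } 3\mid m-\nu+2 \text{ and } m(n-3)\ge n,\\ 0 & \text{otherwise.}\end{cases} \] (2) For $\lambda=\kappa\notin\{0,\frac n3,\frac{2n}3\}$ and $\rho\in\{\rho_{\mathrm{triv}},\rho_{\mathrm{sgn}}\}$: $A^{(m)}_{\kappa,\kappa,\rho}=\frac13\left(\alpha_{m-\kappa,m-\kappa}+\alpha_{m-\kappa,m+2\kappa}+\alpha_{m+2\kappa,m-\kappa}\right)$; $B^{(m)}_{\kappa,\kappa,\rho_{\mathrm{triv}}}=\frac{(-1)^m}{n^2}J(m-\kappa)$, $B^{(m)}_{\kappa,\kappa,\rho_{\mathrm{sgn}}}=\frac{(-1)^{m+1}}{n^2}J(m-\kappa)$; and $\Gamma^{(m)}_{\kappa,\kappa,\rho}=0$. (3) For $\kappa\neq\lambda$, $\lambda\ne-2\kappa$, $\kappa\ne-2\lambda$ in $\mathbb{Z}/n\mathbb{Z}$ and $\rho=\rho_{\mathrm{triv}}$: $B^{(m)}_{\kappa,\lambda,\rho}=\Gamma^{(m)}_{\kappa,\lambda,\rho}=0$ and \[ A^{(m)}_{\kappa,\lambda,\rho}=\tfrac16\left(\alpha_{m-\kappa,m-\lambda}+\alpha_{m-\lambda,m+\kappa+\lambda}+\alpha_{m-\kappa,m+\kappa+\lambda}+\alpha_{m+\kappa+\lambda,m-\kappa}+\alpha_{m-\lambda,m-\kappa}+\alpha_{m+\kappa+\lambda,m-\lambda}\right).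 \]
   Context: Setting. $K$ is an algebraically closed field of characteristic $p\ge0$, $p\ne 2,3$; $n\ge4$ is an integer with $p\nmid n$ and such that $n-1$ is not a power of $p$ (no condition when $p=0$). $\zeta\in K$ is a primitive $n$-th root of unity. $F_n$ is the smooth projective plane curve $x_1^n+x_2^n+x_0^n=0$ over $K$, with affine coordinates $x=x_1/x_0$, $y=x_2/x_0$, so $x^n+y^n+1=0$. $G=\mathrm{Aut}_K(F_n)=A\rtimes S_3$ with $A=\{\sigma_{\alpha,\beta}:\alpha,\beta\in\mathbb{Z}/n\mathbb{Z}\}\cong(\mathbb{Z}/n\mathbb{Z})^2$ and $S_3=\langle s,t: s^3=t^2=1, tst=s^{-1}\rangle$, realized as $K$-automorphisms of the function field $K(F_n)$ (left action, $(gh)(f)=g(h(f))$) by $\sigma_{\alpha,\beta}(x,y)=(\zeta^\alpha x,\zeta^\beta y)$, $s(x,y)=(y/x,1/x)$, $t(x,y)=(1/x,y/x)$, where $g(x,y)$ means $(g(x),g(y))$. $G$ acts on $V_m=H^0(F_n,\Omega_{F_n}^{\otimes m})$ by $g(f\,dx^{\otimes m})=g(f)\,(d\,g(x))^{\otimes m}$. $\chi_{V_m}$ is its character and $\langle\chi_{V_m},\chi\rangle$ is the multiplicity in $V_m$ of the irreducible representation with character $\chi$ (note $p\nmid|G|=6n^2$). Irreducible representations of $G$. $\rho_{\mathrm{triv}},\rho_{\mathrm{sgn}},\rho_{\mathrm{stan}}$ are the irreducible representations of $S_3$ (trivial, sign, 2-dimensional standard), with characters $\chi_{\mathrm{triv}},\chi_{\mathrm{sgn}},\chi_{\mathrm{stan}}$.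 The irreducible representations $\theta_{\kappa,\lambda,\rho}$ of $G$, with characters $\chi_{\kappa,\lambda,\rho}$ evaluated at $\sigma_{\alpha,\beta}g$ ($g\in S_3$), are: (i) $\theta_{\frac{\nu n}3,\frac{\nu n}3,\rho}$, $\nu\in\{0,1,2\}$ ($\nu=1,2$ only if $3\mid n$), $\rho\in\{\rho_{\mathrm{triv}},\rho_{\mathrm{sgn}},\rho_{\mathrm{stan}}\}$, of dimension $1,1,2$, with character $\zeta^{\frac{\nu n}{3}(\alpha+\beta)}\chi_\rho(g)$; (ii) $\theta_{\kappa,\kappa,\rho}$, $\kappa\in\mathbb{Z}/n\mathbb{Z}$, $\kappa\notin\{0,\frac n3,\frac{2n}{3}\}$, $\rho\in\{\rho_{\mathrm{triv}},\rho_{\mathrm{sgn}}\}$, of dimension 3, with character $\zeta^{\kappa(\alpha+\beta)}+\zeta^{\kappa(\alpha-2\beta)}+\zeta^{\kappa(\beta-2\alpha)}$ for $g=1$; $\zeta^{\kappa(\alpha+\beta)}\chi_\rho(g)$ for $g=ts$; $\zeta^{\kappa(\alpha-2\beta)}\chi_\rho(g)$ for $g=t$; $\zeta^{\kappa(\beta-2\alpha)}\chi_\rho(g)$ for $g=st$; $0$ for $g=s,s^2$; (iii) $\theta_{\kappa,\lambda,\rho_{\mathrm{triv}}}$, $\kappa,\lambda\in\mathbb{Z}/n\mathbb{Z}$ with $\kappa\ne\lambda$, $\lambda\ne-2\kappa$, $\kappa\ne-2\lambda$ (one for each $S_3$-orbit $\{(\kappa,\lambda),(-\kappa-\lambda,\kappa),(\lambda,-\kappa-\lambda),(-\kappa-\lambda,\lambda),(\lambda,\kappa),(\kappa,-\kappa-\lambda)\}$),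 of dimension 6, induced from the character $\sigma_{\alpha,\beta}\mapsto\zeta^{\kappa\alpha+\lambda\beta}$ of $A$. Quantities $\alpha_{X,Y}$, $J(X)$ (they depend on $n$ and $m$). For an integer $k$ let $v_k\in\{0,\dots,n-1\}$ be the remainder of $k$ modulo $n$. For integers $X,Y$: if $m(n-3)+1\ge n$, then \[\alpha_{X,Y}=\begin{cases}-1&\text{if } v_{-X}>v_{1-3m}\text{ and }v_{-X}-v_{1-3m}+v_{-Y}\ge n,\\ 1&\text{if }v_{-X}\le v_{1-3m}\text{ and }v_{-X}-v_{1-3m}+v_{-Y}<0,\\0&\text{otherwise;}\end{cases}\] if $m(n-3)+1<n$, then $\alpha_{X,Y}=1$ if $v_{-X}+v_{-Y}\le m(n-3)$ and $\alpha_{X,Y}=0$ otherwise. Moreover \[J(X)=n^2\cdot\#\left\{i\in\mathbb{Z}:\ i\ge0,\ \left\lfloor\tfrac{m(n-3)-n}{2}\right\rfloor+1\le i\le\left\lfloor\tfrac{m(n-3)}{2}\right\rfloor,\ i\equiv-X \bmod n\right\}.\] These quantities depend only on $X,Y$ modulo $n$. *)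

(* Defs.v *)
From HB Require Import structures.
From mathcomp Require Import all_boot all_order all_algebra all_fingroup.
From mathcomp Require Import all_character.
From mathcomp Require Import mpoly.

Set Implicit Arguments.
Unset Strict Implicit.
Unset Printing Implicit Defensive.

Import Order.TTheory GRing.Theory Num.Theory.

Local Open Scope ring_scope.

(* Homogeneous coordinates are ordered (x_1, x_2, x_0), so the indices 0, 1, 2
   of 'I_3 stand for x_1, x_2, x_0. *)

Definition fermat_poly (K : nzRingType) (n : nat) : {mpoly K[3]} :=
  \sum_(i < 3) 'X_i ^+ n.

Definition fermat_point (K : fieldType) (n : nat) (P : 'I_3 -> K) : Prop :=
  (exists i, P i != 0) /\ (fermat_poly K n).@[P] = 0.

(* F(x, y, 1), computed in an extension L of K. *)
Definition dehomog (K L : fieldType) (iota : {rmorphism K -> L}) (x y : L)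
    (F : {mpoly K[3]}) : L :=
  mmap iota (fun i : 'I_3 => [:: x; y; 1]`_i) F.

(* L = K(F_n): the quotients of forms of equal degree, where a form vanishes
   exactly when it is a multiple of the equation of F_n. This determines
   (L, x, y) up to a unique K-isomorphism. *)
Record fermat_function_field (K L : fieldType) (n : nat)
    (iota : {rmorphism K -> L}) (x y : L) : Prop := FermatFunctionField {
  fff_vanish : forall (d : nat) (F : {mpoly K[3]}), F \is d.-homog ->
    (dehomog iota x y F = 0 <-> exists Q, F = Q * fermat_poly K n);
  fff_generated : forall f : L, exists (d : nat) (F H : {mpoly K[3]}),
    [/\ F \is d.-homog, H \is d.-homog, dehomog iota x y H != 0
      & f = dehomog iota x y F / dehomog iota x y H]
}.

(* D = d/dx. For L = K(F_n) with n invertible in K this derivation exists and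
   is unique, and du = D(u) dx in the one-dimensional L-space of differentials
   of L over K. *)
Record is_ddx (K L : fieldType) (iota : {rmorphism K -> L}) (x : L)
    (D : L -> L) : Prop := IsDdx {
  ddx_add : forall f g, D (f + g) = D f + D g;
  ddx_mul : forall f g, D (f * g) = D f * g + f * D g;
  ddx_const : forall c, D (iota c) = 0;
  ddx_x : D x = 1
}.

Section Sections.
Context (K L : fieldType) (iota : {rmorphism K -> L}) (x y : L) (D : L -> L).

Definition local_ring (P : 'I_3 -> K) (f : L) : Prop :=
  exists (d : nat) (F H : {mpoly K[3]}),
    [/\ F \is d.-homog, H \is d.-homog, H.@[P] != 0
      & f = dehomog iota x y F / dehomog iota x y H].

(* A rational m-differential f dx^m is encoded by its coefficient f. The stalk
   of Omega^m at P consists of the finite sums of terms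
   a * du_1 (x) ... (x) du_m with a, u_1, ..., u_m in the local ring at P, and
   such a term equals a * D(u_1) * ... * D(u_m) dx^m. *)
Definition omega_stalk (m : nat) (P : 'I_3 -> K) (f : L) : Prop :=
  exists (N : nat) (a : 'I_N -> L) (u : 'I_N -> 'I_m -> L),
    [/\ forall k, local_ring P (a k), forall k i, local_ring P (u k i)
      & f = \sum_(k < N) a k * \prod_(i < m) D (u k i)].

(* H^0(F_n, Omega^m), as a subset of L through f dx^m |-> f. *)
Definition holo_diff (n m : nat) (f : L) : Prop :=
  forall P : 'I_3 -> K, fermat_point n P -> omega_stalk m P f.

Definition is_basis (d : nat) (e : 'I_d -> L) (V : L -> Prop) : Prop :=
  (forall f, V f <-> exists c : 'I_d -> K, f = \sum_(i < d) iota (c i) * e i)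
  /\ (forall c : 'I_d -> K,
       \sum_(i < d) iota (c i) * e i = 0 -> forall i, c i = 0).

End Sections.

(* G = A x| S_3, given by a faithful left action on L by K-automorphisms: gT is
   identified with the group formed by the automorphisms sigma_(a,b) s^i t^j.
   When n - 1 is not a power of the characteristic, this group is the full
   automorphism group Aut_K(F_n). *)
Record fermat_group (K L : fieldType) (n : nat) (zeta : K)
    (iota : {rmorphism K -> L}) (x y : L) (gT : finGroupType)
    (act : gT -> {rmorphism L -> L}) (sigma : 'I_n -> 'I_n -> gT) (s t : gT) :
    Prop := FermatGroup {
  fg_actM : forall g h f, act (g * h)%g f = act g (act h f);
  fg_actK : forall g c, act g (iota c) = iota c;
  fg_faithful : forall g h, (forall f, act g f = act h f) -> g = h;
  fg_sigma_x : forall a b, act (sigma a b) x = iota (zeta ^+ a) * x;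
  fg_sigma_y : forall a b, act (sigma a b) y = iota (zeta ^+ b) * y;
  fg_s_x : act s x = y / x;
  fg_s_y : act s y = 1 / x;
  fg_t_x : act t x = 1 / x;
  fg_t_y : act t y = y / x;
  fg_elements : forall g, exists a b (i : 'I_3) (j : 'I_2),
    g = (sigma a b * s ^+ i * t ^+ j)%g
}.

(* g (f dx^m) = g(f) (d g(x))^m. *)
Definition act_diff (L : fieldType) (x : L) (D : L -> L) (m : nat)
    (phi : {rmorphism L -> L}) (f : L) : L :=
  phi f * D (phi x) ^+ m.

(* rV is the matrix form of the action of gT on V_m in the basis e, the columns
   of rV g being the coordinates of the vectors g e_j. *)
Definition affords_holo_diff (K L : fieldType) (iota : {rmorphism K -> L})
    (x y : L) (D : L -> L) (gT : finGroupType) (act : gT -> {rmorphism L -> L})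
    (n m d : nat) (e : 'I_d -> L) (rV : mx_representation K [set: gT]%G d) :
    Prop :=
  is_basis iota e (holo_diff iota x y D n m) /\
  forall g j, act_diff x D m (act g) (e j) = \sum_(i < d) iota (rV g i j) * e i.

Inductive S3_irr := Triv | Sgn | Stan.

(* Character of an irreducible representation of S_3 at s^i t^j. *)
Definition S3_char (K : nzRingType) (rho : S3_irr) (i : 'I_3) (j : 'I_2) : K :=
  match rho with
  | Triv => 1
  | Sgn => (-1) ^+ j
  | Stan => if j == 0 :> nat then if i == 0 :> nat then 2%:R else -1 else 0
  end.

(* IrrA nu rho     is theta_(nu n/3, nu n/3, rho),
   IrrB kappa rho  is theta_(kappa, kappa, rho),
   IrrC kappa lam  is theta_(kappa, lam, triv);
   kappa and lam are integer representatives of classes modulo n. *)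
Inductive irr_index :=
  | IrrA of nat & S3_irr
  | IrrB of int & S3_irr
  | IrrC of int & int.

Definition theta_valid (n : nat) (th : irr_index) : Prop :=
  match th with
  | IrrA nu rho => (nu < 3)%N /\ (nu <> 0 -> 3 %| n)%N
  | IrrB kappa rho =>
      [/\ rho <> Stan, (kappa != 0 %[mod n])%Z
        & (3 %| n)%N -> (kappa != (n %/ 3)%N %[mod n])%Z
                     /\ (kappa != (2 * n %/ 3)%N %[mod n])%Z]
  | IrrC kappa lam =>
      [/\ (kappa != lam %[mod n])%Z, (lam != - (2 * kappa) %[mod n])%Z
        & (kappa != - (2 * lam) %[mod n])%Z]
  end.

Definition theta_dim (th : irr_index) : nat :=
  match th with
  | IrrA _ Stan => 2
  | IrrA _ _ => 1
  | IrrB _ _ => 3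
  | IrrC _ _ => 6
  end.

(* Value of the character at sigma_(a,b) s^i t^j. Since t s t = s^-1, the three
   reflections are t (i = 0), s t (i = 1) and t s = s^2 t (i = 2). *)
Definition theta_char (K : fieldType) (n : nat) (zeta : K) (th : irr_index)
    (a b : int) (i : 'I_3) (j : 'I_2) : K :=
  match th with
  | IrrA nu rho => zeta ^ ((nu * n %/ 3)%N%:Z * (a + b)) * S3_char K rho i j
  | IrrB kappa rho =>
      let u := zeta ^ (kappa * (a + b)) in
      let v := zeta ^ (kappa * (a - 2 * b)) in
      let w := zeta ^ (kappa * (b - 2 * a)) in
      if j == 0 :> nat then if i == 0 :> nat then u + v + w else 0
      else (if i == 0 :> nat then v else if i == 1 :> nat then w else u)
           * S3_char K rho i j
  | IrrC kappa lam =>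
      if (i == 0 :> nat) && (j == 0 :> nat) then
          zeta ^ (kappa * a + lam * b)
        + zeta ^ ((- kappa - lam) * a + kappa * b)
        + zeta ^ (lam * a + (- kappa - lam) * b)
        + zeta ^ ((- kappa - lam) * a + lam * b)
        + zeta ^ (lam * a + kappa * b)
        + zeta ^ (kappa * a + (- kappa - lam) * b)
      else 0
  end.

(* Multiplicity in rV of the irreducible representation with character
   theta_char n zeta th: socle_mult W is the multiplicity in rV of the simple
   module of the isotypic component W. Over an algebraically closed field an
   irreducible representation is determined by its K-valued character (but, in
   positive characteristic, not by the pairing of characters in K, which only
   sees multiplicities modulo p). *)
Definition theta_mult (K : closedFieldType) (n : nat) (zeta : K)
    (gT : finGroupType) (sigma : 'I_n -> 'I_n -> gT) (s t : gT)
    (d : nat) (rV : mx_representation K [set: gT]%G d) (th : irr_index) : nat :=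
  \sum_(W : DecSocleType rV |
        [forall a : 'I_n, forall b : 'I_n, forall i : 'I_3, forall j : 'I_2,
           \tr (socle_repr W (sigma a b * s ^+ i * t ^+ j)%g)
             == theta_char n zeta th a b i j])
     socle_mult W.

Definition residue (n : nat) (k : int) : int := (k %% n)%Z.

Definition alpha (n m : nat) (X Y : int) : int :=
  let N := m%:Z * (n%:Z - 3) in
  let vX := residue n (- X) in
  let vY := residue n (- Y) in
  let v0 := residue n (1 - 3 * m%:Z) in
  if n%:Z <= N + 1 then
    if (v0 < vX) && (n%:Z <= vX - v0 + vY) then -1
    else if (vX <= v0) && (vX - v0 + vY < 0) then 1
    else 0
  else if vX + vY <= N then 1 else 0.

(* Used with 3 <= n, so that (m * (n - 3))./2 bounds the range of i. *)
Definition Jterm (n m : nat) (X : int) : nat :=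
  n ^ 2 * #|[set i : 'I_((m * (n - 3))./2).+1 |
              [&& ((m%:Z * (n%:Z - 3) - n%:Z) %/ 2)%Z + 1 <= i%:Z,
                  i%:Z <= (m%:Z * (n%:Z - 3) %/ 2)%Z
                & (i%:Z == - X %[mod n])%Z]]|.

Definition Aterm (n m : nat) (th : irr_index) : rat :=
  let al X Y : rat := (alpha n m X Y)%:~R in
  let M := m%:Z in
  match th with
  | IrrA nu _ =>
      let k := (nu * n %/ 3)%N%:Z in al (M - k) (M - k)
  | IrrB k _ =>
      3%:R^-1 * (al (M - k) (M - k) + al (M - k) (M + 2 * k)
                 + al (M + 2 * k) (M - k))
  | IrrC k l =>
      6%:R^-1 * (al (M - k) (M - l) + al (M - l) (M + k + l)
                 + al (M - k) (M + k + l) + al (M + k + l) (M - k)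
                 + al (M - l) (M - k) + al (M + k + l) (M - l))
  end.

Definition Bterm (n m : nat) (th : irr_index) : rat :=
  let B (rho : S3_irr) (k : int) : rat :=
    match rho with
    | Triv => (-1) ^+ m / n%:R ^+ 2 * (Jterm n m (m%:Z - k))%:R
    | Sgn => (-1) ^+ m.+1 / n%:R ^+ 2 * (Jterm n m (m%:Z - k))%:R
    | Stan => 0
    end in
  match th with
  | IrrA nu rho => B rho (nu * n %/ 3)%N%:Z
  | IrrB k rho => B rho k
  | IrrC _ _ => 0
  end.

Definition Gterm (n m : nat) (th : irr_index) : rat :=
  match th with
  | IrrA nu rho =>
      let g : rat :=
        if (3 %| m%:Z - nu%:Z)%Z then 1
        else if (3 %| m%:Z - nu%:Z + 2)%Z && (n%:Z <= m%:Z * (n%:Z - 3)) then -1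
        else 0 in
      if rho is Stan then - g else g
  | _ => 0
  end.

(* Main.v *)
(* A rational differential f dx^m is holomorphic exactly when
   f = F(x, y, 1) / y^(m(n-1)) for a form F of degree N = m(n-3); the monomials
   x^i y^j with i + j <= N and j < n therefore give a basis of V_m.

   Every theta is induced from a linear character psi of a subgroup H containing
   A, with H = G for dimension 1, A <s> for dimension 2, A <t s> for dimension 3
   and A for dimension 6. Up to the order of H, the element of the group algebra
   attached to psi acts on an irreducible module as a projection of rank 1 if the
   module is theta and as 0 otherwise, so the multiplicity of theta in V_m is the
   dimension of the psi-eigenspace of H. Ranks are used rather than traces,
   because traces in K only see multiplicities modulo the characteristic.

   If a, b, c are the residues of kappa - m, lambda - m, -kappa - lambda - m
   modulo n, then N = a + b + c + n q for an integer q, and the eigenspace of A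
   of weight (kappa, lambda) consists of x^a y^b Q(x^n, y^n) / y^(m(n-1)) with Q
   of degree at most q. It has dimension q + 1, or 0 if q < 0; this is also the
   value of m - ceil((3m-1)/n) + alpha. For kappa = lambda the reflection t s
   exchanges x and y, and it is diagonalised by the powers of x^n - y^n and
   x^n + y^n; for 3 kappa = 0 the rotation s is diagonalised by the powers of
   U = w x^n + w^2 y^n + 1 and V = w^2 x^n + w y^n + 1, where w is a primitive
   cube root of unity. The multiplicities are then counted by residues modulo 2
   and 3. *)

Require Import Defs.
From HB Require Import structures.
From mathcomp Require Import all_boot all_order all_algebra all_fingroup.
From mathcomp Require Import all_solvable all_character.
From mathcomp Require Import mpoly.
From mathcomp Require Import zify ring.

Set Implicit Arguments.
Unset Strict Implicit.
Unset Printing Implicit Defensive.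

Import Order.TTheory GRing.Theory Num.Theory.

Local Open Scope ring_scope.

(** * Representations induced from a linear character *)

(** The residue c is the exponent of x_0 modulo n: N = mn - 3m and a + b + c is congruent to -3m, so
    N - (a + b + c) is a multiple of n. The quotient q is symmetric in the three exponents, hence
    all the values of alpha averaged in the formula coincide.

    The induced modules are never constructed. If E is the element of the group algebra attached to
    psi, Mackey's criterion gives E g E = c E, with c a scalar, for every g. It follows that a
    simple module on which E is nonzero has the induced character; conversely, that character forces
    E to be nonzero. This equivalence lets an equality of traces in K select the isotypic component,
    while the multiplicity itself is read off as a rank.

    Extending psi by zero treats the four kinds of inducing subgroup at once: only a weight of A and
    a table c(i, j) on S_3 vary, and each condition on psi becomes a finite check on these data.

    The powers of U and V are not enough in dimension 1, where an eigenvector is needed for s and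
    for a reflection that exchanges U and V. There a second basis of the invariants of s is built
    from UV and U^3 - V^3, U^3 + V^3; its size is already known from the first basis, so only
    independence remains to be proved. *)

Section PartialCharacter.

Variables (K : fieldType) (gT : finGroupType) (psi : gT -> K).

(* psi extends by zero a linear character of the subgroup {g | psi g != 0}; the
   last clause is Mackey's criterion for the irreducibility of the induced
   representation. *)
Definition partial_character :=
  [/\ psi 1%g = 1,
      forall g h, psi g != 0 -> psi (g * h)%g = psi g * psi h,
      forall g h, psi h != 0 -> psi (g * h)%g = psi g * psi h
    & forall g, psi g = 0 -> exists h,
        [/\ psi h != 0, psi (h ^ g)%g != 0 & psi (h ^ g)%g != psi h]].

Hypothesis Hpsi : partial_character.

Definition psi_order : nat := #|[set g | psi g != 0]|.

Hypothesis Hord : psi_order%:R != 0 :> K.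

Let psi1 : psi 1%g = 1. Proof. by case: Hpsi. Qed.
Let psiMl g h : psi g != 0 -> psi (g * h)%g = psi g * psi h.
Proof. by case: Hpsi => _ H _ _; exact: H. Qed.
Let psiMr g h : psi h != 0 -> psi (g * h)%g = psi g * psi h.
Proof. by case: Hpsi => _ _ H _; exact: H. Qed.

Lemma psi_invM g : psi g != 0 -> psi g^-1%g * psi g = 1.
Proof. by move=> Hg; rewrite -psiMr // mulVg. Qed.

Lemma psi_inv_neq0 g : (psi g^-1%g != 0) = (psi g != 0).
Proof.
have H h : psi h != 0 -> psi h^-1%g != 0.
  move=> /psi_invM H; apply/eqP => H0; move: H; rewrite H0 mul0r.
  by move/esym/eqP; rewrite oner_eq0.
by apply/idP/idP => /H //; rewrite invgK.
Qed.

Lemma psi_orderE : psi_order%:R = \sum_g psi g^-1%g * psi g.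
Proof.
rewrite /psi_order -sum1_card natr_sum big_mkcond /=; apply: eq_bigr => g _.
rewrite inE; case: ifPn => [/psi_invM ->//|]; rewrite negbK => /eqP ->.
by rewrite mulr0.
Qed.

(** Orthogonality of [psi] and its conjugates. If [psi k = 0], replacing [g] by [g h], with [h] from
    Mackey's criterion for [k^-1], multiplies the sum by [psi h^-1 * psi (h ^ k^-1)], which is not
    1; so the sum vanishes. *)
Lemma psi_sum_twist k :
  \sum_g psi g^-1%g * psi (k * g * k^-1)%g
  = if psi k != 0 then psi_order%:R else 0.
Proof.
case: ifPn => [Hk|].
  rewrite psi_orderE; apply: eq_bigr => g _; congr (_ * _).
  rewrite -mulgA psiMl // psiMr ?psi_inv_neq0 //.
  transitivity (psi k^-1%g * psi k * psi g); first by ring.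
  by rewrite psi_invM // mul1r.
rewrite negbK => /eqP Hk.
have Hk' : psi k^-1%g = 0 by apply/eqP; rewrite -[_ == 0]negbK psi_inv_neq0 Hk eqxx.
have [_ _ _ /(_ _ Hk') [h [Hh Hhk Hne]]] := Hpsi.
set S := \sum_g _; have HS : S = psi h^-1%g * psi (h ^ k^-1)%g * S.
  rewrite {1}/S (reindex_inj (mulIg h)) /= mulr_sumr; apply: eq_bigr => g _.
  rewrite invMg psiMl ?psi_inv_neq0 //.
  have -> : (k * (g * h) * k^-1 = (k * g * k^-1) * (h ^ k^-1))%g.
    by rewrite conjgE invgK !mulgA mulgKV.
  by rewrite psiMr //; ring.
apply/eqP; apply: contraNT Hne => HS0; apply/eqP.
have : psi h^-1%g * psi (h ^ k^-1)%g = 1.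
  by apply: (mulIf HS0); rewrite mul1r -HS.
move/(congr1 (fun u => psi h * u)); rewrite mulrA mulr1.
by rewrite [psi h * _]mulrC psi_invM // mul1r.
Qed.

Section Rep.

Variables (d : nat) (r : mx_representation K [set: gT]%G d).

(* A nonzero multiple of the projection onto the psi-eigenspace. *)
Definition psi_mx : 'M[K]_d := \sum_g psi g^-1%g *: r g.
Local Notation E := psi_mx.

Let rM g h : r (g * h)%g = r g *m r h.
Proof. by rewrite repr_mxM ?inE. Qed.

Lemma psi_mxMr k : psi k != 0 -> E *m r k = psi k *: E.
Proof.
move=> Hk; rewrite /psi_mx scaler_sumr mulmx_suml (reindex_inj (mulIg k^-1)%g) /=.
apply: eq_bigr => g _; rewrite -scalemxAl -rM mulgKV scalerA invMg invgK.
by rewrite psiMl.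
Qed.

Lemma psi_mxMl k : psi k != 0 -> r k *m E = psi k *: E.
Proof.
move=> Hk; rewrite /psi_mx scaler_sumr mulmx_sumr (reindex_inj (mulgI k^-1)%g) /=.
apply: eq_bigr => g _; rewrite -scalemxAr -rM mulKVg scalerA invMg invgK.
by rewrite psiMr // mulrC.
Qed.

(** The Hecke algebra of [psi] is one-dimensional. Outside the support, Mackey's [h] can be absorbed
    in [E r(k) E] on the left as [h] or on the right as [h ^ k]; the two scalars differ, so the
    product is zero. *)
Lemma psi_mx_hecke k : E *m r k *m E = (psi k * psi_order%:R) *: E.
Proof.
have E2 : E *m E = psi_order%:R *: E.
  rewrite psi_orderE scaler_suml {2}/psi_mx mulmx_sumr; apply: eq_bigr => g _.
  rewrite -scalemxAr; have [->|Hg] := eqVneq (psi g^-1%g) 0.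
    by rewrite mul0r !scale0r.
  by rewrite psi_mxMr ?scalerA // -psi_inv_neq0.
have [Hk|Hk] := eqVneq (psi k) 0; last by rewrite psi_mxMr // -scalemxAl E2 scalerA.
have [_ _ _ /(_ _ Hk) [h [Hh Hhk Hne]]] := Hpsi.
rewrite Hk mul0r scale0r; apply/eqP.
have H : psi h *: (E *m r k *m E) = psi (h ^ k)%g *: (E *m r k *m E).
  transitivity (E *m r h *m r k *m E); first by rewrite (psi_mxMr Hh) -!scalemxAl.
  rewrite -(mulmxA E) -rM conjgC rM mulmxA -(mulmxA _ (r (h ^ k)%g)) (psi_mxMl Hhk).
  by rewrite scalemxAr.
move/eqP: H; rewrite -subr_eq0 -scalerBl scaler_eq0 subr_eq0 eq_sym.
by rewrite (negPf Hne).
Qed.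

Lemma psi_mx_sqr : E *m E = psi_order%:R *: E.
Proof. by have := psi_mx_hecke 1%g; rewrite repr_mx1 mulmx1 psi1 mul1r. Qed.

(** Since [E] is quasi-idempotent, one more factor [E] may be inserted and moved around the trace,
    which turns [E r(g)] into [E r(g) E]. *)
Lemma psi_mx_trace_conj g : \tr (E *m r g) = psi g * \tr E.
Proof.
apply: (mulfI Hord); rewrite -mxtraceZ scalemxAl -psi_mx_sqr -mulmxA mxtrace_mulC.
by rewrite psi_mx_hecke mxtraceZ; ring.
Qed.

Lemma psi_mx_env A : (A \in enveloping_algebra_mx r)%MS ->
  exists c, E *m A *m E = c *: E.
Proof.
case/envelop_mxP => a ->; exists (\sum_g a g * (psi g * psi_order%:R)).
move: psi_mx psi_mx_hecke => e He.
rewrite scaler_suml mulmx_sumr mulmx_suml; apply: eq_big => [g|g _]; rewrite ?inE //.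
by rewrite -scalemxAr -scalemxAl He scalerA.
Qed.

(** Write [A = L R] with [L] of full column rank and [R] of full row rank. Cancelling both in
    [A A = c A] leaves [R L = c], a scalar matrix of size [\rank A] with the same trace as [A]. *)
Lemma mxtrace_quasi_idem (A : 'M[K]_d) c :
  A *m A = c *: A -> \tr A = c *+ \rank A.
Proof.
move=> HA; have EA := mulmx_base A.
have /row_freeP [B HB] := row_base_free A.
have /row_fullP [C HC] := col_base_full A.
move: (row_base A) (col_base A) EA HB HC => R L EA HB HC.
have H : R *m L = c%:M.
  have: L *m (R *m L) *m R = L *m c%:M *m R.
    by rewrite mulmxA -(mulmxA _ _ R) EA HA mul_mx_scalar -scalemxAl EA.
  move/(congr1 (fun M => C *m M *m B)).
  by rewrite !mulmxA HC !mul1mx -!mulmxA HB !mulmx1.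
by rewrite -{1}EA mxtrace_mulC H mxtrace_scalar.
Qed.

Section Irreducible.

Hypothesis irr_r : mx_irreducible r.
Hypothesis nzE : E != 0.

(** By irreducibility a nonzero row of [E] generates the module, so any other row is its image under
    some [A] of the enveloping algebra. Rows of [E] are reproduced by [E] up to a scalar, and
    [E A E] is a multiple of [E]; hence all rows are proportional. *)
Lemma psi_mx_rank1 : \rank E = 1%N.
Proof.
have [i Hi] : exists i, row i E != 0.
  apply/existsP; apply: contraNT nzE => /existsPn H.
  by apply/eqP/row_matrixP => i; rewrite row0; have /negbNE/eqP := H i.
apply/eqP; rewrite eqn_leq lt0n mxrank_eq0 nzE andbT.
apply: leq_trans (rank_leq_row (row i E)); apply: mxrankS.
apply/row_subP => j.
have wE k : row k E *m E = psi_order%:R *: row k E.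
  by rewrite -row_mul psi_mx_sqr linearZ.
have : (row j E <= cyclic_mx r (row i E))%MS.
  by rewrite -(mxsimple_cyclic irr_r Hi) ?submx1.
case/cyclic_mxP => A HA EA; have [c Hc] := psi_mx_env HA.
suff -> : row j E = (psi_order%:R^-1 * c / psi_order%:R * psi_order%:R) *: row i E.
  exact: scalemx_sub.
have := wE j; rewrite {1}EA => /(congr1 ( *:%R psi_order%:R^-1)).
rewrite scalerA mulVf // scale1r => <-.
have -> : row i E = psi_order%:R^-1 *: (row i E *m E).
  by rewrite wE scalerA mulVf // scale1r.
rewrite -!scalemxAl -(mulmxA (row i E)) -(mulmxA (row i E)) Hc -scalemxAr.
rewrite !scalerA; congr (_ *: _); field => //.
Qed.

(** Frobenius' formula for an induced character. The sum [z] of the conjugates of [E] commutes with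
    the group and satisfies [E z = |H|^2 E], where [|H|] is [psi_order]. The kernel of [z - |H|^2]
    is therefore a nonzero submodule, so [z] is scalar, and the trace of [z r(g)] is computed in two
    ways. *)
Lemma psi_mx_irr_trace g :
  psi_order%:R * \tr (r g) = \sum_k psi (k * g * k^-1)%g.
Proof.
pose z := \sum_k r k^-1%g *m E *m r k.
have zC x : z *m r x = r x *m z.
  rewrite /z mulmx_suml mulmx_sumr (reindex_inj (mulIg x^-1)%g) /=.
  apply: eq_bigr => k _; rewrite invMg invgK !rM -!mulmxA -rM mulVg.
  by rewrite repr_mx1 mulmx1.
have Ez : E *m z = (psi_order%:R * psi_order%:R) *: E.
  rewrite /z mulmx_sumr {1}psi_orderE mulr_suml scaler_suml.
  apply: eq_bigr => k _; rewrite !mulmxA psi_mx_hecke -scalemxAl.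
  have [->|Hk] := eqVneq (psi k^-1%g) 0; first by rewrite !mul0r !scale0r.
  rewrite psi_mxMr; last by rewrite -psi_inv_neq0.
  by rewrite scalerA; congr (_ *: _); ring.
have Hz : z = (psi_order%:R * psi_order%:R)%:M.
  apply/eqP; rewrite -subr_eq0; set y := _ - _.
  have yC : centgmx r y.
    apply/centgmxP => x _; rewrite /y mulmxBl mulmxBr zC.
    by rewrite mul_scalar_mx mul_mx_scalar.
  have Ey : E *m y = 0 by rewrite /y mulmxBr Ez mul_mx_scalar subrr.
  have [_ _ Hs] := irr_r.
  have : (1%:M <= kermx y)%MS.
    apply: Hs; rewrite ?submx1 //; first exact: kermx_centg_module.
    rewrite -mxrank_eq0 -lt0n; apply: leq_trans (_ : \rank E <= _)%N.
      by rewrite psi_mx_rank1.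
    by apply: mxrankS; apply/sub_kermxP.
  by move/sub_kermxP; rewrite mul1mx => ->.
have := congr1 (fun M => \tr (M *m r g)) Hz.
rewrite mul_scalar_mx mxtraceZ -mulrA => Hzg; apply: (mulfI Hord); rewrite -Hzg.
rewrite /z mulmx_suml raddf_sum mulr_sumr; apply: eq_bigr => k _ /=.
rewrite -!mulmxA mxtrace_mulC -!mulmxA -!rM psi_mx_trace_conj mulgA.
by rewrite (mxtrace_quasi_idem psi_mx_sqr) psi_mx_rank1 mulrC.
Qed.

End Irreducible.

(** The converse of the trace formula: summing it against [psi g^-1] and using orthogonality gives
    [|H| \tr E = |H|^2], which is nonzero in [K]. *)
Lemma psi_mx_neq0 :
  (forall g, psi_order%:R * \tr (r g) = \sum_k psi (k * g * k^-1)%g) -> E != 0.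
Proof.
move=> H; apply/eqP => E0.
have : psi_order%:R * \tr E = psi_order%:R * psi_order%:R.
  rewrite /psi_mx raddf_sum mulr_sumr /=.
  transitivity (\sum_g \sum_k psi g^-1%g * psi (k * g * k^-1)%g).
    by apply: eq_bigr => g _; rewrite mxtraceZ mulrCA H mulr_sumr.
  rewrite exchange_big /=; transitivity (\sum_(k | psi k != 0) psi_order%:R : K).
    by rewrite [RHS]big_mkcond; apply: eq_bigr => k _; rewrite psi_sum_twist.
  rewrite sumr_const mulr_natr; congr (_ *+ _).
  by rewrite /psi_order; apply: eq_card => k; rewrite !inE.
rewrite E0 mxtrace0 mulr0 => /esym/eqP; rewrite mulf_eq0 orbb.
by rewrite (negPf Hord).
Qed.

End Rep.
End PartialCharacter.

(** Each summand is stable under [E], so the images lie in independent subspaces and their ranks add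
    up. *)
Lemma mxrank_sum_mulmx (F : fieldType) (I : finType) (P : pred I) n
    (M : I -> 'M[F]_n) (E : 'M[F]_n) :
    mxdirect (\sum_(i | P i) M i) -> (forall i, P i -> (M i *m E <= M i)%MS) ->
  \rank ((\sum_(i | P i) M i)%MS *m E) = (\sum_(i | P i) \rank (M i *m E))%N.
Proof.
move=> /mxdirect_sumsP dxM sM; rewrite (sumsmxMr P M E).
apply/mxdirectP.
apply/mxdirect_sumsP => i Pi; apply/eqP; rewrite -submx0.
have /eqP := dxM i Pi; rewrite -submx0; apply: submx_trans.
rewrite capmxS ?sM //; apply/sumsmx_subP => j /andP[Pj ji].
by rewrite (sumsmx_sup j) ?Pj ?sM.
Qed.

(** * Multiplicities as ranks of the projection attached to [psi] *)

Section Multiplicity.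

Variables (K : fieldType) (gT : finGroupType) (psi : gT -> K).
Hypothesis Hpsi : partial_character psi.
Hypothesis Hord : (psi_order psi)%:R != 0 :> K.
Hypothesis HG : #|gT|%:R != 0 :> K.
Variables (d : nat) (r : mx_representation K [set: gT]%G d).

Local Notation E := (psi_mx psi r).

Definition psi_induced m (r' : mx_representation K [set: gT]%G m) : bool :=
  [forall g, (psi_order psi)%:R * \tr (r' g) == \sum_k psi (k * g * k^-1)%g].

Lemma psi_mx_module (U : 'M_d) : mxmodule r U -> (U *m E <= U)%MS.
Proof.
move=> /mxmoduleP modU; rewrite /psi_mx mulmx_sumr summx_sub // => g _.
by rewrite -scalemxAr scalemx_sub // modU ?inE.
Qed.

Lemma psi_mx_submod (U : 'M_d) (modU : mxmodule r U) :
  \rank (psi_mx psi (submod_repr modU)) = \rank (U *m E).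
Proof.
rewrite -(eqmxMr E (val_submod1 U)).
suff <- : val_submod (psi_mx psi (submod_repr modU)) = val_submod 1%:M *m E.
  by rewrite /val_submod /= mxrankMfree ?row_base_free.
rewrite /psi_mx raddf_sum mulmx_sumr; apply: eq_bigr => g _.
by rewrite /= linearZ /= -scalemxAr -val_submodJ ?inE // mul1mx.
Qed.

(** On a simple module [E] has rank 0 or 1. The trace formula and its converse say that the rank is
    1 exactly when the module has the induced character, so the boolean test is the rank. *)
Lemma psi_mx_simple (U : 'M_d) (simU : mxsimple r U) :
  \rank (U *m E) = psi_induced (submod_repr (mxsimple_module simU)).
Proof.
have modU := mxsimple_module simU.
rewrite -(psi_mx_submod (mxsimple_module simU)).
have irrU : mx_irreducible (submod_repr (mxsimple_module simU)).
  by apply/submod_mx_irr.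
set rU := submod_repr _ in irrU *.
have [E0|nzE] := eqVneq (psi_mx psi rU) 0.
  rewrite E0 mxrank0; case: (boolP (psi_induced rU)) => // /forallP H.
  have : psi_mx psi rU != 0 by apply: psi_mx_neq0 => // g; apply/eqP.
  by rewrite E0 eqxx.
have -> : psi_induced rU by apply/forallP => g; rewrite psi_mx_irr_trace.
by rewrite psi_mx_rank1.
Qed.

(** By Maschke's theorem the module is the direct sum of its isotypic components, each a direct sum
    of copies of one simple module. Every copy of a module with the induced character contributes 1
    to the rank of [E], all others contribute 0. *)
Lemma sum_socle_mult_psi (sG : socleType r) :
  (\sum_(W : sG | psi_induced (socle_repr W)) socle_mult W)%N = \rank E.
Proof.
have pG : pgroup [pchar K]^' [set: gT]%G.
  by rewrite /pgroup pcharf'_nat cardsT.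
have S1 := reducible_Socle1 sG (mx_Maschke_pchar r pG).
rewrite -[in RHS](mul1mx E) -S1 mxrank_sum_mulmx; first last.
- by move=> W _; apply: psi_mx_module; apply: component_mx_module.
- exact: Socle_direct.
rewrite big_mkcond; apply: eq_bigr => W _ /=.
have simU := socle_simple W.
have [I M S simM defW dxM] := component_mx_semisimple simU.
have rankU_gt0: (0 < \rank (socle_base W))%N by rewrite lt0n mxrank_eq0; case simU.
have isoM i: mx_iso r (socle_base W) (M i).
  by apply: component_mx_iso; rewrite ?simU // -defW (sumsmx_sup i).
have -> : socle_mult W = #|I|.
  rewrite /socle_mult -(mulnK #|I| rankU_gt0); congr (_ %/ _)%N.
  rewrite -defW (mxdirectP dxM) /= -sum_nat_const.
  by apply: eq_bigr => i _; rewrite (mxrank_iso (isoM i)).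
rewrite -(eqmxMr E defW) mxrank_sum_mulmx //; last first.
  by move=> i _; apply: psi_mx_module; case: (simM i).
rewrite (eq_bigr (fun=> psi_induced (socle_repr W) : nat)); last first.
  move=> i _; rewrite (psi_mx_simple (simM i)); congr (nat_of_bool _).
  apply: eq_forallb => g; congr (_ * _ == _).
  apply: mxtrace_rsim; last by rewrite inE.
  by apply/mx_rsim_iso; apply: mx_iso_sym; apply: isoM.
by rewrite sum_nat_const; case: ifP => _; rewrite ?muln1 ?muln0.
Qed.

End Multiplicity.

(** * Bases of K-subspaces of the function field *)

Section Bases.

Variables (K L : fieldType) (iota : {rmorphism K -> L}).

(** The index set is cut out by a predicate on a fixed type, so that passing to an eigenspace of a
    diagonal operator changes only [P]. *)
Definition basis_on (I : finType) (P : pred I) (e : I -> L) (V : L -> Prop) :=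
  (forall f, V f <-> exists c : I -> K, f = \sum_(i | P i) iota (c i) * e i) /\
  (forall c : I -> K, \sum_(i | P i) iota (c i) * e i = 0 ->
     forall i, P i -> c i = 0).

Definition klinear (T : L -> L) :=
  (forall f g, T (f + g) = T f + T g) /\
  (forall c f, T (iota c * f) = iota c * T f).

Lemma klinear_sum T (I : finType) (P : pred I) (c : I -> K) (e : I -> L) :
  klinear T ->
  T (\sum_(i | P i) iota (c i) * e i) = \sum_(i | P i) iota (c i) * T (e i).
Proof.
move=> [Tadd TZ]; rewrite (big_morph T Tadd (id1 := 0)).
  by apply: eq_bigr => i _; rewrite TZ.
by have := TZ 0 0; rewrite rmorph0 !mul0r.
Qed.

Lemma is_basisE d (e : 'I_d -> L) V :
  is_basis iota e V <-> basis_on xpredT e V.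
Proof.
by split=> -[H1 H2]; split=> // c H i; [move=> _|]; exact: H2.
Qed.

Lemma basis_on_eq (I : finType) P (e : I -> L) V V' :
  (forall f, V f <-> V' f) -> basis_on P e V -> basis_on P e V'.
Proof. by move=> VV' [H1 H2]; split=> // f; rewrite -VV'. Qed.

Lemma basis_on_mem (I : finType) (P : pred I) (e : I -> L) V i : basis_on P e V -> P i -> V (e i).
Proof.
move=> [H _] Pi; apply/H; exists (fun j => (j == i)%:R).
rewrite (bigD1 i) //= eqxx rmorph1 mul1r big1 ?addr0 // => j /andP[_ /negPf->].
by rewrite rmorph0 mul0r.
Qed.

(** The coordinates of [T f - c f] are [(mu i - c) a_i]; if they vanish, only the indices with
    [mu i = c] remain. *)
Lemma basis_on_eigen (I : finType) P (e : I -> L) V T (mu : I -> K) c :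
    basis_on P e V -> klinear T -> (forall i, P i -> T (e i) = iota (mu i) * e i) ->
  basis_on (fun i => P i && (mu i == c)) e (fun f => V f /\ T f = iota c * f).
Proof.
move=> [sp fr] linT Te; have restr (a : I -> K) : (forall i, P i -> mu i != c -> a i = 0) ->
    \sum_(i | P i) iota (a i) * e i
    = \sum_(i | P i && (mu i == c)) iota (a i) * e i.
  move=> Ha; rewrite (bigID (fun i => mu i == c)) /= [X in _ + X]big1 ?addr0 //.
  by move=> i /andP[Pi ne]; rewrite Ha // rmorph0 mul0r.
split=> [f|a Ha i /andP[Pi Hi]].
  split=> [[/sp[a fE] Tf]|[a ->]].
    exists a; rewrite fE; apply: restr => i Pi ne.
    have : \sum_(i | P i) iota ((mu i - c) * a i) * e i = 0.
      have := Tf; rewrite fE klinear_sum // => /eqP; rewrite -subr_eq0 => /eqP.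
      apply: etrans; rewrite mulr_sumr -sumrB; apply: eq_bigr => j Pj.
      by rewrite Te // rmorphM rmorphB; ring.
    move/fr => /(_ i Pi) /eqP; rewrite mulf_eq0 subr_eq0 (negPf ne) /=.
    by move/eqP.
  split.
    apply/sp; exists (fun i => if mu i == c then a i else 0); rewrite restr.
      by apply: eq_bigr => i /andP[_ ->].
    by move=> i _ /negPf ->.
  rewrite klinear_sum // mulr_sumr; apply: eq_bigr => i /andP[Pi /eqP Hi].
  by rewrite Te // Hi; ring.
have := fr (fun i => if mu i == c then a i else 0); rewrite restr; last first.
  by move=> j _ /negPf ->.
move=> H; have := H _ i Pi; rewrite Hi; apply.
by rewrite -[RHS]Ha; apply: eq_bigr => j /andP[_ ->].
Qed.

Lemma basis_on_coord (I : finType) P (e : I -> L) V (J : finType) (b : J -> L) :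
  basis_on P e V -> (forall j, V (b j)) ->
  exists M : J -> I -> K, forall j, b j = \sum_(i | P i) iota (M j i) * e i.
Proof.
move=> [sp _] Vb; have H j : exists m : {ffun I -> K},
    b j = \sum_(i | P i) iota (m i) * e i.
  have /sp[c Hc] := Vb j; exists [ffun i => c i]; rewrite Hc.
  by apply: eq_bigr => i _; rewrite ffunE.
by have [M HM] := fin_all_exists H; exists (fun j => M j).
Qed.

Lemma basis_on_enum (I : finType) (P : pred I) (e : I -> L) V :
  basis_on P e V -> is_basis iota (fun k : 'I_#|P| => e (enum_val k)) V.
Proof.
move=> [sp fr].
have re (c : 'I_#|P| -> K) (c' : I -> K) :
    (forall k, c k = c' (enum_val k)) ->
    \sum_k iota (c k) * e (enum_val k) = \sum_(i | P i) iota (c' i) * e i.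
  by move=> H; rewrite [RHS]big_enum_val; apply: eq_bigr => k _; rewrite H.
split=> [f|c Hc k].
  split=> [/sp[c ->]|[c ->]].
    by exists (fun k => c (enum_val k)); rewrite -(re _ _ (fun=> erefl)).
  apply/sp; have [k0 _|P0] := pickP (fun k : 'I_#|P| => true); last first.
    exists (fun=> 0); rewrite (re _ (fun=> 0)) // => k; by have := P0 k.
  pose c' i := if insub (index i (enum P)) is Some k then c k else c k0.
  exists c'; apply: re => k; rewrite /c' /enum_val index_uniq ?enum_uniq //.
    by rewrite valK.
  by rewrite -cardE.
have [k0 _|P0] := pickP (fun k : 'I_#|P| => true); last by have := P0 k.
pose c' i := if insub (index i (enum P)) is Some k then c k else c k0.
have cc' l : c l = c' (enum_val l).
  rewrite /c' /enum_val index_uniq ?enum_uniq //; last by rewrite -cardE.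
  by rewrite valK.
rewrite cc'; apply: (fr c'); last exact: (enum_valP k).
by apply: etrans Hc; apply/esym/re.
Qed.

(** Once [r] is identified with [#|P|], the matrix expressing [b] in the known basis is square, and
    independence makes its kernel zero. Explicit eigenbases thus need only membership, independence
    and a count. *)
Lemma basis_on_free (I : finType) P (e : I -> L) V r (b : 'I_r -> L) :
    basis_on P e V -> #|P| = r -> (forall j, V (b j)) ->
    (forall c : 'I_r -> K, \sum_j iota (c j) * b j = 0 -> forall j, c j = 0) ->
  basis_on xpredT b V.
Proof.
move=> /basis_on_enum; move: (fun k => _) => e'; move: e'; rewrite {1 2}[P in #|P|]/=.
move: #|P| => r' e' He rr; case: r / rr b => b Vb frb.
have [sp fr] := He.
have [M HM] := basis_on_coord (proj1 (is_basisE _ _) He) Vb.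
pose A := \matrix_(j, i) M j i.
have lin (c : 'rV_r') :
    \sum_j iota (c 0 j) * b j = \sum_i iota ((c *m A) 0 i) * e' i.
  rewrite (eq_bigr (fun j => \sum_i iota (c 0 j * M j i) * e' i)); last first.
    move=> j _; rewrite HM mulr_sumr; apply: eq_bigr => i _.
    by rewrite rmorphM mulrA.
  rewrite exchange_big; apply: eq_bigr => i _; rewrite -mulr_suml mxE rmorph_sum.
  by congr (_ * _); apply: eq_bigr => j _; rewrite mxE.
have Au : A \in unitmx.
  rewrite -row_free_unit -kermx_eq0; apply/rowV0P => c /sub_kermxP cA.
  apply/rowP => j; rewrite mxE; apply: (frb (fun j => c 0 j)).
  by rewrite lin cA big1 // => i _; rewrite mxE rmorph0 mul0r.
split=> [f|c Hc i _]; last exact: frb.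
split=> [/sp[a ->]|[c ->]].
  exists (fun j => ((\row_i a i) *m invmx A) 0 j); rewrite lin mulmxKV //.
  by apply: eq_bigr => i _; rewrite mxE.
apply/sp; exists (fun i => ((\row_j c j) *m A) 0 i); rewrite -lin.
by apply: eq_bigr => j _; rewrite mxE.
Qed.

End Bases.

(** * The rank of [psi_mx] as the dimension of an eigenspace *)

Section EigenRank.

Variables (K L : fieldType) (iota : {rmorphism K -> L}).
Variables (gT : finGroupType) (psi : gT -> K).
Hypothesis Hpsi : partial_character psi.
Hypothesis Hord : (psi_order psi)%:R != 0 :> K.
Variables (d : nat) (r : mx_representation K [set: gT]%G d).
Variables (e : 'I_d -> L) (V : L -> Prop) (T : gT -> L -> L).
Hypothesis He : is_basis iota e V.
Hypothesis Tlin : forall g, klinear iota (T g).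
Hypothesis Te : forall g j, T g (e j) = \sum_(i < d) iota (r g i j) * e i.

(** Let the columns of [M] be the coordinates of the eigenbasis. The columns of [psi_mx] are
    eigenvectors, so [psi_mx] factors through [M]; this bounds its rank from above. *)
Lemma psi_mx_rank_eigen (I : finType) (P : pred I) (b : I -> L) :
    basis_on iota P b
      (fun f => V f /\ forall g, psi g != 0 -> T g f = iota (psi g) * f) ->
  \rank (psi_mx psi r) = #|P|.
Proof.
move=> /basis_on_enum; set b' := fun k => _; move: b' => b'.
have [sp fr] := He; move=> [spb frb].
pose vec n (w : 'I_n -> L) (c : 'cV[K]_n) := \sum_i iota (c i 0) * w i.
have vecT g c : T g (vec d e c) = vec d e (r g *m c).
  rewrite /vec klinear_sum //.
  rewrite (eq_bigr (fun j => \sum_i iota (r g i j * c j 0) * e i)); last first.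
    move=> j _; rewrite Te mulr_sumr; apply: eq_bigr => i _.
    by rewrite rmorphM; ring.
  rewrite exchange_big; apply: eq_bigr => i _; rewrite -mulr_suml mxE rmorph_sum.
  by [].
have vecZ a c : iota a * vec d e c = vec d e (a *: c).
  rewrite /vec mulr_sumr; apply: eq_bigr => i _; rewrite mxE rmorphM; ring.
have vec_inj c1 c2 : vec d e c1 = vec d e c2 -> c1 = c2.
  move=> H; apply/colP => i; apply/eqP; rewrite -subr_eq0; apply/eqP.
  apply: (fr (fun i => c1 i 0 - c2 i 0)); rewrite -[RHS](subrr (vec d e c1)).
  by rewrite {2}H -sumrB; apply: eq_bigr => j _; rewrite rmorphB mulrBl.
have Vvec c : V (vec d e c) by apply/sp; exists (fun i => c i 0).
have mem f : (V f /\ forall g, psi g != 0 -> T g f = iota (psi g) * f) <->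
    exists2 c, f = vec d e c & forall g, psi g != 0 -> r g *m c = psi g *: c.
  split=> [[/sp[c fE]]|[c -> H]]; last first.
    by split=> // g Hg; rewrite vecT H // vecZ.
  have {fE} -> : f = vec d e (\col_i c i).
    by rewrite fE; apply: eq_bigr => i _; rewrite mxE.
  move=> H; exists (\col_i c i) => // g Hg.
  by apply: vec_inj; rewrite -vecT -vecZ H.
have b'V k := basis_on_mem (i := k) (proj1 (is_basisE _ _ _) (conj spb frb)) isT.
have bM : exists M : 'M_(d, #|P|), forall k, b' k = vec d e (col k M).
  have Vb k : V (b' k) by have [] := b'V k.
  have [M HM] := basis_on_coord (proj1 (is_basisE _ _ _) He) Vb.
  exists (\matrix_(i, k) M k i) => k; rewrite HM.
  by apply: eq_bigr => i _; rewrite !mxE.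
have [M HM] := bM.
have vecM c : vec _ b' c = vec d e (M *m c).
  rewrite /vec (eq_bigr (fun k => \sum_i iota (M i k * c k 0) * e i)); last first.
    move=> k _; rewrite HM mulr_sumr; apply: eq_bigr => i _.
    by rewrite rmorphM mxE; ring.
  by rewrite exchange_big; apply: eq_bigr => i _; rewrite -mulr_suml mxE rmorph_sum.
have rankM : \rank M = #|P|.
  apply/eqP; rewrite -mxrank_tr -[_ == _]/(row_free _) -kermx_eq0.
  apply/rowV0P => c /sub_kermxP cM; apply/rowP => k; rewrite mxE.
  apply: (frb (fun k => c 0 k)); transitivity (vec _ b' c^T).
    by apply: eq_bigr => j _; rewrite mxE.
  rewrite vecM -[M]trmxK -trmx_mul cM trmx0 /vec big1 // => i _.
  by rewrite mxE rmorph0 mul0r.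
have rM g : psi g != 0 -> r g *m M = psi g *: M.
  move=> Hg; apply: trmx_inj; apply/row_matrixP => k; apply: trmx_inj.
  rewrite !tr_row !trmxK linearZ /= colE -mulmxA -colE.
  have /mem[c bc Hc] := b'V k; suff -> : col k M = c by exact: Hc.
  by apply: vec_inj; rewrite -HM.
apply/eqP; rewrite eqn_leq; apply/andP; split.
  have [C HC] : exists C, psi_mx psi r = M *m C.
    have Vj j : exists c, vec d e (col j (psi_mx psi r)) = vec d e (M *m c).
      have /spb[c Hc] : V (vec d e (col j (psi_mx psi r))) /\ (forall g, psi g != 0 ->
          T g (vec d e (col j (psi_mx psi r)))
          = iota (psi g) * vec d e (col j (psi_mx psi r))).
        apply/mem; exists (col j (psi_mx psi r)) => // g Hg.
        by rewrite colE mulmxA psi_mxMl // -scalemxAl.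
      exists (\col_i c i); rewrite Hc -vecM.
      by apply: eq_bigr => i _; rewrite mxE.
    have {}Vj j : exists c : {ffun 'I_#|P| -> K},
        col j (psi_mx psi r) = M *m \col_i c i.
      have [c /vec_inj Hc] := Vj j; exists [ffun i => c i 0]; rewrite Hc.
      by congr (_ *m _); apply/colP => i; rewrite !mxE ffunE.
    have [C HC] := fin_all_exists Vj; exists (\matrix_(i, j) C j i).
    apply: trmx_inj; apply/row_matrixP => k; apply: trmx_inj.
    rewrite !tr_row !trmxK HC colE -mulmxA; congr (_ *m _).
    by rewrite -colE; apply/colP => i; rewrite !mxE.
  by rewrite HC; apply: leq_trans (mxrankM_maxl _ _) _; rewrite rankM.
(* For the other inequality, [psi_mx] acts on eigenvectors as the nonzero scalar [psi_order], so its
   image contains the columns of [M]. *)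
rewrite -rankM -(mxrank_scale_nz M Hord).
suff <- : psi_mx psi r *m M = (psi_order psi)%:R *: M by apply: mxrankM_maxl.
rewrite psi_orderE // scaler_suml mulmx_suml; apply: eq_bigr => g _.
rewrite -scalemxAl; have [->|Hg] := eqVneq (psi g^-1%g) 0.
  by rewrite mul0r !scale0r.
by rewrite rM ?scalerA // -(psi_inv_neq0 Hpsi).
Qed.

End EigenRank.

(** * Forms and the function field *)

Notation o0 := (Ordinal (isT : (0 < 3)%N)).
Notation o1 := (Ordinal (isT : (1 < 3)%N)).
Notation o2 := (Ordinal (isT : (2 < 3)%N)).

Lemma big_ord3 (R : Type) (idx : R) (op : Monoid.law idx) (F : 'I_3 -> R) :
  \big[op/idx]_(i < 3) F i = op (op (F o0) (F o1)) (F o2).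
Proof.
rewrite !big_ord_recr big_ord0 Monoid.mul1m /=.
by congr (op (op _ _) _); congr F; apply: val_inj.
Qed.

Lemma ord3P (P : 'I_3 -> Prop) : P o0 -> P o1 -> P o2 -> forall i, P i.
Proof.
move=> H0 H1 H2 [[|[|[|i]]] Hi] //=.
- by have -> : Ordinal Hi = o0 by apply: val_inj.
- by have -> : Ordinal Hi = o1 by apply: val_inj.
- by have -> : Ordinal Hi = o2 by apply: val_inj.
Qed.

Section MpolyFacts.

Lemma mpoly_ring_ind k (R : comNzRingType) (P : {mpoly R[k]} -> Prop) :
    (forall c, P c%:MP) -> (forall i, P 'X_i) ->
    (forall p q, P p -> P q -> P (p + q)) ->
    (forall p q, P p -> P q -> P (p * q)) ->
  forall p, P p.
Proof.
move=> PC PX PD PM p; rewrite [p]mpolyE.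
apply: (big_ind P) => [|//|m _]; first by rewrite -mpolyC0.
rewrite -mul_mpolyC; apply: (PM) => //; rewrite mpolyXE_id.
apply: (big_ind P) => [|//|i _]; first by rewrite -mpolyC1.
by elim: (m i) => [|e IH]; rewrite ?exprS ?expr0 -?mpolyC1; auto.
Qed.

Lemma rmorph_mmap k (R : comNzRingType) (S T : comNzRingType)
    (f : {rmorphism R -> S}) (h : 'I_k -> S) (g : {rmorphism S -> T})
    (f' : {rmorphism R -> T}) (h' : 'I_k -> T) p :
  (forall c, g (f c) = f' c) -> (forall i, g (h i) = h' i) ->
  g (mmap f h p) = mmap f' h' p.
Proof.
move=> gf gh; elim/mpoly_ring_ind: p => [c|i|p q IHp IHq|p q IHp IHq].
- by rewrite !mmapC gf.
- by rewrite !mmapX !mmap1U gh.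
- by rewrite !rmorphD IHp IHq.
- by rewrite !rmorphM IHp IHq.
Qed.

Lemma mmap_dhomog_scale k (R : comNzRingType) (S : comNzRingType)
    (f : {rmorphism R -> S}) (h : 'I_k -> S) c d p : p \is d.-homog ->
  mmap f (fun i => c * h i) p = c ^+ d * mmap f h p.
Proof.
move=> /dhomogP Hp; rewrite /mmap mulr_sumr !big_seq; apply: eq_bigr => m /Hp Hm.
rewrite /mmap1; have -> : \prod_i (c * h i) ^+ m i = c ^+ d * \prod_i h i ^+ m i.
  rewrite -Hm /= mdegE; elim/big_rec3: _ => [|i a b e _ ->]; first by rewrite mulr1.
  by rewrite exprMn exprD; ring.
ring.
Qed.

Lemma dhomog_mderiv k (R : comNzRingType) d (p : {mpoly R[k]}) i :
  p \is d.-homog -> mderiv i p \is (d.-1).-homog.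
Proof.
move=> /dhomogP Hp; rewrite /mderiv big_seq; apply: rpred_sum => m /Hp /= Hm.
have [->|mi] := eqVneq (m i) 0%N; first by rewrite mul0r scale0r rpred0.
have le : (U_(i) <= m)%MM.
  by apply/mnm_lepP => j; rewrite mnm1E; case: eqP => [<-|]; rewrite ?lt0n.
by rewrite rpredZ // dhomogX /= -Hm -{2}(submK le) mdegD mdeg1 addn1.
Qed.

Lemma derivation_mmap k (K L : fieldType) (iota : {rmorphism K -> L})
    (D : L -> L) (h : 'I_k -> L) p :
    (forall f g, D (f + g) = D f + D g) ->
    (forall f g, D (f * g) = D f * g + f * D g) ->
    (forall c, D (iota c) = 0) ->
  D (mmap iota h p) = \sum_i mmap iota h (mderiv i p) * D (h i).
Proof.
move=> Dadd Dmul DC; elim/mpoly_ring_ind: p => [c|i|p q IHp IHq|p q IHp IHq].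
- by rewrite mmapC DC big1 // => i _; rewrite mderivC rmorph0 mul0r.
- rewrite mmapX mmap1U (bigD1 i) //= big1 ?addr0 => [|j /negPf ji].
    rewrite mderivX mnm1E eqxx scale1r (_ : U_(i) - U_(i) = 0)%MM.
      by rewrite mpolyX0 rmorph1 mul1r.
    by apply/mnmP => j; rewrite mnmBE subnn mnm0E.
  by rewrite mderivX mnm1E eq_sym ji scale0r rmorph0 mul0r.
- rewrite rmorphD Dadd IHp IHq -big_split; apply: eq_bigr => i _ /=.
  by rewrite mderivD rmorphD mulrDl.
- rewrite rmorphM Dmul IHp IHq mulr_suml mulr_sumr -big_split.
  by apply: eq_bigr => i _ /=; rewrite mderivM rmorphD !rmorphM /=; ring.
Qed.

End MpolyFacts.

(** * Forms as polynomials in two variables *)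

Section Bivariate.

Variable K : fieldType.

(* F(X, Y, 1), where X is the inner variable and Y the outer one. *)
Definition dehom (F : {mpoly K[3]}) : {poly {poly K}} :=
  mmap (polyC \o polyC) (fun i : 'I_3 => [:: 'X%:P; 'X; 1]`_i) F.

Fact dehom_is_zmod_morphism : zmod_morphism dehom.
Proof. exact: mmap_is_additive. Qed.
Fact dehom_is_monoid_morphism : monoid_morphism dehom.
Proof.
by split; [exact: (mmap_is_multiplicative _ _).2
          |exact: (mmap_is_multiplicative _ _).1].
Qed.
HB.instance Definition _ :=
  GRing.isZmodMorphism.Build _ _ dehom dehom_is_zmod_morphism.
HB.instance Definition _ :=
  GRing.isMonoidMorphism.Build _ _ dehom dehom_is_monoid_morphism.

Lemma dehomXU (i : 'I_3) : dehom 'X_i = [:: 'X%:P; 'X; 1]`_i.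
Proof. by rewrite /dehom mmapX mmap1U. Qed.

Definition deg_le (e : nat) (B : {poly {poly K}}) :=
  forall j k, B`_j`_k != 0 -> (j + k <= e)%N.

Definition homogenize (e : nat) (B : {poly {poly K}}) : {mpoly K[3]} :=
  \sum_(j < size B) \sum_(k < size B`_j)
    B`_j`_k *: ('X_o0 ^+ k * 'X_o1 ^+ j * 'X_o2 ^+ (e - (j + k))).

Lemma dhomogXU (i : 'I_3) : ('X_i : {mpoly K[3]}) \is 1.-homog.
Proof. by rewrite dhomogX /= mdeg1. Qed.

Lemma dhomogXn (i : 'I_3) k : ('X_i ^+ k : {mpoly K[3]}) \is k.-homog.
Proof. by have := dhomogMn k (dhomogXU i); rewrite mul1n. Qed.

Lemma homogenize_homog e B : deg_le e B -> homogenize e B \is e.-homog.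
Proof.
move=> H; apply: rpred_sum => j _; apply: rpred_sum => k _.
have [->|/H le] := eqVneq (B`_j`_k) 0; first by rewrite scale0r rpred0.
rewrite rpredZ // -(subnKC le); apply: dhomogM; last by rewrite addKn dhomogXn.
by rewrite addnC; apply: dhomogM; exact: dhomogXn.
Qed.

Lemma homogenizeK e B : dehom (homogenize e B) = B.
Proof.
rewrite /homogenize rmorph_sum -[RHS]coefK poly_def; apply: eq_bigr => j _ /=.
rewrite rmorph_sum -[X in _ = X *: _]coefK poly_def -mul_polyC rmorph_sum mulr_suml /=.
apply: eq_bigr => k _; rewrite [LHS]mmapZ -/(dehom _) !rmorphM !rmorphXn /=.
rewrite !dehomXU /= expr1n mulr1 -mul_polyC rmorphM rmorphXn /=.
by rewrite mulrA.
Qed.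

Lemma deg_le_exists B : exists e, deg_le e B.
Proof.
exists (size B + \max_(j < size B) size (B`_j)%R)%N => j k H.
have Hj : (j < size B)%N.
  by rewrite ltnNge; apply: contraNN H => /(nth_default 0) ->; rewrite coef0.
have Hk : (k < size (B`_j)%R)%N.
  by rewrite ltnNge; apply: contraNN H => /(nth_default 0) ->.
apply: leq_add; rewrite ltnW //; apply: leq_trans Hk _.
exact: (@leq_bigmax _ (fun j : 'I_(size B) => size (B`_j)%R) (Ordinal Hj)).
Qed.

Lemma dehom_fermat n : dehom (fermat_poly K n) = 'X^n + ('X^n + 1)%:P.
Proof.
rewrite /fermat_poly rmorph_sum big_ord3 !rmorphXn /= !dehomXU /=.
by rewrite expr1n rmorphD rmorph1 rmorphXn /= addrAC addrC addrA.
Qed.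

Definition at_x (a : K) : {poly {poly K}} -> {poly K} := map_poly (horner_eval a).
HB.instance Definition _ a := GRing.RMorphism.on (at_x a).

Lemma at_xM a B C : at_x a (B * C) = at_x a B * at_x a C.
Proof. exact: rmorphM. Qed.

Lemma at_xD a B C : at_x a (B + C) = at_x a B + at_x a C.
Proof. exact: rmorphD. Qed.

Lemma at_xC a p : at_x a p%:P = p.[a]%:P.
Proof. exact: map_polyC. Qed.

Lemma rmorph_dehom (T : comNzRingType) (g : {rmorphism {poly {poly K}} -> T})
    (f : {rmorphism K -> T}) (h : 'I_3 -> T) F :
    (forall c, g c%:P%:P = f c) -> g 'X%:P = h o0 -> g 'X = h o1 -> 1 = h o2 ->
  g (dehom F) = mmap f h F.
Proof.
move=> gC g0 g1 g2; apply: rmorph_mmap => [c|]; first exact: gC.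
by apply: ord3P; rewrite /= ?rmorph1.
Qed.

Lemma at_x_dehom a b F :
  (at_x a (dehom F)).[b] = F.@[(fun i : 'I_3 => [:: a; b; 1]`_i)].
Proof.
pose g : {rmorphism {poly {poly K}} -> K} := horner_eval b \o at_x a.
have gE B : g B = (at_x a B).[b] by [].
rewrite -gE (rmorph_dehom (f := idfun) (h := fun i : 'I_3 => [:: a; b; 1]`_i)) //.
- by move=> c; rewrite gE /at_x map_polyC /= /horner_eval !hornerC.
- by rewrite gE /at_x map_polyC /= /horner_eval hornerX hornerC.
- by rewrite gE /at_x map_polyX hornerX.
Qed.

End Bivariate.

Section FunctionField.

Variables (K L : fieldType) (n : nat) (iota : {rmorphism K -> L}) (x y : L).
Hypothesis n_gt0 : (0 < n)%N.
Hypothesis HL : fermat_function_field n iota x y.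

Definition evx : {poly K} -> L := horner_eval x \o map_poly iota.
HB.instance Definition _ := GRing.RMorphism.on evx.

Definition ev : {poly {poly K}} -> L := horner_eval y \o map_poly evx.
HB.instance Definition _ := GRing.RMorphism.on ev.

Lemma evxC c : evx c%:P = iota c.
Proof. by rewrite /evx /= /horner_eval map_polyC hornerC. Qed.

Lemma evxX : evx 'X = x.
Proof. by rewrite /evx /= /horner_eval map_polyX hornerX. Qed.

Lemma evC p : ev p%:P = evx p.
Proof. by rewrite /ev /= /horner_eval map_polyC hornerC. Qed.

Lemma evX : ev 'X = y.
Proof. by rewrite /ev /= /horner_eval map_polyX hornerX. Qed.

Fact dehomog_is_zmod_morphism : zmod_morphism (dehomog iota x y).
Proof. exact: mmap_is_additive. Qed.
Fact dehomog_is_monoid_morphism : monoid_morphism (dehomog iota x y).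
Proof.
by split; [exact: (mmap_is_multiplicative _ _).2
          |exact: (mmap_is_multiplicative _ _).1].
Qed.
HB.instance Definition _ :=
  GRing.isZmodMorphism.Build _ _ (dehomog iota x y) dehomog_is_zmod_morphism.
HB.instance Definition _ :=
  GRing.isMonoidMorphism.Build _ _ (dehomog iota x y)
    dehomog_is_monoid_morphism.

Lemma evM (B C : {poly {poly K}}) : ev (B * C) = ev B * ev C.
Proof. exact: rmorphM. Qed.

Lemma evD (B C : {poly {poly K}}) : ev (B + C) = ev B + ev C.
Proof. exact: rmorphD. Qed.

Lemma evN (B : {poly {poly K}}) : ev (- B) = - ev B.
Proof. by apply/eqP; rewrite -addr_eq0 -evD addNr /ev rmorph0. Qed.

Lemma evB (B C : {poly {poly K}}) : ev (B - C) = ev B - ev C.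
Proof. by rewrite evD evN. Qed.

Lemma evXn (B : {poly {poly K}}) k : ev (B ^+ k) = ev B ^+ k.
Proof. exact: rmorphXn. Qed.

Lemma ev_dehom F : ev (dehom F) = dehomog iota x y F.
Proof.
rewrite (rmorph_dehom (f := iota) (h := fun i : 'I_3 => [:: x; y; 1]`_i)) //.
- by move=> c; rewrite /= evC evxC.
- by rewrite /= evC evxX.
- by rewrite /= evX.
Qed.

Local Notation fp := ('X^n + ('X^n + 1)%:P : {poly {poly K}}).

Lemma size_fp : size fp = n.+1.
Proof.
rewrite size_polyDl ?size_polyXn //; apply: leq_ltn_trans (size_polyC_leq1 _) _.
by rewrite ltnS.
Qed.

Lemma fp_monic : fp \is monic.
Proof.
apply/monicP; rewrite lead_coefDl ?lead_coefXn // size_polyXn.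
by apply: leq_ltn_trans (size_polyC_leq1 _) _; rewrite ltnS.
Qed.

(** The vanishing criterion for forms, carried to affine polynomials by homogenizing in a
    sufficiently large degree. *)
Lemma ev_eq0 B : ev B = 0 <-> exists Q, B = Q * fp.
Proof.
have vF d F := fff_vanish HL (d := d) (F := F); split=> [B0|[Q ->]].
  have [e He] := deg_le_exists B.
  have [H _] := vF _ _ (homogenize_homog He).
  case: H => [|Q /(congr1 (@dehom K))]; first by rewrite -ev_dehom homogenizeK.
  by rewrite homogenizeK rmorphM /= dehom_fermat => BE; exists (dehom Q).
rewrite rmorphM /= -dehom_fermat ev_dehom; apply/eqP; rewrite mulf_eq0 orbC.
apply/orP; left; apply/eqP; apply/(vF n).
  by apply: rpred_sum => i _; exact: dhomogXn.
by exists 1; rewrite mul1r.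
Qed.

(** The equation is monic of degree [n] in the outer variable, so a nonzero multiple of it has
    degree at least [n]. Equivalently, 1, y, ..., y^(n-1) are independent over K[x]. *)
Lemma ev_small (B : {poly {poly K}}) : (size B <= n)%N -> ev B = 0 -> B = 0.
Proof.
move=> sB /ev_eq0 [Q BE]; move: sB; rewrite BE.
have [->|nzQ] := eqVneq Q 0; first by rewrite mul0r.
rewrite size_Mmonic ?fp_monic // size_fp addnS /= leqNgt.
by rewrite -[X in (X < _)%N]add0n ltn_add2r size_poly_gt0 nzQ.
Qed.

Lemma ev_rmod (B : {poly {poly K}}) : exists2 B' : {poly {poly K}}, (size B' <= n)%N & ev B = ev B'.
Proof.
have := Pdiv.RingMonic.rdivp_eq fp_monic B.
have := Pdiv.Ring.ltn_rmodpN0 B (monic_neq0 fp_monic).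
set B' := Pdiv.Ring.rmodp _ _; rewrite size_fp ltnS => sB' ->.
exists B' => //; rewrite rmorphD /= (_ : ev (Pdiv.Ring.rdivp B fp * fp) = 0) ?add0r //.
by apply/ev_eq0; exists (Pdiv.Ring.rdivp B fp).
Qed.

Lemma evx_inj : injective evx.
Proof.
apply: raddf_inj => p p0; apply/eqP; rewrite -polyC_eq0; apply/eqP.
by apply: ev_small; rewrite ?evC //; apply: leq_trans (size_polyC_leq1 _) _.
Qed.

End FunctionField.

(** * Fractions with denominators in K[x] *)

Section Fractions.

Variables (K L : fieldType) (n : nat) (iota : {rmorphism K -> L}) (x y : L).
Hypothesis n_gt0 : (0 < n)%N.
Hypothesis HL : fermat_function_field n iota x y.

Local Notation evx := (evx iota x).
Local Notation ev := (ev iota x y).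

Lemma ev_coef (B : {poly {poly K}}) m : (size B <= m)%N ->
  ev B = \sum_(k < m) evx B`_k * y ^+ k.
Proof.
move=> sB; rewrite /ev /= /horner_eval (horner_coef_wide _ (n := m)).
  by apply: eq_bigr => k _; rewrite coef_map.
by apply: leq_trans (size_poly _ _) _.
Qed.

(** The polynomial [c] is the norm of [ev C]: the determinant of the matrix [M] of multiplication by
    [ev C] on the K[x]-module with basis 1, y, ..., y^(n-1). A kernel vector of [M] would make
    [ev C] a zero divisor. *)
Lemma ev_norm (C : {poly {poly K}}) : ev C != 0 ->
  exists c (B : {poly {poly K}}), c != 0 /\ evx c = ev C * ev B.
Proof.
move=> nzC.
have H (j : 'I_n) : exists B : {poly {poly K}},
    (size B <= n)%N /\ ev B = ev C * y ^+ j.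
  have [B sB evB] := ev_rmod n_gt0 HL (C * 'X^j).
  by exists B; split=> //; rewrite -evB rmorphM rmorphXn /= evX.
have {H} [B_ HB] := fin_all_exists H.
pose M := \matrix_(j < n, k < n) (B_ j)`_k.
have HM j : \sum_k evx (M j k) * y ^+ k = ev C * y ^+ j.
  have [sB <-] := HB j; rewrite (ev_coef sB).
  by apply: eq_bigr => k _; rewrite mxE.
have mulM (u : 'rV_n) : \sum_k evx ((u *m M) 0 k) * y ^+ k
    = ev C * \sum_j evx (u 0 j) * y ^+ j.
  rewrite mulr_sumr.
  rewrite (eq_bigr (fun k => \sum_j evx (u 0 j) * (evx (M j k) * y ^+ k))).
    rewrite exchange_big; apply: eq_bigr => j _.
    by rewrite -mulr_sumr HM; ring.
  move=> k _; rewrite mxE rmorph_sum mulr_suml; apply: eq_bigr => j _.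
  by rewrite rmorphM mulrA.
have evpoly (u : 'rV_n) : ev (\poly_(j < n) (if insub j is Some i then u 0 i else 0))
    = \sum_j evx (u 0 j) * y ^+ j.
  rewrite (ev_coef (size_poly _ _)); apply: eq_bigr => j _.
  by rewrite coef_poly ltn_ord valK.
have nzM : \det M != 0.
  apply/negP => /det0P[u nzu uM0].
  have := mulM u; rewrite uM0 big1; last by move=> k _; rewrite mxE rmorph0 mul0r.
  move=> /esym/eqP; rewrite mulf_eq0 (negPf nzC) /= -evpoly => /eqP.
  move/(ev_small n_gt0 HL (size_poly _ _)) => u0; case/eqP: nzu.
  apply/rowP => j; rewrite mxE.
  by have := congr1 (fun p : {poly _} => p`_j) u0; rewrite coef_poly ltn_ord valK coef0.
(* Row 0 of the adjugate is sent by [M] to the determinant times the basis element [y^0 = 1], so it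
   holds the coefficients of the cofactor [B]. *)
pose u := row (Ordinal n_gt0) (\adj M).
exists (\det M), (\poly_(j < n) (if insub j is Some i then u 0 i else 0)); split=> //.
rewrite (evpoly u) -mulM -row_mul mul_adj_mx (bigD1 (Ordinal n_gt0)) //= big1.
  by rewrite !mxE eqxx expr0 mulr1 mulr1n addr0.
move=> k /negPf nk; rewrite !mxE eq_sym nk mulr0n rmorph0 mul0r.
by [].
Qed.

Lemma ev_fraction f : exists (B : {poly {poly K}}) q,
  [/\ (size B <= n)%N, q != 0 & f = ev B / evx q].
Proof.
have [d [F [H [_ _ nzH ->]]]] := fff_generated HL f.
rewrite -!ev_dehom in nzH *.
have [c [B [nzc cE]]] := ev_norm nzH.
have [B' sB' B'E] := ev_rmod n_gt0 HL (dehom F * B).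
exists B', c; split=> //; rewrite -B'E rmorphM cE /=.
have nzB : ev B != 0.
  apply: contraNneq nzc => B0; apply/eqP/(evx_inj n_gt0 HL).
  by rewrite rmorph0 cE B0 mulr0.
have nzc' : evx c != 0 by rewrite cE mulf_neq0.
move: (ev (dehom H)) (ev (dehom F)) (ev B) nzH nzB => a1 a2 a3 nz1 nz3.
by field; rewrite nz3.
Qed.

End Fractions.

(** * Functions regular on the affine part of the curve *)

Section Regular.

Variables (K L : fieldType) (n : nat).
Variables (iota : {rmorphism K -> L}) (x y : L) (zeta : K).
Hypothesis n_gt0 : (0 < n)%N.
Hypothesis K_closed : forall q : {poly K}, size q != 1%N -> exists a, root q a.
Hypothesis Hzeta : n.-primitive_root zeta.
Hypothesis HL : fermat_function_field n iota x y.

Local Notation evx := (evx iota x).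
Local Notation ev := (ev iota x y).

Lemma nth_roots (c : K) : c != 0 ->
  exists s : seq K, [/\ uniq s, size s = n & forall b, b \in s -> b ^+ n = c].
Proof.
move=> nzc; have [|w /rootP] := @K_closed ('X^n - c%:P).
  by rewrite size_XnsubC // eqSS -lt0n.
rewrite !hornerE => /subr0_eq Hw.
have nzw : w != 0 by apply: contraNneq nzc => w0; rewrite -Hw w0 expr0n gtn_eqF.
exists [seq w * zeta ^+ (i : 'I_n) | i : 'I_n]; split.
- rewrite map_inj_uniq ?enum_uniq // => i j /(mulfI nzw)/eqP.
  rewrite (eq_prim_root_expr Hzeta) !modn_small // => /eqP ij.
  exact: val_inj.
- by rewrite size_map -cardE card_ord.
move=> b /mapP[i _ ->].
by rewrite exprMn Hw exprAC (prim_expr_order Hzeta) expr1n mulr1.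
Qed.

Lemma small_poly_root_vanish (p : {poly K}) c : c != 0 -> (size p <= n)%N ->
  (forall b, b ^+ n = c -> p.[b] = 0) -> p = 0.
Proof.
move=> /nth_roots[s [us ss Hs]] sp H; apply: roots_geq_poly_eq0 us _; last by rewrite ss.
by apply/allP => b /Hs /H /eqP.
Qed.

Definition point (a b c : K) : 'I_3 -> K := fun i => [:: a; b; c]`_i.

Lemma fermat_pointE a b c : (a != 0) || (b != 0) || (c != 0) ->
  a ^+ n + b ^+ n + c ^+ n = 0 -> fermat_point n (point a b c).
Proof.
move=> nz H; split.
  by case/orP: nz => [/orP[]|] nz; [exists o0|exists o1|exists o2].
by rewrite /fermat_poly rmorph_sum big_ord3 !rmorphXn /= !mevalXU.
Qed.

Lemma dehomog_neq0 P d (H : {mpoly K[3]}) : fermat_point n P ->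
  H \is d.-homog -> H.@[P] != 0 -> dehomog iota x y H != 0.
Proof.
move=> [_ FP] hH; apply: contra_neq => /(fff_vanish HL hH)[Q ->].
by rewrite rmorphM /= FP mulr0.
Qed.

Lemma at_x_fermat (a : K) :
  at_x a ('X^n + ('X^n + 1)%:P) = 'X^n + (a ^+ n + 1)%:P.
Proof.
by rewrite at_xD at_xC !hornerE /at_x rmorphXn /= map_polyX.
Qed.

Lemma at_x_eq0 (a : K) (B : {poly {poly K}}) : at_x a B = 0 ->
  exists B', B = ('X - a%:P)%:P * B'.
Proof.
move=> H; have Ba k : root B`_k a.
  by rewrite -[_ a]/(_ == 0) -[_.[a]]/(horner_eval a _) -coef_map -/(at_x a) H coef0.
exists (map_poly (fun p => p %/ ('X - a%:P)) B); apply/polyP => k.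
rewrite coefCM coef_map_id0 ?div0p // mulrC divpK //.
by rewrite dvdp_XsubCl.
Qed.

(* Write g = B(x, y) / q(x) with deg_y B < n. If q(a) = 0 then B(a, Y) vanishes
   on the fibre over x = a, which has n points, or one point of multiplicity n
   when a^n = -1; so X - a divides B and can be cancelled. *)
Lemma regular_affine g :
    (forall P, fermat_point n P -> P o2 != 0 -> local_ring iota x y P g) ->
  exists2 B : {poly {poly K}}, (size B <= n)%N & g = ev B.
Proof.
move=> Hg; have [B [q [sB nzq gE]]] := ev_fraction n_gt0 HL g.
have evx_neq0 q' : q' != 0 -> evx q' != 0.
  by apply: contra_neq => /eqP; rewrite -(rmorph0 evx) (inj_eq (evx_inj n_gt0 HL)) => /eqP.
have [r ler] := ubnP (size q).
elim: r => // r IHr in B q sB nzq gE ler *.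
have [sq|] := leqP (size q) 1.
  have [c nzc qE] : exists2 c, c != 0 & q = c%:P.
    by apply/size_poly1P; rewrite eqn_leq sq size_poly_gt0.
  exists ((c^-1)%:P%:P * B).
    by rewrite size_Cmul // polyC_eq0 invr_eq0.
  rewrite gE qE evxC rmorphM /= evC evxC fmorphV; exact: mulrC.
move=> sq; have [a /rootP qa] : exists a, root q a.
  by apply: K_closed; rewrite neq_ltn sq orbT.
have key b : a ^+ n + b ^+ n + 1 = 0 -> exists2 Hp : {poly K}, Hp.[b] != 0
    & exists Q, at_x a B * Hp = Q * ('X^n + (a ^+ n + 1)%:P).
  move=> ab; have fP : fermat_point n (point a b 1).
    by apply: fermat_pointE; rewrite ?oner_eq0 ?orbT ?expr1n.
  have [d [F [H [_ hH HP gFH]]]] := Hg _ fP (oner_neq0 _).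
  exists (at_x a (dehom H)); first by rewrite at_x_dehom.
  have /(ev_eq0 HL)[Q QE] : ev (B * dehom H - q%:P * dehom F) = 0.
    rewrite evB !evM evC !ev_dehom.
    have nzH := dehomog_neq0 fP hH HP.
    apply/eqP; rewrite subr_eq0; apply/eqP.
    have := gFH; rewrite gE => /eqP; rewrite eqr_div ?evx_neq0 // => /eqP ->.
    exact: mulrC.
  have {}QE : B * dehom H = Q * ('X^n + ('X^n + 1)%:P) + q%:P * dehom F.
    by rewrite -QE subrK.
  exists (at_x a Q); move/(congr1 (at_x a)): QE.
  by rewrite at_xD !at_xM at_x_fermat at_xC qa mul0r addr0.
have sBa : (size (at_x a B) <= n)%N by apply: leq_trans (size_poly _ _) _.
have Ba0 : at_x a B = 0.
  have [an|an] := eqVneq (a ^+ n + 1) 0.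
    have [|Hp Hp0 [Q QE]] := key 0; first by rewrite expr0n gtn_eqF // addr0.
    move: QE; rewrite an addr0 => QE.
    have co : coprimep 'X^n Hp.
      apply: coprimep_expl; rewrite coprimep_sym -['X]subr0 -polyC0.
      by rewrite coprimep_XsubC.
    have : 'X^n %| at_x a B * Hp by rewrite QE dvdp_mulIr.
    rewrite Gauss_dvdpl // => /dvdp_leq; rewrite size_polyXn => dv.
    by apply/eqP; apply: contraTT sBa => /dv; rewrite -ltnNge.
  apply: (small_poly_root_vanish (c := - (a ^+ n + 1))); rewrite ?oppr_eq0 //.
  move=> b bn; have [|Hp Hpb [Q /(congr1 (fun p => p.[b]))]] := key b.
    by rewrite bn; ring.
  rewrite !hornerM hornerD hornerXn hornerC bn addNr mulr0 => /eqP.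
  by rewrite mulf_eq0 (negPf Hpb) orbF => /eqP.
have [B' BE] := at_x_eq0 Ba0.
have /factor_theorem[q' qE] : root q a by apply/rootP.
have nzXa : 'X - a%:P != 0 by rewrite polyXsubC_eq0.
have nzq' : q' != 0 by apply: contraNneq nzq => q'0; rewrite qE q'0 mul0r.
apply: (IHr B' q') => //.
- have [->|nzB'] := eqVneq B' 0; first by rewrite size_poly0.
  by move: sB; rewrite BE size_Cmul.
- rewrite gE BE qE evM evC rmorphM /=.
  have := evx_neq0 _ nzXa; have := evx_neq0 _ nzq'.
  move: (evx _) (evx _) (ev _) => a1 a2 a3 nz1 nz2.
  by field; rewrite nz1.
- by move: ler; rewrite qE size_Mmonic ?monicXsubC // size_XsubC addn2 /= ltnS.
Qed.

End Regular.

(** * Holomorphic differentials *)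

Section LocalRing.

Variables (K L : fieldType) (n : nat) (iota : {rmorphism K -> L}) (x y : L).
Hypothesis HL : fermat_function_field n iota x y.
Variable P : 'I_3 -> K.
Hypothesis HP : fermat_point n P.

Local Notation dh := (dehomog iota x y).
Local Notation loc := (local_ring iota x y P).

Lemma local_ring_frac d (F H : {mpoly K[3]}) :
  F \is d.-homog -> H \is d.-homog -> H.@[P] != 0 -> loc (dh F / dh H).
Proof. by move=> hF hH nz; exists d, F, H. Qed.

Lemma local_ringC c : loc (iota c).
Proof.
have hC e : (e%:MP : {mpoly K[3]}) \is 0.-homog.
  by rewrite -[e%:MP]mulr1 mul_mpolyC; apply: dhomogZ; exact: dhomog1.
have -> : iota c = dh c%:MP / dh 1%:MP by rewrite /dehomog !mmapC /= rmorph1 divr1.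
by apply: local_ring_frac (hC _) (hC _) _; rewrite mevalC oner_neq0.
Qed.

Lemma local_ringM f g : loc f -> loc g -> loc (f * g).
Proof.
move=> [d [F [H [hF hH HH ->]]]] [e [G [I [hG hI HI ->]]]].
have -> : dh F / dh H * (dh G / dh I) = dh (F * G) / dh (H * I).
  by rewrite !rmorphM /= invfM mulrACA.
apply: local_ring_frac (dhomogM hF hG) (dhomogM hH hI) _.
by rewrite mevalM mulf_neq0.
Qed.

Lemma local_ringD f g : loc f -> loc g -> loc (f + g).
Proof.
move=> [d [F [H [hF hH HH ->]]]] [e [G [I [hG hI HI ->]]]].
have nzH := dehomog_neq0 HL HP hH HH; have nzI := dehomog_neq0 HL HP hI HI.
have -> : dh F / dh H + dh G / dh I = dh (F * I + H * G) / dh (H * I).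
  by rewrite rmorphD !rmorphM /= addf_div // [dh G * _]mulrC.
apply: (local_ring_frac (d := d + e)).
- by rewrite rpredD // dhomogM.
- exact: dhomogM.
by rewrite mevalM mulf_neq0.
Qed.

Lemma local_ring_sum I (r : seq I) (Q : pred I) F :
  (forall i, Q i -> loc (F i)) -> loc (\sum_(i <- r | Q i) F i).
Proof.
move=> HF; apply: (big_ind loc) => //; last exact: local_ringD.
by rewrite -(rmorph0 iota); apply: local_ringC.
Qed.

Lemma local_ring_prod I (r : seq I) (Q : pred I) F :
  (forall i, Q i -> loc (F i)) -> loc (\prod_(i <- r | Q i) F i).
Proof.
move=> HF; apply: (big_ind loc) => //; last exact: local_ringM.
by rewrite -(rmorph1 iota); apply: local_ringC.
Qed.

Lemma derivation_div (D : L -> L) f h :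
    (forall f g, D (f * g) = D f * g + f * D g) -> h != 0 ->
  D (f / h) = (D f * h - f * D h) / h ^+ 2.
Proof.
move=> Dmul nzh; have := Dmul (f / h) h; rewrite divfK // => ->.
by field.
Qed.

(** The [T i] are the affine coordinates X_i / X_k. As [c D] sends each to a form of degree [n - 1]
    in them, the quotient rule for F/H gives a numerator of degree [2 (d + 1) + (n - 2)] over [H^2];
    the excess [n - 2] is compensated by a power of X_k, which does not vanish at [P]. *)
Lemma derivation_local (D : L -> L) (T : 'I_3 -> L) (R : 'I_3 -> {mpoly K[3]})
    (k : 'I_3) c u :
    (forall f g, D (f + g) = D f + D g) ->
    (forall f g, D (f * g) = D f * g + f * D g) ->
    (forall a, D (iota a) = 0) ->
    (1 < n)%N -> P k != 0 -> dh 'X_k != 0 ->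
    (forall i, T i = (dh 'X_k)^-1 * dh 'X_i) ->
    (forall i, R i \is (n.-1).-homog) ->
    (forall i, c * D (T i) = mmap iota T (R i)) ->
  loc u -> loc (c * D u).
Proof.
move=> Dadd Dmul DC n_gt1 Pk nzk TE hR RE [d [F [H [hF hH HH ->]]]].
have hF' := dhomogM hF (dhomogXU K k); have hH' := dhomogM hH (dhomogXU K k).
have nzH := dehomog_neq0 HL HP hH HH.
(* Raising the degree to [d + 1] ensures that partial derivatives have degree exactly one less, also
   when the original degree is 0. *)
have -> : dh F / dh H = dh (F * 'X_k) / dh (H * 'X_k).
  by rewrite !rmorphM /= -mulf_div divff ?mulr1.
have {HH} HH : (H * 'X_k).@[P] != 0 by rewrite mevalM mevalXU mulf_neq0.
move: (F * 'X_k) (H * 'X_k) hF' hH' HH => {hF hH nzH}F {}H; rewrite addn1 => hF hH HH.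
have nzH := dehomog_neq0 HL HP hH HH.
pose t := mmap iota T.
have tE e G : G \is e.-homog -> t G = (dh 'X_k)^-1 ^+ e * dh G.
  move=> hG; rewrite -(mmap_dhomog_scale _ _ _ hG) /t /mmap.
  apply: eq_bigr => q _; congr (_ * _); apply: mmap1_eq => i.
  by rewrite TE; congr (_ * _); rewrite /dehomog mmapX mmap1U.
(* [M] lifts the derivation [c D] to forms. *)
pose M (G : {mpoly K[3]}) := \sum_i mderiv i G * R i.
have DM G : c * D (t G) = t (M G).
  rewrite derivation_mmap // mulr_sumr /t /M rmorph_sum; apply: eq_bigr => i _ /=.
  by rewrite mulrCA RE rmorphM.
have hM G : G \is (d.+1).-homog -> M G \is (d + n.-1).-homog.
  move=> hG; apply: rpred_sum => i _; apply: dhomogM (hR i).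
  exact: (dhomog_mderiv _ hG).
have nzt : t H != 0.
  by rewrite (tE _ _ hH) mulf_neq0 // expf_neq0 // invr_neq0.
have -> : dh F / dh H = t F / t H.
  by rewrite (tE _ _ hF) (tE _ _ hH) -mulf_div divff ?mul1r // expf_neq0 // invr_neq0.
rewrite derivation_div // mulrA mulrBr [X in X - _]mulrA.
rewrite [X in _ - X]mulrCA !DM.
have -> : t (M F) * t H - t F * t (M H) = t (M F * H - F * M H).
  by rewrite /t rmorphB !rmorphM.
have hN : M F * H - F * M H \is (d + n.-1 + d.+1).-homog.
  rewrite rpredB //; first exact: (dhomogM (hM _ hF) hH).
  by rewrite addnC; exact: (dhomogM hF (hM _ hH)).
rewrite (tE _ _ hN) (tE _ _ hH).
have -> : (dh 'X_k)^-1 ^+ (d + n.-1 + d.+1) * dh (M F * H - F * M H)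
    / ((dh 'X_k)^-1 ^+ d.+1 * dh H) ^+ 2
    = dh (M F * H - F * M H) / dh (H ^+ 2 * 'X_k ^+ (n - 2)).
  rewrite rmorphM !rmorphXn /=.
  have -> : (d + n.-1 + d.+1 = d.+1 * 2 + (n - 2))%N by lia.
  move: (dh _) (dh H) (dh _) nzk nzH => a b e nza nzb.
  rewrite exprD exprM exprMn !exprVn.
  field.
  by rewrite nzb !expf_neq0.
apply: (local_ring_frac hN).
  have -> : (d + n.-1 + d.+1 = d.+1 * 2 + (n - 2))%N by lia.
  by apply: dhomogM; [exact: dhomogMn | exact: dhomogXn].
by rewrite mevalM !rmorphXn /= mevalXU mulf_neq0 // expf_neq0.
Qed.

End LocalRing.

Section Holomorphic.

Variables (K L : fieldType) (n : nat) (iota : {rmorphism K -> L}) (x y : L).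
Variables (zeta : K) (D : L -> L).
Hypothesis n_gt3 : (3 < n)%N.
Hypothesis n_neq0 : n%:R != 0 :> K.
Hypothesis K_closed : forall q : {poly K}, size q != 1%N -> exists a, root q a.
Hypothesis Hzeta : n.-primitive_root zeta.
Hypothesis HL : fermat_function_field n iota x y.
Hypothesis HD : is_ddx iota x D.

Let n_gt0 : (0 < n)%N. Proof. by apply: leq_trans n_gt3. Qed.
Local Notation ev := (ev iota x y).
Local Notation dh := (dehomog iota x y).
Local Notation loc := (local_ring iota x y).

Lemma dehomogXU i : dh 'X_i = [:: x; y; 1]`_i.
Proof. by rewrite /dehomog mmapX mmap1U. Qed.

Lemma fermat_eq : x ^+ n + y ^+ n + 1 = 0.
Proof.
have h : (fermat_poly K n) \is n.-homog by apply: rpred_sum => i _; exact: dhomogXn.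
have [_ H] := fff_vanish HL h; have := H (ex_intro _ 1 (esym (mul1r _))).
by rewrite /fermat_poly rmorph_sum big_ord3 !rmorphXn /= !dehomogXU /= expr1n.
Qed.

Lemma x_neq0 : x != 0.
Proof.
rewrite -(evxX iota x); apply/eqP => x0; have := polyX_eq0 K.
by rewrite (_ : 'X = 0) ?eqxx //; apply: (evx_inj n_gt0 HL); rewrite x0 rmorph0.
Qed.

Lemma y_neq0 : y != 0.
Proof.
rewrite -(evX iota x y); apply/eqP => /(ev_small n_gt0 HL) H.
have : (size ('X : {poly {poly K}}) <= n)%N by rewrite size_polyX; apply: ltn_trans n_gt3.
by move/H/eqP; rewrite polyX_eq0.
Qed.

Let Dadd := ddx_add HD.
Let Dmul := ddx_mul HD.
Let DC := ddx_const HD.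
Let Dx := ddx_x HD.

Lemma derivationX f k : D (f ^+ k) = k%:R * f ^+ k.-1 * D f.
Proof.
elim: k => [|k IH]; first by rewrite expr0 -(rmorph1 iota) DC !mul0r.
rewrite exprS Dmul IH /=; case: k {IH} => [|k]; first by rewrite expr0; ring.
by rewrite /= exprS -[k.+2]addn1 natrD; ring.
Qed.

Lemma D1 : D 1 = 0. Proof. by rewrite -(rmorph1 iota). Qed.

Lemma Dy : y ^+ n.-1 * D y = - x ^+ n.-1.
Proof.
have nL : n%:R != 0 :> L by rewrite -(rmorph_nat iota) fmorph_eq0.
apply: (mulfI nL); have := congr1 D fermat_eq.
have -> : (0 : L) = iota 0 by rewrite rmorph0.
rewrite !Dadd !derivationX D1 DC Dx => /eqP; rewrite addr0 mulr1 addrC addr_eq0.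
by move/eqP; rewrite -mulrA mulrN.
Qed.

Lemma Dinv f : f != 0 -> D f^-1 = - D f / f ^+ 2.
Proof.
move=> nz; have := derivation_div 1 Dmul nz.
by rewrite mul1r D1 mul0r mul1r add0r.
Qed.

(* dx / chart_coef k generates the stalks of Omega at the points where the
   homogeneous coordinate k does not vanish; charts 2 and 0 cover F_n away from
   (0 : 1 : 0), which is not on the curve. *)
Definition chart_coef (k : 'I_3) : L :=
  if k == o2 then y ^+ n.-1 else y ^+ n.-1 / x ^+ (n - 3).

(** In either chart, with coordinates u, v, the scaled derivation sends u to v^(n-1) and v to
    -u^(n-1): up to the factor n it is the Hamiltonian field of the affine equation. For u = y/x, v
    = 1/x this uses y^(n-1) (x Dy - y) = -x^n - y^n = 1. *)
Lemma chart_derivation P k u : fermat_point n P -> k \in [:: o0; o2] -> P k != 0 ->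
  loc P u -> loc P (chart_coef k * D u).
Proof.
move=> fP; have nzx := x_neq0; have n_gt1 : (1 < n)%N by lia.
have pre : n.-1 = (n - 3).+2 by lia.
have hX i : ('X_i ^+ n.-1 : {mpoly K[3]}) \is (n.-1).-homog by exact: dhomogXn.
have h0 : (0 : {mpoly K[3]}) \is (n.-1).-homog by exact: rpred0.
rewrite !inE => /orP[] /eqP -> Pk; rewrite /chart_coef /=.
  apply: (derivation_local HL fP
    (T := fun i : 'I_3 => [:: 1; y / x; x^-1]`_i)
    (R := fun i : 'I_3 => [:: 0; 'X_o2 ^+ n.-1; - 'X_o1 ^+ n.-1]`_i)
    (k := o0)) => //; rewrite ?dehomogXU //.
  - by apply: ord3P; rewrite /= !dehomogXU /= ?mulVf // ?mulr1 // mulrC.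
  - by apply: ord3P; rewrite //= rpredN.
  apply: ord3P; rewrite /= ?rmorph0 ?rmorphN ?rmorphXn /= ?mmapX ?mmap1U /=.
  - by rewrite D1 mulr0.
  - rewrite (derivation_div _ Dmul) // Dx mulr1 exprVn.
    have -> : y ^+ n.-1 / x ^+ (n - 3) * ((D y * x - y) / x ^+ 2)
        = ((y ^+ n.-1 * D y) * x - y ^+ n.-1 * y) / (x ^+ (n - 3) * x ^+ 2).
      by field; rewrite nzx expf_neq0.
    rewrite Dy -exprD mulNr -!exprSr prednK //.
    have -> : - x ^+ n - y ^+ n = 1.
      by apply/eqP; rewrite -opprD eqr_oppLR -addr_eq0 fermat_eq.
    by rewrite mul1r; congr (_ ^-1); congr (_ ^+ _); lia.
  - rewrite Dinv // Dx pre; rewrite !exprS.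
    move: (n - 3)%N => e; rewrite expr_div_n.
    by field; rewrite nzx expf_neq0.
apply: (derivation_local HL fP
    (T := fun i : 'I_3 => [:: x; y; 1]`_i)
    (R := fun i : 'I_3 => [:: 'X_o1 ^+ n.-1; - 'X_o0 ^+ n.-1; 0]`_i)
    (k := o2)) => //; rewrite ?dehomogXU /= ?oner_neq0 //.
- by move=> i; rewrite !dehomogXU /= invr1 mul1r.
- by apply: ord3P; rewrite //= rpredN.
apply: ord3P; rewrite /= ?rmorph0 ?rmorphN ?rmorphXn /= ?mmapX ?mmap1U /=.
- by rewrite Dx mulr1.
- exact: Dy.
- by rewrite D1 mulr0.
Qed.

(** Each of the [m] differentials in a term of the stalk absorbs one factor [chart_coef k]. *)
Lemma chart_stalk m P k f : fermat_point n P -> k \in [:: o0; o2] -> P k != 0 ->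
  omega_stalk iota x y D m P f -> loc P (chart_coef k ^+ m * f).
Proof.
move=> fP k02 Pk [N [a [u [la lu ->]]]].
rewrite mulr_sumr; apply: (local_ring_sum HL fP) => j _.
rewrite mulrCA; apply: local_ringM (la j) _.
rewrite -{1}[m]card_ord -prodr_const -big_split /=.
by apply: local_ring_prod => i _; apply: chart_derivation.
Qed.

(* The part of degree e + 1 of B vanishes at the n points of F_n on x_0 = 0. *)
Lemma infinity_degree g (B : {poly {poly K}}) e N :
    (size B <= n)%N -> g = ev B -> deg_le e.+1 B -> (N <= e)%N ->
    (forall P, fermat_point n P -> P o0 != 0 -> loc P (g / x ^+ N)) ->
  deg_le e B.
Proof.
move=> sB gE dB Ne Hg.
pose p := \poly_(j < n) (if (j <= e.+1)%N then B`_j`_(e.+1 - j) else 0).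
have pE w : (homogenize e.+1 B).@[point 1 w 0] = p.[w].
  rewrite /homogenize rmorph_sum /= horner_poly.
  rewrite (big_ord_widen n (fun j => (\sum_(k < size (B`_j)%R)
    B`_j`_k *: ('X_o0 ^+ k * 'X_o1 ^+ j * 'X_o2 ^+ (e.+1 - (j + k)))).@[point 1 w 0]) sB).
  rewrite big_mkcond; apply: eq_bigr => j _.
  case: ifP => [_|/negbT]; last first.
    by rewrite -leqNgt => Bj; rewrite [B`_j]nth_default // coef0 if_same mul0r.
  rewrite rmorph_sum /=.
  have termE k : (B`_j`_k *: ('X_o0 ^+ k * 'X_o1 ^+ j
        * 'X_o2 ^+ (e.+1 - (j + k)))).@[point 1 w 0]
      = if (j <= e.+1)%N && (k == e.+1 - j)%N then B`_j`_k * w ^+ j else 0.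
    rewrite mevalZ !mevalM !rmorphXn /= !mevalXU /= expr1n mul1r expr0n.
    case: eqP => [e0|ne]; last first.
      case: ifP => [/andP[je /eqP ke]|]; last by rewrite !mulr0.
      by case: ne; rewrite ke; lia.
    rewrite mulr1; have [->|/dB jk] := eqVneq (B`_j`_k) 0.
      by rewrite mul0r if_same.
    by case: ifP => // /negP[]; lia.
  under eq_bigr => k _ do rewrite termE.
  case: (leqP j e.+1) => /= je; last first.
    by rewrite mul0r big1.
  rewrite -big_mkcond /=; case: (ltnP (e.+1 - j) (size (B`_j)%R)) => ks.
    by rewrite (big_pred1 (Ordinal ks)).
  rewrite big_pred0; first by rewrite nth_default ?mul0r.
  by move=> k; apply/negbTE; rewrite neq_ltn (leq_trans (ltn_ord k) ks).
have p0 : p = 0.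
  apply: (small_poly_root_vanish n_gt0 K_closed Hzeta (c := -1)).
  - by rewrite oppr_eq0 oner_neq0.
  - exact: size_poly.
  move=> w wn; have fP : fermat_point n (point 1 w 0).
    apply: fermat_pointE; rewrite ?oner_neq0 // expr1n wn expr0n gtn_eqF //.
    by rewrite subrr addr0.
  have [d [F [H [hF hH HP gFH]]]] := Hg _ fP (oner_neq0 _).
  have nzH := dehomog_neq0 HL fP hH HP.
  have hB := homogenize_homog dB.
  have hG : homogenize e.+1 B * H - 'X_o0 ^+ N * F * 'X_o2 ^+ (e.+1 - N)
      \is (e.+1 + d).-homog.
    rewrite rpredB //; first exact: dhomogM.
    have -> : (e.+1 + d = N + d + (e.+1 - N))%N by lia.
    by apply: dhomogM; [apply: dhomogM => //|]; exact: dhomogXn.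
  have [|Q] := (fff_vanish HL hG).1 _.
    rewrite rmorphB !rmorphM !rmorphXn /= !dehomogXU /= expr1n mulr1.
    rewrite -(ev_dehom iota x y (homogenize _ _)) homogenizeK -gE.
    apply/eqP; rewrite subr_eq0; have /eqP := gFH.
    by rewrite eqr_div ?expf_neq0 ?x_neq0 // [dh F * _]mulrC.
  move/(congr1 (fun G => G.@[point 1 w 0])).
  rewrite rmorphB !rmorphM !rmorphXn /= !mevalXU /= fP.2 mulr0 expr0n.
  rewrite (_ : (_ - _ == 0)%N = false) ?mulr0 ?subr0; last by apply/eqP; lia.
  by rewrite pE => /eqP; rewrite mulf_eq0 (negPf HP) orbF => /eqP.
move=> j k nz; have := dB _ _ nz; rewrite leq_eqVlt => /orP[/eqP jk|] //.
have jn : (j < n)%N.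
  apply: leq_trans sB; rewrite ltnNge; apply: contraNN nz => Bj.
  by rewrite [B`_j]nth_default // coef0.
have := congr1 (fun q : {poly K} => q`_j) p0; rewrite coef_poly jn coef0.
rewrite ifT; last by lia.
have -> : (e.+1 - j = k)%N by lia.
by move/eqP; rewrite (negPf nz).
Qed.

End Holomorphic.

Section HoloBasis.

Variables (K L : fieldType) (n : nat) (iota : {rmorphism K -> L}) (x y : L).
Variables (zeta : K) (D : L -> L).
Hypothesis n_gt3 : (3 < n)%N.
Hypothesis n_neq0 : n%:R != 0 :> K.
Hypothesis K_closed : forall q : {poly K}, size q != 1%N -> exists a, root q a.
Hypothesis Hzeta : n.-primitive_root zeta.
Hypothesis HL : fermat_function_field n iota x y.
Hypothesis HD : is_ddx iota x D.
Variable m : nat.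

Let n_gt0 : (0 < n)%N. Proof. by apply: leq_trans n_gt3. Qed.
Local Notation ev := (ev iota x y).
Local Notation evx := (evx iota x).
Local Notation dh := (dehomog iota x y).
Local Notation loc := (local_ring iota x y).
Local Notation N := (m * (n - 3))%N.
Local Notation omega := (y ^+ (m * n.-1))^-1.
Local Notation holo := (holo_diff iota x y D n m).
Let nzx := x_neq0 n_gt3 HL.
Let nzy := y_neq0 n_gt3 HL.

(** On the affine part f y^(m(n-1)) is regular, hence a polynomial. At the points with x_1 != 0
    regularity bounds its quotient by x^N; this removes the excess of the degree over N one unit at
    a time. *)
Lemma holo_diff_form f : holo f ->
  exists B : {poly {poly K}}, [/\ (size B <= n)%N, deg_le N B & f = ev B * omega].
Proof.
move=> Hf; pose g := f * y ^+ (m * n.-1).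
have [P fP P2|B sB gE] := regular_affine n_gt0 K_closed Hzeta HL (g := g).
  have := chart_stalk n_gt3 n_neq0 Hzeta HL HD fP (k := o2) isT P2 (Hf P fP).
  by rewrite /chart_coef /= -exprM mulnC mulrC.
exists B; split=> //; last by rewrite -gE mulfK // expf_neq0.
have [e He] := deg_le_exists B.
have {}He : deg_le (N + e) B by move=> j k /He le; apply: leq_trans le (leq_addl _ _).
elim: e He => [|e IH]; first by rewrite addn0.
rewrite addnS => dB; apply: IH; apply: (infinity_degree n_gt3 n_neq0 K_closed Hzeta HL sB gE dB (leq_addr _ _)).
move=> P fP P0.
have := chart_stalk n_gt3 n_neq0 Hzeta HL HD fP (k := o0) isT P0 (Hf P fP).
rewrite /chart_coef /= expr_div_n -!exprM (mulnC _ m) (mulnC _ m) mulrAC.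
by rewrite [_ * f]mulrC.
Qed.

Lemma dhZ c F : dh (c *: F) = iota c * dh F.
Proof. exact: mmapZ. Qed.

Lemma omega_stalk1 P a u :
  loc P a -> loc P u -> omega_stalk iota x y D m P (a * D u ^+ m).
Proof.
move=> la lu; exists 1%N, (fun=> a), (fun _ _ => u); split=> //.
by rewrite big_ord1 prodr_const card_ord.
Qed.

Lemma local_ring_ratio P i k : P k != 0 ->
  loc P ([:: x; y; 1]`_(i : 'I_3) / [:: x; y; 1]`_k).
Proof.
move=> Pk; rewrite -!(dehomogXU iota).
by apply: local_ring_frac (dhomogXU K i) (dhomogXU K k) _; rewrite mevalXU.
Qed.

(** At each point the differential is written as [a (du)^m]: u = 1/x on the line x_0 = 0, u = x
    where x_0 and x_2 are nonzero, u = y where x_0 is nonzero and x_2 = 0. Since m(n-1) = N + 2m,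
    the factor 2m from d(1/x), or from x_0^(2m), makes [a] a quotient of forms of equal degree. *)
Lemma form_holo_diff F : F \is N.-homog -> holo (dh F * omega).
Proof.
move=> hF P fP; have hX i k := dhomogXn K i k.
have nX i k : P i != 0 -> ('X_i ^+ k : {mpoly K[3]}).@[P] != 0.
  by move=> Pi; rewrite rmorphXn /= mevalXU expf_neq0.
have n3 : (m * n.-1 = N + 2 * m)%N.
  by rewrite (_ : n.-1 = n - 3 + 2)%N ?mulnDr 1?[(2 * m)%N]mulnC //; lia.
have [P2|P2] := eqVneq (P o2) 0.
  have [P0 P1] : P o0 != 0 /\ P o1 != 0.
    have [[i Pi] FP] := fP; move: FP; rewrite /fermat_poly rmorph_sum big_ord3 /=.
    rewrite !rmorphXn /= !mevalXU P2 expr0n gtn_eqF //= addr0 => FP.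
    have : P o0 != 0 \/ P o1 != 0.
      move: i Pi; apply: ord3P; [by left|by right|by rewrite P2 eqxx].
    case=> nz; split=> //; apply: contraNneq nz => e0; move/eqP: FP;
      by rewrite e0 expr0n gtn_eqF // ?addr0 ?add0r expf_eq0 n_gt0.
  have -> : dh F * omega
      = dh ((((-1) ^+ m : K) *: F) * 'X_o0 ^+ (2 * m)) / dh ('X_o1 ^+ (m * n.-1))
        * D (x^-1) ^+ m.
    rewrite (Dinv HD) // (ddx_x HD) rmorphM /= dhZ !rmorphXn /= !dehomogXU /=.
    rewrite expr_div_n exprAC -exprM.
    transitivity (((-1) ^+ m) ^+ 2 * dh F * (x ^+ (2 * m) / x ^+ (2 * m)) * omega).
      by rewrite sqrr_sign mul1r divff ?mulr1 ?expf_neq0.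
    by rewrite rmorphN1 [(m * 2)%N]mulnC exprS expr1; ring.
  apply: omega_stalk1; last first.
    by have := local_ring_ratio o2 P0; rewrite mul1r.
  apply: (@local_ring_frac K L iota x y P (m * n.-1)); rewrite ?nX //.
  by rewrite n3; apply: dhomogM => //; rewrite rpredZ.
have [P1|P1] := eqVneq (P o1) 0; last first.
  have -> : dh F * omega = dh (F * 'X_o2 ^+ (2 * m)) / dh ('X_o1 ^+ (m * n.-1)) * D x ^+ m.
    by rewrite (ddx_x HD) expr1n mulr1 rmorphM !rmorphXn /= !dehomogXU /= expr1n mulr1.
  apply: omega_stalk1; last first.
    by have := local_ring_ratio o0 P2; rewrite divr1.
  apply: (@local_ring_frac K L iota x y P (m * n.-1)); rewrite ?nX //.
  by rewrite n3; apply: dhomogM.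
have P0 : P o0 != 0.
  move: fP.2; rewrite /fermat_poly rmorph_sum big_ord3 /=.
  rewrite !rmorphXn /= !mevalXU P1 expr0n gtn_eqF //= addr0 => /eqP.
  by apply: contraTneq => ->; rewrite expr0n gtn_eqF //= add0r expf_neq0.
have -> : dh F * omega = dh ((((-1) ^+ m : K) *: F) * 'X_o2 ^+ (2 * m)) / dh ('X_o0 ^+ (m * n.-1)) * D y ^+ m.
  have -> : D y = - (x ^+ n.-1 / y ^+ n.-1).
    apply: (mulfI (expf_neq0 n.-1 nzy)); rewrite (Dy n_neq0 HL HD).
    by rewrite mulrN mulrC divfK // expf_neq0.
  rewrite rmorphM /= dhZ !rmorphXn /= !dehomogXU /= expr1n mulr1.
  rewrite exprNn expr_div_n -!exprM (mulnC m).
  transitivity (((-1) ^+ m) ^+ 2 * dh F * (x ^+ (n.-1 * m) / x ^+ (n.-1 * m))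
      * (y ^+ (n.-1 * m))^-1).
    by rewrite sqrr_sign mul1r divff ?mulr1 ?expf_neq0.
  by rewrite rmorphN1 exprS expr1; ring.
apply: omega_stalk1; last first.
  by have := local_ring_ratio o1 P2; rewrite divr1.
apply: (@local_ring_frac K L iota x y P (m * n.-1)); rewrite ?nX //.
by rewrite n3; apply: dhomogM => //; rewrite rpredZ.
Qed.

Definition mono (ij : 'I_N.+1 * 'I_n) : L := x ^+ ij.1 * y ^+ ij.2 * omega.

Definition mono_ok (ij : 'I_N.+1 * 'I_n) : bool := (ij.1 + ij.2 <= N)%N.

Lemma ev_mono (B : {poly {poly K}}) : (size B <= n)%N -> deg_le N B ->
  ev B * omega = \sum_(ij | mono_ok ij) iota B`_(ij.2)`_(ij.1) * mono ij.
Proof.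
move=> sB dB; rewrite (ev_coef _ _ _ sB) mulr_suml.
rewrite (eq_bigr (fun j : 'I_n => \sum_(i < N.+1) iota B`_j`_i * (x ^+ i * y ^+ j * omega))).
  rewrite exchange_big pair_big /= [RHS]big_mkcond; apply: eq_bigr => -[i j] _ /=.
  rewrite /mono_ok /=; case: leqP => // ij.
  have [->|/dB] := eqVneq (B`_j`_i) 0; first by rewrite rmorph0 mul0r.
  by rewrite addnC leqNgt ij.
move=> j _; rewrite /evx /= /horner_eval (horner_coef_wide _ (n := N.+1)).
  rewrite !mulr_suml; apply: eq_bigr => i _; rewrite coef_map /=; ring.
rewrite size_map_poly; apply/leq_sizeP => k Nk; apply/eqP.
by apply: contraTT Nk => /dB; rewrite -leqNgt; lia.
Qed.

Lemma holo_basis : basis_on iota mono_ok mono holo.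
Proof.
pose Bof (c : 'I_N.+1 * 'I_n -> K) : {poly {poly K}} :=
  \poly_(j < n) (if insub j is Some j' then
     \poly_(i < N.+1) (if insub i is Some i' then
        if mono_ok (i', j') then c (i', j') else 0 else 0) else 0).
have BE c (i : 'I_N.+1) (j : 'I_n) :
    (Bof c)`_j`_i = if mono_ok (i, j) then c (i, j) else 0.
  by rewrite !coef_poly ltn_ord valK coef_poly ltn_ord valK.
have Bs c : (size (Bof c) <= n)%N by exact: size_poly.
have Bd c : deg_le N (Bof c).
  move=> j i; have [nj|jn] := leqP n j.
    by rewrite coef_poly ltnNge nj /= coef0 eqxx.
  have [Ni|iN] := ltnP N i.
    rewrite coef_poly jn; case: insub => [j'|]; last by rewrite coef0 eqxx.
    by rewrite coef_poly ltnNge Ni eqxx.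
  have := BE c (Ordinal (iN : (i < N.+1)%N)) (Ordinal jn); rewrite /= => ->.
  by rewrite /mono_ok /=; case: ifP => [|_]; rewrite ?eqxx // addnC.
have sumE c : \sum_(ij | mono_ok ij) iota (c ij) * mono ij = ev (Bof c) * omega.
  rewrite ev_mono //; apply: eq_bigr => -[i j] ok /=.
  by rewrite BE ok.
split=> [f|c].
  split=> [/holo_diff_form[B [sB dB ->]]|[c ->]].
    by exists (fun ij : 'I_N.+1 * 'I_n => B`_(ij.2)`_(ij.1)); rewrite ev_mono.
  rewrite sumE -[Bof c](homogenizeK N) ev_dehom.
  by apply: form_holo_diff; exact: homogenize_homog.
rewrite sumE => /eqP; rewrite mulf_eq0 invr_eq0 expf_eq0 (negPf nzy) andbF orbF.
move=> /eqP/(ev_small n_gt0 HL (Bs c)) B0 [i j] ok.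
by have := BE c i j; rewrite ok B0 !coef0.
Qed.

End HoloBasis.

(** * The group action *)

Section FermatGroup.

Variables (K L : fieldType) (n : nat) (iota : {rmorphism K -> L}) (x y : L).
Variables (zeta : K) (D : L -> L).
Variables (gT : finGroupType) (act : gT -> {rmorphism L -> L}).
Variables (sigma : 'I_n -> 'I_n -> gT) (s t : gT).
Hypothesis n_gt3 : (3 < n)%N.
Hypothesis n_neq0 : n%:R != 0 :> K.
Hypothesis Hzeta : n.-primitive_root zeta.
Hypothesis HL : fermat_function_field n iota x y.
Hypothesis HD : is_ddx iota x D.
Hypothesis HG : fermat_group zeta iota x y act sigma s t.
Variable m : nat.

Let n_gt0 : (0 < n)%N. Proof. by apply: leq_trans n_gt3. Qed.
Local Notation dh := (dehomog iota x y).
Let nzx := x_neq0 n_gt3 HL.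
Let nzy := y_neq0 n_gt3 HL.
Let actM := fg_actM HG.
Let actK := fg_actK HG.

Lemma zeta_neq0 : zeta != 0.
Proof.
apply/eqP => z0; have := prim_expr_order Hzeta.
by rewrite z0 expr0n gtn_eqF // => /eqP; rewrite eq_sym oner_eq0.
Qed.

Lemma act1 f : act 1%g f = f.
Proof. by apply: (fmorph_inj (act 1%g)); rewrite -actM mulg1. Qed.

Lemma mmap_act g h F :
  act g (mmap iota h F) = mmap iota (fun i : 'I_3 => act g (h i)) F.
Proof. by apply: rmorph_mmap => // c; rewrite actK. Qed.

(** The function field is generated by x and y over K and the action is faithful; all relations in
    the group are checked through this. *)
Lemma act_ext g h : act g x = act h x -> act g y = act h y -> g = h.
Proof.
move=> ex ey; apply: (fg_faithful HG) => f.
have [d [F [H [_ _ _ ->]]]] := fff_generated HL f.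
rewrite !fmorph_div /dehomog !mmap_act; congr (_ / _); rewrite /mmap;
  apply: eq_bigr => q _; congr (_ * _); apply: mmap1_eq; apply: ord3P => //=;
  by rewrite !rmorph1.
Qed.

(** Both sides obey the product rule along [act g], so the generators suffice. For y the identity
    comes from differentiating the image under [act g] of the equation of the curve. *)
Lemma chain_rule g f : D (act g f) = act g (D f) * D (act g x).
Proof.
have Dadd := ddx_add HD; have Dmul := ddx_mul HD; have DC := ddx_const HD.
have base (i : 'I_3) : D (act g [:: x; y; 1]`_i)
    = act g (D [:: x; y; 1]`_i) * D (act g x).
  move: i; apply: ord3P => /=.
  - by rewrite (ddx_x HD) rmorph1 mul1r.
  - have nL : n%:R != 0 :> L by rewrite -(rmorph_nat iota) fmorph_eq0.
    have nzgy : act g y ^+ n.-1 != 0 by rewrite expf_neq0 // fmorph_eq0.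
    apply: (mulfI nzgy); rewrite mulrA -rmorphXn -rmorphM (Dy n_neq0 HL HD).
    rewrite rmorphN rmorphXn mulNr; apply: (mulfI nL).
    have := congr1 (fun z => D (act g z)) (fermat_eq HL).
    rewrite !rmorphD rmorph1 rmorph0 !rmorphXn !Dadd !(derivationX HD) (D1 HD).
    have -> : D 0 = 0 by rewrite -(rmorph0 iota) DC rmorph0.
    move/eqP; rewrite addr0 addrC addr_eq0 => /eqP.
    by rewrite /= mulrN !mulrA.
  - by rewrite rmorph1 (D1 HD) rmorph0 mul0r.
have formE F : D (act g (dh F)) = act g (D (dh F)) * D (act g x).
  rewrite {1}/dehomog mmap_act derivation_mmap // /dehomog derivation_mmap //.
  rewrite rmorph_sum mulr_suml; apply: eq_bigr => i _.
  by rewrite base rmorphM mulrA mmap_act.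
have [d [F [H [_ _ nzH ->]]]] := fff_generated HL f.
rewrite fmorph_div !(derivation_div _ Dmul) ?fmorph_eq0 // !formE.
by rewrite fmorph_div rmorphXn rmorphB !rmorphM /=; ring.
Qed.

Local Notation T g := (act_diff x D m (act g)).

Lemma act_diff_mul g u f : T g (u * f) = act g u * T g f.
Proof. by rewrite /act_diff rmorphM mulrA. Qed.

Lemma act_diffM g h f : T (g * h)%g f = T g (T h f).
Proof.
rewrite /act_diff !actM chain_rule rmorphM rmorphXn exprMn; ring.
Qed.

Lemma act_diff1 f : T 1%g f = f.
Proof. by rewrite /act_diff !act1 (ddx_x HD) expr1n mulr1. Qed.

Lemma act_diff_klinear g : klinear iota (T g).
Proof.
split=> [f h|c f]; first by rewrite /act_diff rmorphD mulrDl.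
by rewrite act_diff_mul actK.
Qed.

Definition ord_mod (a : int) : 'I_n := Ordinal (ltn_pmod `|(a %% n)%Z|%N n_gt0).

Lemma zeta_mod (a b : int) : (a = b %[mod n])%Z -> zeta ^ a = zeta ^ b.
Proof.
have H c : zeta ^ c = zeta ^ (c %% n)%Z.
  rewrite {1}(divz_eq c n) expfzDr ?zeta_neq0 // mulrC [(_ * n%:Z)%R]mulrC.
  by rewrite -exprz_exp -exprnP (prim_expr_order Hzeta) exp1rz mulr1.
by move=> ab; rewrite (H a) (H b) ab.
Qed.

Lemma zeta_eq (a b : int) : zeta ^ a = zeta ^ b -> (a = b %[mod n])%Z.
Proof.
move=> H; have : zeta ^ (a - b) = 1.
  by rewrite expfzDr ?zeta_neq0 // -invr_expz H divff // expfz_neq0 ?zeta_neq0.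
have nz : n%:Z != 0 by rewrite eqz_nat gtn_eqF.
have [k kE] : exists k : nat, ((a - b) %% n)%Z = k.
  by exists `|((a - b) %% n)%Z|%N; rewrite gez0_abs ?modz_ge0.
have kn : (k < n)%N by rewrite -ltz_nat -kE ltz_pmod.
rewrite (zeta_mod (b := k)) -?kE ?modz_mod // kE -exprnP => /eqP.
rewrite -(prim_order_dvd Hzeta) /dvdn modn_small // => /eqP k0.
by apply/eqP; rewrite eqz_mod_dvd; apply/dvdz_mod0P; rewrite kE k0.
Qed.

Lemma zeta_ord_mod a : zeta ^+ ord_mod a = zeta ^ a.
Proof.
rewrite exprnP; apply: zeta_mod => /=; rewrite modn_small.
  by rewrite gez0_abs ?modz_mod // modz_ge0 // eqz_nat gtn_eqF.
by rewrite -ltz_nat gez0_abs ?ltz_pmod // modz_ge0 // eqz_nat gtn_eqF.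
Qed.

(** Integer exponents are needed because conjugation by [s] and [t] produces negative ones. *)
Definition sigz (a b : int) : gT := sigma (ord_mod a) (ord_mod b).

Lemma sigz_x a b : act (sigz a b) x = iota (zeta ^ a) * x.
Proof. by rewrite /sigz (fg_sigma_x HG) zeta_ord_mod. Qed.

Lemma sigz_y a b : act (sigz a b) y = iota (zeta ^ b) * y.
Proof. by rewrite /sigz (fg_sigma_y HG) zeta_ord_mod. Qed.

Lemma sigzM a b a' b' : (sigz a b * sigz a' b')%g = sigz (a + a') (b + b').
Proof.
apply: act_ext; rewrite actM.
  by rewrite !sigz_x rmorphM actK sigz_x expfzDr ?zeta_neq0 // rmorphM; ring.
by rewrite !sigz_y rmorphM actK sigz_y expfzDr ?zeta_neq0 // rmorphM; ring.
Qed.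

Lemma sigz0 : sigz 0 0 = 1%g.
Proof. by apply: act_ext; rewrite ?sigz_x ?sigz_y act1 expr0z rmorph1 mul1r. Qed.

Lemma sigma_sigz (a b : 'I_n) : sigma a b = sigz a b.
Proof.
by apply: act_ext; rewrite ?sigz_x ?sigz_y ?(fg_sigma_x HG) ?(fg_sigma_y HG).
Qed.

Lemma zetaB a b : zeta ^ (a - b) = zeta ^ a / zeta ^ b.
Proof. by rewrite expfzDr ?zeta_neq0 // -invr_expz. Qed.

Let act_s_x := fg_s_x HG.
Let act_s_y := fg_s_y HG.
Let act_t_x := fg_t_x HG.
Let act_t_y := fg_t_y HG.

Lemma s_sigz a b : (s * sigz a b = sigz (- b) (a - b) * s)%g.
Proof.
have nzz c : iota (zeta ^ c) != 0 by rewrite fmorph_eq0 expfz_neq0 ?zeta_neq0.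
apply: act_ext; rewrite !actM.
  rewrite sigz_x rmorphM actK act_s_x fmorph_div sigz_x sigz_y.
  rewrite zetaB fmorph_div -invr_expz fmorphV; move: (nzz b) (nzz a).
  by move: (iota _) (iota _) => u v nzu nzv; field; rewrite nzu nzx.
rewrite sigz_y rmorphM actK act_s_y fmorph_div rmorph1 sigz_x.
by rewrite -invr_expz fmorphV; have := nzz b; move: (iota _) => u nzu; field; rewrite nzu.
Qed.

Lemma t_sigz a b : (t * sigz a b = sigz (- a) (b - a) * t)%g.
Proof.
have nzz c : iota (zeta ^ c) != 0 by rewrite fmorph_eq0 expfz_neq0 ?zeta_neq0.
apply: act_ext; rewrite !actM.
  rewrite sigz_x rmorphM actK act_t_x fmorph_div rmorph1 sigz_x.
  by rewrite -invr_expz fmorphV; have := nzz a; move: (iota _) => u nzu; field; rewrite nzu.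
rewrite sigz_y rmorphM actK act_t_y fmorph_div sigz_x sigz_y.
rewrite zetaB fmorph_div -invr_expz fmorphV; move: (nzz b) (nzz a).
by move: (iota _) (iota _) => u v nzu nzv; field; rewrite nzv nzx.
Qed.

Let act_st := (act_s_x, act_s_y, act_t_x, act_t_y, @fmorph_div, @rmorph1).

Lemma s3 : (s ^+ 3 = 1)%g.
Proof.
apply: act_ext; rewrite !expgS expg0 mulg1 !actM act1 !act_st;
  by field; rewrite ?nzx ?nzy ?oner_neq0.
Qed.

Lemma t2 : (t ^+ 2 = 1)%g.
Proof.
apply: act_ext; rewrite !expgS expg0 mulg1 !actM act1 !act_st;
  by field; rewrite ?nzx ?nzy ?oner_neq0.
Qed.

Lemma t_s : (t * s = s ^+ 2 * t)%g.
Proof.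
apply: act_ext; rewrite !expgS expg0 mulg1 !actM !act_st;
  by field; rewrite ?nzx ?nzy ?oner_neq0.
Qed.

(** Conjugation by [t] inverts [s]; the inverse is written as the square to keep exponents
    natural. *)
Lemma tX_sX i j : (t ^+ j * s ^+ i = s ^+ (if odd j then 2 * i else i)%N * t ^+ j)%g.
Proof.
have H k : (t * s ^+ k = s ^+ (2 * k)%N * t)%g.
  elim: k => [|k IH]; first by rewrite !expg0 mulg1 mul1g.
  by rewrite expgSr mulgA IH -mulgA t_s mulgA -expgD mulnSr.
have t2j k : (t ^+ k.*2 = 1)%g by rewrite -mul2n expgM t2 expg1n.
rewrite -[in LHS](odd_double_half j) -[in RHS](odd_double_half j) expgD t2j mulg1.
by rewrite oddD odd_double addbF oddb; case: (odd j); rewrite ?expg1 ?H // expg0 mulg1 mul1g.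
Qed.

Lemma wtM i j i' j' : (s ^+ i * t ^+ j * (s ^+ i' * t ^+ j')
  = s ^+ ((i + if odd j then 2 * i' else i') %% 3)%N * t ^+ ((j + j') %% 2)%N)%g.
Proof.
rewrite !expg_mod ?s3 ?t2 //.
by rewrite mulgA -(mulgA (s ^+ i)%g) tX_sX !expgD !mulgA.
Qed.

(* Conjugation by s and t, on the exponents (a, b) of sigma_(a,b). *)
Definition sact (u : int * int) := (- u.2, u.1 - u.2).
Definition tact (u : int * int) := (- u.1, u.2 - u.1).
Definition wact i j u := iter i sact (iter j tact u).

Lemma wt_sigz i j a b : (s ^+ i * t ^+ j * sigz a b
  = sigz (wact i j (a, b)).1 (wact i j (a, b)).2 * (s ^+ i * t ^+ j))%g.
Proof.
have Ht k u : (t ^+ k * sigz u.1 u.2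
    = sigz (iter k tact u).1 (iter k tact u).2 * t ^+ k)%g.
  elim: k => [|k IH]; first by rewrite !expg0 mulg1 mul1g.
  by rewrite expgS -mulgA IH mulgA t_sigz -mulgA.
have Hs k u : (s ^+ k * sigz u.1 u.2
    = sigz (iter k sact u).1 (iter k sact u).2 * s ^+ k)%g.
  elim: k => [|k IH]; first by rewrite !expg0 mulg1 mul1g.
  by rewrite expgS -mulgA IH mulgA s_sigz -mulgA.
by rewrite -mulgA (Ht j (a, b)) mulgA Hs mulgA.
Qed.

Lemma mono_inj c c' i j k l : c != 0 -> (j < n)%N -> (l < n)%N ->
  iota c * (x ^+ i * y ^+ j) = iota c' * (x ^+ k * y ^+ l) -> (i, j) = (k, l).
Proof.
move=> nzc jn ln H.
pose M c i j : {poly {poly K}} := (c *: 'X^i)%:P * 'X^j.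
have evM c1 i1 j1 : ev iota x y (M c1 i1 j1) = iota c1 * (x ^+ i1 * y ^+ j1).
  by rewrite evM evC evXn evX -mul_polyC rmorphM rmorphXn /= evxC evxX mulrA.
have sM c1 i1 j1 : (j1 < n)%N -> (size (M c1 i1 j1) <= n)%N.
  move=> j1n; rewrite /M mul_polyC; apply: leq_trans (size_scale_leq _ _) _.
  by rewrite size_polyXn.
have : M c i j - M c' k l = 0.
  apply: (ev_small n_gt0 HL).
    by apply: leq_trans (size_polyD _ _) _; rewrite size_polyN geq_max !sM.
  by rewrite evB !evM H subrr.
move/eqP; rewrite subr_eq0 => /eqP /(congr1 (fun p : {poly {poly K}} => p`_j`_i)).
rewrite /M !coefCM !coefXn eqxx mulr1 coefZ coefXn eqxx mulr1 => cE.
move: nzc; rewrite cE; case: (j =P l) => [->|_]; last by rewrite mulr0 coef0 eqxx.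
by rewrite mulr1 coefZ coefXn; case: (i =P k) => [->|_] //; rewrite mulr0 eqxx.
Qed.

(** The image of x already determines [i] and [j], because the six images under S_3 are pairwise
    non-proportional monomials. The exponents [a] and [b] are then read off the images of x and
    y. *)
Lemma normal_form_inj a b i j a' b' i' j' :
    (i < 3)%N -> (j < 2)%N -> (i' < 3)%N -> (j' < 2)%N ->
    (sigz a b * s ^+ i * t ^+ j = sigz a' b' * s ^+ i' * t ^+ j')%g ->
  [/\ (a = a' %[mod n])%Z, (b = b' %[mod n])%Z, i = i' & j = j'].
Proof.
(* Exponents of the image of x multiplied by xy. This factor clears all denominators and keeps the
   exponent of y at most 2, hence below [n], where monomials are independent. *)
pose tab i j : nat * nat := if j == 0%N then nth (2, 1)%N [:: (2, 1); (0, 2); (1, 0)]%N i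
  else nth (2, 1)%N [:: (0, 1); (2, 0); (1, 2)]%N i.
have tabE i1 j1 : (i1 < 3)%N -> (j1 < 2)%N ->
    act (s ^+ i1 * t ^+ j1)%g x * (x * y) = x ^+ (tab i1 j1).1 * y ^+ (tab i1 j1).2.
  case: i1 => [|[|[|i1]]] //; case: j1 => [|[|j1]] // _ _;
    rewrite /tab /= ?actM ?expgS ?expg0 ?mulg1 ?actM ?act1 ?act_st;
    by field; rewrite ?nzx ?nzy ?oner_neq0.
have nzz c : zeta ^ c != 0 by rewrite expfz_neq0 ?zeta_neq0.
have act_sig a1 b1 i1 j1 : (i1 < 3)%N -> (j1 < 2)%N -> exists2 c, c != 0 &
    act (sigz a1 b1 * (s ^+ i1 * t ^+ j1))%g x * (x * y)
    = iota c * (x ^+ (tab i1 j1).1 * y ^+ (tab i1 j1).2).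
  move=> /tabE H /H {H}; set k := (tab _ _).1; set l := (tab _ _).2 => E.
  have {}E : act (s ^+ i1 * t ^+ j1)%g x = x ^+ k * y ^+ l / (x * y).
    by rewrite -E mulfK // mulf_neq0.
  exists ((zeta ^ a1) ^+ k * (zeta ^ b1) ^+ l / (zeta ^ a1 * zeta ^ b1)).
    by rewrite mulf_neq0 ?invr_neq0 ?mulf_neq0 ?expf_neq0.
  rewrite actM E fmorph_div !rmorphM !rmorphXn /= fmorphV rmorphM sigz_x sigz_y.
  have := nzz a1; have := nzz b1; rewrite -!(fmorph_eq0 iota).
  move: (iota _) (iota _) => u v nzu nzv; rewrite !exprMn.
  by field; rewrite nzu nzv nzx nzy.
rewrite -!mulgA => i3 j2 i'3 j'2 E.
have [c nzc cE] := act_sig a b i j i3 j2; have [c' _ c'E] := act_sig a' b' i' j' i'3 j'2.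
have tabn i1 j1 : ((tab i1 j1).2 < n)%N.
  apply: leq_trans n_gt3; rewrite /tab.
  by case: ifP => _; case: i1 => [|[|[|[|i1]]]].
have /(mono_inj nzc (tabn i j) (tabn i' j')) : iota c * (x ^+ (tab i j).1 * y ^+ (tab i j).2)
    = iota c' * (x ^+ (tab i' j').1 * y ^+ (tab i' j').2) by rewrite -cE E c'E.
rewrite -!surjective_pairing => tabij.
have [ii jj] : i = i' /\ j = j'.
  move: tabij; rewrite /tab {E cE c'E}; move: i3 j2 i'3 j'2.
  by case: i => [|[|[|?]]]; case: j => [|[|?]]; case: i' => [|[|[|?]]]; case: j' => [|[|?]].
subst i' j'; move: E => /mulIg E.
split=> //; apply: zeta_eq; apply: (fmorph_inj iota).
  by apply: (mulIf nzx); rewrite -(sigz_x a b) -(sigz_x a' b') E.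
by apply: (mulIf nzy); rewrite -(sigz_y a b) -(sigz_y a' b') E.
Qed.

Lemma elements_normal g : exists (a b : 'I_n) (i : 'I_3) (j : 'I_2),
  g = (sigz a b * s ^+ i * t ^+ j)%g.
Proof.
have [a [b [i [j ->]]]] := fg_elements HG g.
by exists a, b, i, j; rewrite sigma_sigz.
Qed.

End FermatGroup.

(** * Linear characters of the subgroups containing A *)

Section FermatCharacters.

Variables (K L : fieldType) (n : nat) (iota : {rmorphism K -> L}) (x y : L).
Variables (zeta : K) (D : L -> L).
Variables (gT : finGroupType) (act : gT -> {rmorphism L -> L}).
Variables (sigma : 'I_n -> 'I_n -> gT) (s t : gT).
Hypothesis n_gt3 : (3 < n)%N.
Hypothesis Hzeta : n.-primitive_root zeta.
Hypothesis HL : fermat_function_field n iota x y.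
Hypothesis HG : fermat_group zeta iota x y act sigma s t.

Local Notation sigz := (sigz sigma n_gt3).
Local Notation wt i j := (s ^+ i * t ^+ j)%g.

Variables (kappa lam : int) (c : nat -> nat -> K).

Definition weight (u : int * int) : K := zeta ^ (kappa * u.1 + lam * u.2).

Definition wmul i j i' j' : nat * nat :=
  (((i + if odd j then 2 * i' else i') %% 3)%N, ((j + j') %% 2)%N).

(** The exponents of the conjugate of [s^i t^j] by [s^i' t^j']. *)
Definition wconj i' j' i j : nat * nat :=
  ((((if odd j' then 2 * i else i) + (if odd j then 2 * i' else 0)) %% 3)%N, j).

(* psi (sigma_(a,b) s^i t^j) = zeta^(kappa a + lam b) c(i, j). The support of c
   is the image in S_3 of the subgroup from which theta is induced. *)
Definition psi (g : gT) : K :=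
  if [pick q : 'I_n * 'I_n * 'I_3 * 'I_2 |
      g == (sigz q.1.1.1 q.1.1.2 * wt q.1.2 q.2)%g] is Some q
  then weight (q.1.1.1%:Z, q.1.1.2%:Z) * c q.1.2 q.2 else 0.

Lemma weight_mod u v : (u.1 = v.1 %[mod n])%Z -> (u.2 = v.2 %[mod n])%Z ->
  weight u = weight v.
Proof.
move=> e1 e2; apply: (zeta_mod n_gt3 Hzeta).
by rewrite -modzDm -(modzMmr _ u.1) -(modzMmr _ u.2) e1 e2 modzMmr modzMmr modzDm.
Qed.

Lemma psiE a b i j : (i < 3)%N -> (j < 2)%N ->
  psi (sigz a b * wt i j)%g = weight (a, b) * c i j.
Proof.
move=> i3 j2; rewrite /psi; case: pickP => [q /eqP|].
  rewrite !mulgA => E.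
  have [e1 e2 -> ->] := normal_form_inj Hzeta HL HG i3 j2 (ltn_ord _) (ltn_ord _) E.
  by congr (_ * _); apply: weight_mod.
have [a' [b' [i' [j']]]] := elements_normal n_gt3 Hzeta HL HG (sigz a b * wt i j)%g.
by rewrite -mulgA => E /(_ (a', b', i', j')); rewrite E eqxx.
Qed.

Hypothesis c00 : c 0 0 = 1.
Hypothesis c_mull : forall i j i' j', (i < 3)%N -> (j < 2)%N -> (i' < 3)%N ->
  (j' < 2)%N -> c i j != 0 ->
  c (wmul i j i' j').1 (wmul i j i' j').2 = c i j * c i' j'.
Hypothesis c_mulr : forall i j i' j', (i < 3)%N -> (j < 2)%N -> (i' < 3)%N ->
  (j' < 2)%N -> c i' j' != 0 ->
  c (wmul i j i' j').1 (wmul i j i' j').2 = c i j * c i' j'.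
Hypothesis c_inv : forall i j u, (i < 3)%N -> (j < 2)%N -> c i j != 0 ->
  weight (wact i j u) = weight u.
Hypothesis c_irr : forall i j, (i < 3)%N -> (j < 2)%N -> c i j = 0 ->
  (exists u, weight (wact i j u) != weight u) \/
  (exists p q, [/\ (p < 3)%N, (q < 2)%N, c p q != 0,
     c (wconj i j p q).1 (wconj i j p q).2 != 0 &
     c (wconj i j p q).1 (wconj i j p q).2 != c p q]).

Lemma weightD u v : weight (u.1 + v.1, u.2 + v.2) = weight u * weight v.
Proof.
rewrite /weight -expfzDr ?(zeta_neq0 n_gt3 Hzeta) //=; congr (_ ^ _); ring.
Qed.

Lemma weight_neq0 u : weight u != 0.
Proof. by rewrite expfz_neq0 ?(zeta_neq0 n_gt3 Hzeta). Qed.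

Lemma weight0 : weight (0, 0) = 1.
Proof. by rewrite /weight !mulr0 addr0 expr0z. Qed.

Lemma wmul_lt i j i' j' : ((wmul i j i' j').1 < 3)%N /\ ((wmul i j i' j').2 < 2)%N.
Proof. by rewrite !ltn_pmod. Qed.

Lemma wconj_lt i' j' i j : ((wconj i' j' i j).1 < 3)%N.
Proof. by rewrite ltn_pmod. Qed.

Lemma mul_normal a b i j a' b' i' j' :
  (sigz a b * wt i j * (sigz a' b' * wt i' j') =
   sigz (a + (wact i j (a', b')).1) (b + (wact i j (a', b')).2)
   * wt (wmul i j i' j').1 (wmul i j i' j').2)%g.
Proof.
transitivity (sigz a b * ((wt i j * sigz a' b') * wt i' j'))%g.
  by rewrite !mulgA.
rewrite (wt_sigz n_gt3 Hzeta HL HG) -(wtM n_gt3 HL HG) -(sigzM n_gt3 Hzeta HL HG).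
by rewrite !mulgA.
Qed.

Lemma wconjE i' j' i j : (i < 3)%N -> (j < 2)%N -> (i' < 3)%N -> (j' < 2)%N ->
  (wt i' j' * wt i j = wt (wconj i' j' i j).1 (wconj i' j' i j).2 * wt i' j')%g.
Proof.
rewrite !(wtM n_gt3 HL HG).
by case: i => [|[|[|?]]]; case: j => [|[|?]]; case: i' => [|[|[|?]]]; case: j' => [|[|?]].
Qed.

Definition of_normal (q : 'I_n * 'I_n * 'I_3 * 'I_2) : gT :=
  (sigz q.1.1.1 q.1.1.2 * wt q.1.2 q.2)%g.

Lemma of_normal_bij : bijective of_normal.
Proof.
have surj g : exists q, g == of_normal q.
  have [a [b [i [j ->]]]] := elements_normal n_gt3 Hzeta HL HG g.
  by exists (a, b, i, j); rewrite /of_normal /= mulgA.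
exists (fun g => xchoose (surj g)) => [q|g]; last first.
  by rewrite -(eqP (xchooseP (surj g))).
have /eqP := xchooseP (surj (of_normal q)); case: (xchoose _) => [[[a b] i] j].
case: q => [[[a' b'] i'] j']; rewrite /of_normal /= !mulgA => E.
have [] := normal_form_inj Hzeta HL HG (ltn_ord _) (ltn_ord _) (ltn_ord _) (ltn_ord _) E.
rewrite !modz_small ?ltz_nat ?ltn_ord //= => -[/val_inj ->] [/val_inj ->].
by move=> /val_inj -> /val_inj ->.
Qed.

Lemma psi_of_normal q :
  psi (of_normal q) = weight (q.1.1.1%:Z, q.1.1.2%:Z) * c q.1.2 q.2.
Proof. exact: psiE. Qed.

Lemma sum_gT (F : gT -> K) :
  \sum_g F g = \sum_(a < n) \sum_(b < n) \sum_(i < 3) \sum_(j < 2)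
    F (sigz a b * wt i j)%g.
Proof.
rewrite (reindex of_normal) /=; last exact: onW_bij of_normal_bij.
by rewrite !pair_big.
Qed.

Lemma elim_gT (P : gT -> Prop) :
  (forall a b i j, (i < 3)%N -> (j < 2)%N -> P (sigz a b * wt i j)%g) ->
  forall g, P g.
Proof.
move=> H g; have [a [b [i [j ->]]]] := elements_normal n_gt3 Hzeta HL HG g.
by rewrite -mulgA; apply: H.
Qed.

Lemma psi_mull g h : psi g != 0 -> psi (g * h)%g = psi g * psi h.
Proof.
elim/elim_gT: g => a b i j i3 j2; elim/elim_gT: h => a' b' i' j' i'3 j'2.
have [l3 l2] := wmul_lt i j i' j'.
rewrite mul_normal !psiE // mulf_eq0 (negPf (weight_neq0 _)) /= => nz.
rewrite (weightD (a, b) (wact i j (a', b'))) c_mull // c_inv //; ring.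
Qed.

Lemma psi_mulr g h : psi h != 0 -> psi (g * h)%g = psi g * psi h.
Proof.
elim/elim_gT: g => a b i j i3 j2; elim/elim_gT: h => a' b' i' j' i'3 j'2.
have [l3 l2] := wmul_lt i j i' j'.
rewrite mul_normal !psiE // mulf_eq0 (negPf (weight_neq0 _)) /= => nz.
rewrite (weightD (a, b) (wact i j (a', b'))) c_mulr //.
have [->|nz'] := eqVneq (c i j) 0; first by rewrite mul0r !mulr0 mul0r.
by rewrite c_inv //; ring.
Qed.

Lemma psi_sigz a b : psi (sigz a b) = weight (a, b).
Proof.
rewrite -[sigz a b]mulg1 -[1%g]mulg1 -{1}(expg0 s) -(expg0 t).
by rewrite psiE // c00 mulr1.
Qed.

Lemma psi_wt i j : (i < 3)%N -> (j < 2)%N -> psi (wt i j) = c i j.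
Proof.
move=> i3 j2; rewrite -[wt i j]mul1g -(sigz0 n_gt3 Hzeta HL HG) psiE //.
by rewrite weight0 mul1r.
Qed.

Lemma psi_conj_sigz a b g : psi (sigz a b * g * (sigz a b)^-1)%g = psi g.
Proof.
have E : ((sigz a b)^-1 = sigz (- a) (- b))%g.
  apply: (mulgI (sigz a b)).
  by rewrite mulgV (sigzM n_gt3 Hzeta HL HG) !subrr (sigz0 n_gt3 Hzeta HL HG).
rewrite E psi_mulr ?psi_mull ?psi_sigz ?weight_neq0 //.
rewrite mulrAC -(weightD (a, b) (- a, - b)) /= !subrr weight0; exact: mul1r.
Qed.

(** For Mackey's criterion at an element sigma w outside the support there are two cases. Either w
    moves the weight, and an element of A separates the two conjugates, or w conjugates an element
    of the support in S_3 to another one with a different value of [c]. In the second case the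
    witness is also conjugated by sigma, which leaves [psi] unchanged. *)
Lemma fermat_partial_character : partial_character psi.
Proof.
split; [|exact: psi_mull|exact: psi_mulr|].
  by rewrite -(sigz0 n_gt3 Hzeta HL HG) psi_sigz weight0.
elim/elim_gT => a b i j i3 j2.
rewrite psiE // => /eqP; rewrite mulf_eq0 (negPf (weight_neq0 _)) /= => /eqP c0.
have [[u Hu]|[p [q [p3 q2 nzp nzc ne]]]] := c_irr i3 j2 c0.
  exists (sigz (wact i j u).1 (wact i j u).2).
  have -> : (sigz (wact i j u).1 (wact i j u).2 ^ (sigz a b * wt i j)
      = sigz u.1 u.2)%g.
    rewrite conjgE; apply: (mulgI (sigz a b * wt i j)%g); rewrite !mulgA mulgV mul1g.
    rewrite !(sigzM n_gt3 Hzeta HL HG).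
    have := wt_sigz n_gt3 Hzeta HL HG i j u.1 u.2; rewrite -surjective_pairing => H.
    rewrite -!(mulgA (sigz _ _)) H !mulgA (sigzM n_gt3 Hzeta HL HG).
    by congr (sigz _ _ * _ * _)%g; rewrite addrC.
  rewrite !psi_sigz -!surjective_pairing !weight_neq0; split=> //.
  by rewrite eq_sym.
exists (sigz a b * wt (wconj i j p q).1 (wconj i j p q).2 * (sigz a b)^-1)%g.
have -> : ((sigz a b * wt (wconj i j p q).1 (wconj i j p q).2 * (sigz a b)^-1)
    ^ (sigz a b * wt i j) = wt p q)%g.
  rewrite conjgE; apply: (mulgI (sigz a b * wt i j)%g).
  rewrite -!(mulgA (sigz a b)) wconjE //.
  by rewrite !mulgA mulgV mul1g mulgKV.
rewrite psi_conj_sigz !psi_wt ?wconj_lt //; split=> //.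
by rewrite eq_sym.
Qed.

Definition psi_index : nat := \sum_(i < 3) \sum_(j < 2) (c i j != 0)%R.

Lemma fermat_psi_order : psi_order psi = (n * n * psi_index)%N.
Proof.
rewrite /psi_order -sum1_card (reindex of_normal) /=; last exact: onW_bij of_normal_bij.
transitivity (\sum_(a < n) \sum_(b < n) \sum_(i < 3) \sum_(j < 2) (c i j != 0)%R)%N.
  rewrite !pair_big /= big_mkcond; apply: eq_bigr => q _.
  by rewrite inE psi_of_normal mulf_eq0 (negPf (weight_neq0 _)) /=; case: eqP.
by rewrite !sum_nat_const !card_ord mulnA.
Qed.

(** Conjugation by A fixes [psi], so the sum over the group is n^2 times a sum of six terms over
    S_3. *)
Lemma psi_conj_sum a b i j : (i < 3)%N -> (j < 2)%N ->
  \sum_k psi (k * (sigz a b * wt i j) * k^-1)%g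
  = (n * n)%:R * \sum_(i' < 3) \sum_(j' < 2) weight (wact i' j' (a, b))
      * c (wconj i' j' i j).1 (wconj i' j' i j).2.
Proof.
move=> i3 j2; rewrite sum_gT; set S := \sum_(i' < 3) _.
transitivity (\sum_(a' < n) \sum_(b' < n) S); last first.
  by rewrite !sumr_const !card_ord natrM -mulrA mulr_natl mulr_natl.
apply: eq_bigr => a' _; apply: eq_bigr => b' _.
apply: eq_bigr => i' _; apply: eq_bigr => j' _.
have -> : (sigz a' b' * wt i' j' * (sigz a b * wt i j) * (sigz a' b' * wt i' j')^-1
   = sigz a' b' * (wt i' j' * (sigz a b * wt i j) * (wt i' j')^-1) * (sigz a' b')^-1)%g.
  by rewrite invMg !mulgA.
rewrite psi_conj_sigz mulgA (wt_sigz n_gt3 Hzeta HL HG) -(mulgA (sigz _ _)) wconjE //.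
by rewrite mulgA mulgK psiE ?wconj_lt // -surjective_pairing.
Qed.

End FermatCharacters.

Section Eigenspaces.

Variables (K L : fieldType) (n : nat) (iota : {rmorphism K -> L}) (x y : L).
Variables (zeta : K) (D : L -> L).
Variables (gT : finGroupType) (act : gT -> {rmorphism L -> L}).
Variables (sigma : 'I_n -> 'I_n -> gT) (s t : gT).
Hypothesis n_gt3 : (3 < n)%N.
Hypothesis n_neq0 : n%:R != 0 :> K.
Hypothesis Hzeta : n.-primitive_root zeta.
Hypothesis HL : fermat_function_field n iota x y.
Hypothesis HD : is_ddx iota x D.
Hypothesis HG : fermat_group zeta iota x y act sigma s t.
Variable m : nat.

Let n_gt0 : (0 < n)%N. Proof. by apply: leq_trans n_gt3. Qed.
Local Notation sigz := (sigz sigma n_gt3).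
Local Notation wt i j := (s ^+ i * t ^+ j)%g.
Local Notation N := (m * (n - 3))%N.
Local Notation omega := (y ^+ (m * n.-1))^-1.
Local Notation T g := (act_diff x D m (act g)).
Let nzx := x_neq0 n_gt3 HL.
Let nzy := y_neq0 n_gt3 HL.
Let nzz c : zeta ^ c != 0. Proof. by rewrite expfz_neq0 ?(zeta_neq0 n_gt3 Hzeta). Qed.
Let TM := act_diffM n_gt3 n_neq0 HL HD HG m.
Let Tmul g u f : T g (u * f) = act g u * T g f.
Proof. by rewrite /act_diff rmorphM mulrA. Qed.
Let Tlin := act_diff_klinear D HG m.
Let TZ g c f : T g (iota c * f) = iota c * T g f.
Proof. by have [_ H] := Tlin g. Qed.

Lemma nN : (m * n.-1 = N + 2 * m)%N.
Proof.
by rewrite (_ : n.-1 = n - 3 + 2)%N ?mulnDr 1?[(2 * m)%N]mulnC //; lia.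
Qed.

Lemma zeta_nat_mod i : zeta ^+ (i * n) = 1.
Proof. by rewrite mulnC exprM (prim_expr_order Hzeta) expr1n. Qed.

Lemma T_sigma_x : T (sigz 1 0) omega = iota (zeta ^+ m) * omega.
Proof.
rewrite /act_diff fmorphV rmorphXn (sigz_y n_gt3 Hzeta HG) (sigz_x n_gt3 Hzeta HG).
rewrite expr0z rmorph1 mul1r (ddx_mul HD) (ddx_const HD) (ddx_x HD) mul0r add0r mulr1.
by rewrite expr1z -rmorphXn mulrC.
Qed.

(** Here dx is fixed and the scalar is zeta^(-m(n-1)) = zeta^m; for x it came from (dx)^m. So
    [omega] has weight (m, m), which explains the shift of all weights by m. *)
Lemma T_sigma_y : T (sigz 0 1) omega = iota (zeta ^+ m) * omega.
Proof.
rewrite /act_diff fmorphV rmorphXn (sigz_y n_gt3 Hzeta HG) (sigz_x n_gt3 Hzeta HG).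
rewrite expr0z rmorph1 mul1r expr1z (ddx_x HD) expr1n mulr1 exprMn invfM.
congr (_ * _); rewrite -rmorphXn -fmorphV; congr (iota _).
apply: (mulfI (expf_neq0 (m * n.-1) (zeta_neq0 n_gt3 Hzeta))).
rewrite mulfV ?expf_neq0 ?(zeta_neq0 n_gt3 Hzeta) // -exprD -mulnSr prednK //.
by rewrite zeta_nat_mod.
Qed.

Lemma D_y_over_x : D (y / x) = (y ^+ n.-1 * x ^+ 2)^-1.
Proof.
have nzy' : y ^+ n.-1 != 0 by rewrite expf_neq0.
rewrite (derivation_div _ (ddx_mul HD)) // (ddx_x HD) mulr1.
suff H : y ^+ n.-1 * (D y * x - y) = 1.
  by apply: (mulfI nzy'); rewrite mulrA H mul1r [in RHS]invfM mulVKf.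
rewrite mulrBr mulrA (Dy n_neq0 HL HD) mulNr -!exprSr prednK //.
by apply/eqP; rewrite -opprD eqr_oppLR -addr_eq0 (fermat_eq HL).
Qed.

Lemma T_s : T s omega = x ^+ N * omega.
Proof.
rewrite /act_diff fmorphV rmorphXn (fg_s_y HG) (fg_s_x HG) D_y_over_x.
rewrite nN div1r exprVn invrK exprVn exprMn -!exprM [(n.-1 * m)%N]mulnC nN.
rewrite exprD invfM; have := expf_neq0 (2 * m) nzx.
move: (_ ^+ (2 * m)) (_ ^+ N) (_ ^+ (N + 2 * m)) => u v w nzu.
by rewrite mulrACA divff ?mulr1.
Qed.

Lemma T_t : T t omega = (-1) ^+ m * x ^+ N * omega.
Proof.
rewrite /act_diff fmorphV rmorphXn (fg_t_y HG) (fg_t_x HG) div1r.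
have E : x ^+ (m * n.-1) = x ^+ N * x ^+ (2 * m) by rewrite nN exprD.
rewrite (Dinv HD) // (ddx_x HD) !expr_div_n invf_div -!exprM E.
have := expf_neq0 (2 * m) nzx.
move: (x ^+ (2 * m)) (x ^+ N) (y ^+ _) => u v w nzu.
transitivity ((-1) ^+ m * v / w * (u / u)); first by ring.
by rewrite divff ?mulr1.
Qed.

Lemma act_wt21 : act (wt 2 1) x = y /\ act (wt 2 1) y = x.
Proof.
rewrite expg1 !expgS expg0 mulg1 !(fg_actM HG) (fg_t_x HG) (fg_t_y HG).
rewrite !(fmorph_div, rmorph1, fg_s_x HG, fg_s_y HG).
by split; field; rewrite ?nzx ?nzy ?oner_neq0.
Qed.

(** Exchanging x and y turns dx / y^(n-1) into dy / x^(n-1) = - dx / y^(n-1). This is the origin of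
    the sign in the terms B. *)
Lemma T_wt21 : T (wt 2 1) omega = (-1) ^+ m * omega.
Proof.
rewrite expg1 -(t_s n_gt3 HL HG) TM T_s Tmul T_t rmorphXn (fg_t_x HG) div1r.
have := expf_neq0 N nzx; rewrite exprVn.
move: (x ^+ N) => v nzv; transitivity ((-1) ^+ m / y ^+ (m * n.-1) * (v / v)).
  by ring.
by rewrite divff ?mulr1.
Qed.

Lemma sigz_nat (a b : nat) : sigz a b = (sigz 1 0 ^+ a * sigz 0 1 ^+ b)%g.
Proof.
have X1 k : (sigz 1 0 ^+ k)%g = sigz k 0.
  elim: k => [|k IH]; first by rewrite expg0 (sigz0 n_gt3 Hzeta HL HG).
  by rewrite expgS IH (sigzM n_gt3 Hzeta HL HG) addr0 -add1n PoszD.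
have X2 k : (sigz 0 1 ^+ k)%g = sigz 0 k.
  elim: k => [|k IH]; first by rewrite expg0 (sigz0 n_gt3 Hzeta HL HG).
  by rewrite expgS IH (sigzM n_gt3 Hzeta HL HG) addr0 -add1n PoszD.
by rewrite X1 X2 (sigzM n_gt3 Hzeta HL HG) addr0 add0r.
Qed.

Section Generators.

Variables (kappa lam : int) (c : nat -> nat -> K).
Hypothesis c00 : c 0 0 = 1.

(** The eigenvalue conditions are multiplicative along the normal form sigma s^i t^j, so the two
    generators of A and the support of [c] suffice. *)
Lemma psi_eigenP f :
  (forall g, psi zeta sigma s t n_gt3 kappa lam c g != 0 ->
     T g f = iota (psi zeta sigma s t n_gt3 kappa lam c g) * f) <->
  [/\ T (sigz 1 0) f = iota (zeta ^ kappa) * f,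
      T (sigz 0 1) f = iota (zeta ^ lam) * f
    & forall i j, (i < 3)%N -> (j < 2)%N -> c i j != 0 ->
        T (wt i j) f = iota (c i j) * f].
Proof.
pose ps := psi zeta sigma s t n_gt3 kappa lam c; rewrite -/ps.
have psE a b i j : (i < 3)%N -> (j < 2)%N ->
    ps (sigz a b * wt i j)%g = weight zeta kappa lam (a, b) * c i j.
  by move=> i3 j2; apply: (psiE n_gt3 Hzeta HL HG).
have ps1 a b : ps (sigz a b) = weight zeta kappa lam (a, b).
  by apply: (psi_sigz n_gt3 Hzeta HL HG).
have ps2 i j : (i < 3)%N -> (j < 2)%N -> ps (wt i j) = c i j.
  by move=> i3 j2; apply: (psi_wt n_gt3 Hzeta HL HG).
have nzw u : weight zeta kappa lam u != 0 by apply: nzz.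
split=> [H|[H1 H2 H3] g].
  split=> [||i j i3 j2 nz].
  - by rewrite H ps1 // /weight /= ?mulr1 ?mulr0 ?addr0.
  - by rewrite H ps1 // /weight /= ?mulr1 ?mulr0 ?add0r.
  - by rewrite H ps2.
have [a [b [i [j ->]]]] := elements_normal n_gt3 Hzeta HL HG g.
rewrite -mulgA psE // mulf_eq0 negb_or => /andP[_ nz].
rewrite TM (H3 i j) // TZ rmorphM mulrAC mulrC; congr (_ * _).
have TX h z k : T h f = iota z * f -> T (h ^+ k)%g f = iota (z ^+ k) * f.
  move=> E; elim: k => [|k IH].
    by rewrite expg0 (act_diff1 HD HG) expr0 rmorph1 mul1r.
  by rewrite expgSr TM E TZ IH exprSr rmorphM; ring.
rewrite sigz_nat TM (TX _ _ _ H2) TZ (TX _ _ _ H1) mulrA -rmorphM; congr (iota _ * _).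
rewrite /weight /= expfzDr ?(zeta_neq0 n_gt3 Hzeta) // -!exprz_exp -!exprnP.
exact: mulrC.
Qed.

End Generators.

End Eigenspaces.

(** * Eigenbases of the space of holomorphic differentials *)

Section WeightCount.

Variables (n m a b : nat).
Hypothesis a_lt : (a < n)%N.
Hypothesis b_lt : (b < n)%N.

Let n_gt0 : (0 < n)%N. Proof. exact: leq_ltn_trans (leq0n a) a_lt. Qed.
Local Notation N := (m * (n - 3))%N.

Definition weight_ok (ij : 'I_N.+1 * 'I_n) : bool :=
  [&& (ij.1 + ij.2 <= N)%N, (ij.1 %% n == a)%N & ij.2 == b :> nat].

(** The solutions have j = b and i = a + n l, with 0 <= l <= (N - a - b) / n. *)
Lemma card_weight_ok :
  #|weight_ok| = if (a + b <= N)%N then ((N - (a + b)) %/ n).+1 else 0%N.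
Proof.
case: ifPn => [ab|]; last first.
  rewrite -ltnNge => ab; apply: eq_card0 => -[i j]; apply/negP => /and3P[/= ij /eqP ia /eqP jb].
  have := leq_mod i n; rewrite ia => ai.
  by move: ij; rewrite jb leqNgt (leq_trans ab) // leq_add2r.
set q := (_ %/ n)%N; have qn l : (l <= q)%N -> (a + n * l + b <= N)%N.
  move=> lq; rewrite addnAC -leq_subRL // mulnC.
  by apply: leq_trans (leq_divM _ n); rewrite leq_mul2r lq orbT.
pose h (l : 'I_q.+1) : 'I_N.+1 * 'I_n := (inord (a + n * l), Ordinal b_lt).
have hE l : (h l).1 = (a + n * l)%N :> nat.
  by rewrite inordK // ltnS; have := qn l (ltn_ord l); apply: leq_trans (leq_addr _ _).
have h_inj : injective h.
  move=> l l' /(congr1 (fun p => nat_of_ord p.1)); rewrite !hE => /addnI/eqP.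
  by rewrite eqn_mul2l gtn_eqF //= => /eqP/val_inj.
rewrite -[RHS]card_ord -(card_codom h_inj); apply: eq_card => -[i j].
apply/and3P/codomP => [[/= ij /eqP ia /eqP jb]|[l E]].
  have lq : (i %/ n < q.+1)%N.
    rewrite ltnS /q leq_divRL //; move: ij; rewrite jb {1}(divn_eq i n) ia.
    by move: (_ * n)%N => k; lia.
  exists (Ordinal lq); congr (_, _); apply: val_inj => /=; last exact: jb.
  by have := hE (Ordinal lq); rewrite /= => ->; rewrite {1}(divn_eq i n) ia addnC mulnC.
have -> : i = (h l).1 by rewrite -E. have -> : j = (h l).2 by rewrite -E.
rewrite hE /= eqxx; split=> //; first exact: qn (ltn_ord l).
by rewrite addnC mulnC modnMDl modn_small.
Qed.

End WeightCount.

Section Bases.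

Variables (K L : fieldType) (n : nat) (iota : {rmorphism K -> L}) (x y : L).
Variables (zeta : K) (D : L -> L).
Variables (gT : finGroupType) (act : gT -> {rmorphism L -> L}).
Variables (sigma : 'I_n -> 'I_n -> gT) (s t : gT).
Hypothesis n_gt3 : (3 < n)%N.
Hypothesis n_neq0 : n%:R != 0 :> K.
Hypothesis K_closed : forall q : {poly K}, size q != 1%N -> exists a, root q a.
Hypothesis Hzeta : n.-primitive_root zeta.
Hypothesis HL : fermat_function_field n iota x y.
Hypothesis HD : is_ddx iota x D.
Hypothesis HG : fermat_group zeta iota x y act sigma s t.
Variable m : nat.

Let n_gt0 : (0 < n)%N. Proof. by apply: leq_trans n_gt3. Qed.
Local Notation sigz := (sigz sigma n_gt3).
Local Notation N := (m * (n - 3))%N.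
Local Notation omega := (y ^+ (m * n.-1))^-1.
Local Notation holo := (holo_diff iota x y D n m).
Local Notation T g := (act_diff x D m (act g)).
Let nzx := x_neq0 n_gt3 HL.
Let nzy := y_neq0 n_gt3 HL.
Let Tmul g u f : T g (u * f) = act g u * T g f.
Proof. by rewrite /act_diff rmorphM mulrA. Qed.
Let Tlin := act_diff_klinear D HG m.

Lemma act_sigma_x i j : act (sigz 1 0) (x ^+ i * y ^+ j) = iota (zeta ^+ i) * (x ^+ i * y ^+ j).
Proof.
rewrite rmorphM !rmorphXn /= (sigz_x n_gt3 Hzeta HG) (sigz_y n_gt3 Hzeta HG).
by rewrite expr1z expr0z rmorph1 mul1r exprMn -rmorphXn mulrA.
Qed.

Lemma act_sigma_y i j : act (sigz 0 1) (x ^+ i * y ^+ j) = iota (zeta ^+ j) * (x ^+ i * y ^+ j).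
Proof.
rewrite rmorphM !rmorphXn /= (sigz_x n_gt3 Hzeta HG) (sigz_y n_gt3 Hzeta HG).
by rewrite expr1z expr0z rmorph1 mul1r exprMn -rmorphXn mulrCA.
Qed.

Section Weight.

Variables (kappa lam : int) (a b : nat).
Hypothesis a_lt : (a < n)%N.
Hypothesis b_lt : (b < n)%N.
Hypothesis aE : (a%:Z + m%:Z = kappa %[mod n])%Z.
Hypothesis bE : (b%:Z + m%:Z = lam %[mod n])%Z.

Definition weight_space f :=
  (holo f /\ T (sigz 1 0) f = iota (zeta ^ kappa) * f) /\
  T (sigz 0 1) f = iota (zeta ^ lam) * f.

Lemma zeta_weight i e k : (e < n)%N -> (e%:Z + m%:Z = k %[mod n])%Z ->
  (zeta ^+ (i + m) == zeta ^ k) = (i %% n == e)%N.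
Proof.
move=> en ek; apply/eqP/eqP => [|ie]; last first.
  rewrite exprnP; apply: (zeta_mod n_gt3 Hzeta).
  by rewrite -ek PoszD -[LHS]modzDml modz_nat ie.
rewrite exprnP => /(zeta_eq n_gt3 Hzeta); rewrite -ek PoszD => H.
have : (i%:Z = e%:Z %[mod n])%Z.
  by apply/eqP; rewrite -(eqz_modDr m%:Z); apply/eqP.
by rewrite !modz_nat => -[->]; rewrite modn_small.
Qed.

Lemma weight_basis : basis_on iota (weight_ok a b) (mono (n := n) x y (m := m)) weight_space.
Proof.
have H0 := holo_basis n_gt3 n_neq0 K_closed Hzeta HL HD m.
have [e1 e2] := (T_sigma_x n_gt3 Hzeta HD HG m, T_sigma_y n_gt3 Hzeta HD HG m).
have m1 (ij : 'I_N.+1 * 'I_n) : mono_ok ij ->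
    T (sigz 1 0) (mono x y ij) = iota (zeta ^+ (ij.1 + m)) * mono x y ij.
  by move=> _; rewrite /mono Tmul act_sigma_x e1 exprD rmorphM; ring.
have m2 (ij : 'I_N.+1 * 'I_n) : mono_ok ij && (zeta ^+ (ij.1 + m) == zeta ^ kappa) ->
    T (sigz 0 1) (mono x y ij) = iota (zeta ^+ (ij.2 + m)) * mono x y ij.
  by move=> _; rewrite /mono Tmul act_sigma_y e2 exprD rmorphM; ring.
have H1 := basis_on_eigen (zeta ^ kappa) H0 (Tlin (sigz 1 0)) m1.
have [sp fr] := basis_on_eigen (zeta ^ lam) H1 (Tlin (sigz 0 1)) m2.
have PE (ij : 'I_N.+1 * 'I_n) : weight_ok a b ij = (mono_ok ij && (zeta ^+ (ij.1 + m) == zeta ^ kappa))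
    && (zeta ^+ (ij.2 + m) == zeta ^ lam).
  rewrite (zeta_weight _ a_lt aE) (zeta_weight _ b_lt bE).
  by rewrite (modn_small (ltn_ord ij.2)) -andbA.
split=> [f|c Hc ij].
  rewrite [weight_space f]/weight_space sp; split=> -[c ->]; exists c;
    by apply: eq_bigl => ij; rewrite PE.
rewrite PE; apply: fr; rewrite -[RHS]Hc.
by apply: eq_bigl => ij'; rewrite PE.
Qed.

End Weight.

(** At the root [r] of [A] only the term l = 0 survives, and [B] does not vanish there, so its
    coefficient is zero. Dividing by [A] lowers q. *)
Lemma free_powers (A B : {poly K}) r q (c : nat -> K) :
    A != 0 -> A.[r] = 0 -> B.[r] != 0 ->
    \sum_(l < q.+1) c l *: (A ^+ l * B ^+ (q - l)) = 0 ->
  forall l, (l < q.+1)%N -> c l = 0.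
Proof.
move=> nzA Ar Br; elim: q c => [|q IH] c.
  rewrite big_ord1 !expr0 mulr1 => /eqP.
  by rewrite scaler_eq0 oner_eq0 orbF => /eqP c0 [].
rewrite big_ord_recl subn0 expr0 mul1r => H.
have {}H : c 0%N *: B ^+ q.+1
    + A * \sum_(l < q.+1) c l.+1 *: (A ^+ l * B ^+ (q - l)) = 0.
  rewrite -[RHS]H; congr (_ + _); rewrite mulr_sumr; apply: eq_bigr => l _.
  by rewrite lift0 subSS exprS -scalerAr mulrA.
have c0 : c 0%N = 0.
  have := congr1 (fun p => p.[r]) H.
  rewrite /= hornerD hornerZ hornerM Ar mul0r addr0 horner_exp horner0 => /eqP.
  by rewrite mulf_eq0 expf_eq0 (negPf Br) /= orbF => /eqP.
move: H; rewrite c0 scale0r add0r => /eqP; rewrite mulf_eq0 (negPf nzA) /=.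
move=> /eqP H [|l] //; rewrite ltnS; exact: (IH (fun l => c l.+1) H).
Qed.

Section Balanced.

Variables (kappa : int) (a c0 q : nat).
Hypothesis a_lt : (a < n)%N.
Hypothesis aE : (a%:Z + m%:Z = kappa %[mod n])%Z.
Hypothesis c0_lt : (c0 < n)%N.
Hypothesis NE : (N = a + a + c0 + n * q)%N.

Local Notation WS := (weight_space kappa kappa).
Local Notation evx := (evx iota x).

(** The form behind this differential is x_1^a x_2^a x_0^c0 G, of degree N by [NE]. The factor G is
    invariant, so x^a y^a and [omega] alone determine the weight. *)
Lemma weight_space_mem (G : {mpoly K[3]}) : G \is (n * q).-homog ->
    act (sigz 1 0) (dehomog iota x y G) = dehomog iota x y G ->
    act (sigz 0 1) (dehomog iota x y G) = dehomog iota x y G ->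
  WS (x ^+ a * y ^+ a * dehomog iota x y G * omega).
Proof.
move=> hG G1 G2; split; first split.
- have -> : x ^+ a * y ^+ a * dehomog iota x y G
      = dehomog iota x y ('X_o0 ^+ a * 'X_o1 ^+ a * 'X_o2 ^+ c0 * G).
    by rewrite !rmorphM !rmorphXn /= !dehomogXU /= expr1n mulr1.
  apply: (form_holo_diff n_gt3 n_neq0 Hzeta HL HD); rewrite NE.
  by apply: dhomogM => //; apply: dhomogM; [apply: dhomogM|]; exact: dhomogXn.
- rewrite Tmul rmorphM act_sigma_x G1 (T_sigma_x n_gt3 Hzeta HD HG).
  rewrite -(eqP (_ : zeta ^+ (a + m) == zeta ^ kappa)); last first.
    by rewrite (zeta_weight _ a_lt aE) modn_small.
  by rewrite exprD rmorphM /=; ring.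
rewrite Tmul rmorphM act_sigma_y G2 (T_sigma_y n_gt3 Hzeta HD HG).
rewrite -(eqP (_ : zeta ^+ (a + m) == zeta ^ kappa)); last first.
  by rewrite (zeta_weight _ a_lt aE) modn_small.
by rewrite exprD rmorphM /=; ring.
Qed.

Lemma card_balanced : #|@weight_ok n m a a| = q.+1.
Proof.
rewrite (card_weight_ok m a_lt a_lt) NE -addnA leq_addr addKn.
by rewrite [(n * q)%N]mulnC addnC divnMDl // divn_small // addn0.
Qed.

Lemma balanced_free k (g : 'I_k -> L) (G : 'I_k -> {poly K}) (c : 'I_k -> K) :
    (forall l, g l = evx (G l)) ->
    \sum_l iota (c l) * (x ^+ a * y ^+ a * g l * omega) = 0 ->
  \sum_l c l *: G l = 0.
Proof.
move=> gE H; apply: (evx_inj n_gt0 HL); rewrite rmorph0.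
have nz : x ^+ a * y ^+ a * omega != 0.
  by rewrite !mulf_neq0 ?invr_neq0 ?expf_neq0.
apply: (mulIf nz); rewrite mul0r -[RHS]H rmorph_sum mulr_suml.
apply: eq_bigr => l _; rewrite gE /= -mul_polyC rmorphM /= evxC; ring.
Qed.

End Balanced.

End Bases.

(** * Bases adapted to the exchange of x and y and to the rotation *)

Section SpecialBases.

Variables (K L : fieldType) (n : nat) (iota : {rmorphism K -> L}) (x y : L).
Variables (zeta : K) (D : L -> L).
Variables (gT : finGroupType) (act : gT -> {rmorphism L -> L}).
Variables (sigma : 'I_n -> 'I_n -> gT) (s t : gT).
Hypothesis n_gt3 : (3 < n)%N.
Hypothesis n_neq0 : n%:R != 0 :> K.
Hypothesis K_closed : forall q : {poly K}, size q != 1%N -> exists a, root q a.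
Hypothesis Hzeta : n.-primitive_root zeta.
Hypothesis HL : fermat_function_field n iota x y.
Hypothesis HD : is_ddx iota x D.
Hypothesis HG : fermat_group zeta iota x y act sigma s t.
Variable m : nat.

Let n_gt0 : (0 < n)%N. Proof. by apply: leq_trans n_gt3. Qed.
Local Notation sigz := (sigz sigma n_gt3).
Local Notation wt i j := (s ^+ i * t ^+ j)%g.
Local Notation N := (m * (n - 3))%N.
Local Notation omega := (y ^+ (m * n.-1))^-1.
Local Notation T g := (act_diff x D m (act g)).
Let nzx := x_neq0 n_gt3 HL.
Let Tmul g u f : T g (u * f) = act g u * T g f.
Proof. by rewrite /act_diff rmorphM mulrA. Qed.
Let Tlin := act_diff_klinear D HG m.

Variables (kappa : int) (a c0 q : nat).
Hypothesis a_lt : (a < n)%N.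
Hypothesis aE : (a%:Z + m%:Z = kappa %[mod n])%Z.
Hypothesis c0_lt : (c0 < n)%N.
Hypothesis NE : (N = a + a + c0 + n * q)%N.
Hypothesis two_neq0 : 2%:R != 0 :> K.

Local Notation WS := (weight_space iota x y zeta D act sigma n_gt3 m kappa kappa).
Local Notation evx := (evx iota x).
Local Notation dh := (dehomog iota x y).

Lemma act_sigz_xn b1 b2 : act (sigz b1 b2) (x ^+ n) = x ^+ n.
Proof.
rewrite rmorphXn (sigz_x n_gt3 Hzeta HG) exprMn -rmorphXn exprnP exprzAC.
by rewrite -exprnP (prim_expr_order Hzeta) exp1rz rmorph1 mul1r.
Qed.

Lemma act_sigz_yn b1 b2 : act (sigz b1 b2) (y ^+ n) = y ^+ n.
Proof.
rewrite rmorphXn (sigz_y n_gt3 Hzeta HG) exprMn -rmorphXn exprnP exprzAC.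
by rewrite -exprnP (prim_expr_order Hzeta) exp1rz rmorph1 mul1r.
Qed.

Let xn : x ^+ n = evx 'X^n. Proof. by rewrite rmorphXn /= evxX. Qed.
Let yn : y ^+ n = evx (- 1 - 'X^n).
Proof.
rewrite rmorphB rmorphN rmorph1 /= -xn; apply/eqP.
rewrite -subr_eq0 (_ : _ - _ = x ^+ n + y ^+ n + 1); last by ring.
by rewrite (fermat_eq HL).
Qed.

(* Products of eigenforms for the exchange of x and y. *)
Definition formB (l : nat) : {mpoly K[3]} :=
  ('X_o0 ^+ n - 'X_o1 ^+ n) ^+ l * ('X_o0 ^+ n + 'X_o1 ^+ n) ^+ (q - l).

Lemma dh_formB l :
  dh (formB l) = (x ^+ n - y ^+ n) ^+ l * (x ^+ n + y ^+ n) ^+ (q - l).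
Proof. by rewrite rmorphM !rmorphXn rmorphB rmorphD !rmorphXn /= !dehomogXU. Qed.

Lemma T_wt21_mem g : T (wt 2 1) (x ^+ a * y ^+ a * g * omega)
  = x ^+ a * y ^+ a * (act (wt 2 1) g * (-1) ^+ m) * omega.
Proof.
have [wx wy] := act_wt21 n_gt3 HL HG.
rewrite Tmul (T_wt21 n_gt3 n_neq0 Hzeta HL HD HG) !rmorphM !rmorphXn /= wx wy.
ring.
Qed.

(** The number of forms equals the dimension q + 1. On the curve y^n = -1 - x^n, so x^n - y^n
    becomes 2x^n + 1 and x^n + y^n becomes -1; independence follows at a root of 2X^n + 1, which is
    nonconstant since 2 is invertible. *)
Lemma basisB : basis_on iota xpredT
  (fun l : 'I_q.+1 => x ^+ a * y ^+ a * dh (formB l) * omega) WS.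
Proof.
have formE l : dh (formB l) = evx ((2%:R *: 'X^n + 1) ^+ l * (-1) ^+ (q - l)).
  rewrite dh_formB xn yn -rmorphB -rmorphD -!rmorphXn -rmorphM /=.
  by congr (evx (_ ^+ _ * _ ^+ _)); rewrite -?mul_polyC ?polyC_natr; ring.
apply: (basis_on_free (weight_basis n_gt3 n_neq0 K_closed Hzeta HL HD HG
  a_lt a_lt aE aE)).
- exact: (card_balanced n_gt3 a_lt c0_lt NE).
- move=> l; apply: (weight_space_mem n_neq0 Hzeta HL HD HG a_lt aE NE).
  + have -> : (n * q = n * l + n * (q - l))%N.
      by rewrite -mulnDr subnKC // -ltnS.
    apply: dhomogM; apply: dhomogMn; [apply: rpredB|apply: rpredD]; exact: dhomogXn.
  + by rewrite dh_formB rmorphM !rmorphXn rmorphB rmorphD /= act_sigz_xn act_sigz_yn.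
  + by rewrite dh_formB rmorphM !rmorphXn rmorphB rmorphD /= act_sigz_xn act_sigz_yn.
move=> c /(balanced_free n_gt3 HL (G := fun l : 'I_q.+1 => _) (fun l => formE l)) H l.
pose c' k := if insub k is Some l' then c l' else 0.
have [|r Hr] := K_closed (q := 2%:R *: 'X^n + 1).
  rewrite size_polyDl size_scale // size_polyXn ?size_poly1 ?ltnS //.
  by rewrite eqSS gtn_eqF.
have -> : c l = c' l by rewrite /c' valK.
apply: (free_powers (A := 2%:R *: 'X^n + 1) (B := -1) (r := r) (q := q)) => //.
- apply/eqP => /(congr1 (fun p => p.[0])).
  rewrite hornerD hornerZ hornerXn hornerC horner0 expr0n gtn_eqF // mulr0 add0r.
  by move/eqP; rewrite oner_eq0.
- exact/rootP.
- by rewrite hornerN hornerC oppr_eq0 oner_neq0.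
by rewrite -[RHS]H; apply: eq_bigr => k _; rewrite /c' valK.
Qed.

Section Triple.

Variable w : K.
Hypothesis Hw : w ^+ 2 + w + 1 = 0.
Hypothesis three_neq0 : 3%:R != 0 :> K.
Hypothesis c0a : c0 = a.

Let w2 : w ^+ 2 = - w - 1.
Proof. by apply/eqP; rewrite -subr_eq0 opprB opprK addrC -addrA addrC addrAC -Hw; apply/eqP; ring. Qed.

Let w3 : w ^+ 3 = 1.
Proof. by rewrite exprS w2 mulrBr mulr1 mulrN -expr2 w2; ring. Qed.

(* U and V are eigenforms for s, up to a power of x, and are exchanged together
   with x and y by s^2 t. *)
Definition formU : {mpoly K[3]} :=
  w *: 'X_o0 ^+ n + w ^+ 2 *: 'X_o1 ^+ n + 'X_o2 ^+ n.
Definition formV : {mpoly K[3]} :=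
  w ^+ 2 *: 'X_o0 ^+ n + w *: 'X_o1 ^+ n + 'X_o2 ^+ n.

Local Notation U := (iota w * x ^+ n + iota w ^+ 2 * y ^+ n + 1).
Local Notation V := (iota w ^+ 2 * x ^+ n + iota w * y ^+ n + 1).

Lemma dh_formU : dh formU = U.
Proof. by rewrite !rmorphD /= !dhZ !rmorphXn /= !dehomogXU /= expr1n. Qed.

Lemma dh_formV : dh formV = V.
Proof. by rewrite !rmorphD /= !dhZ !rmorphXn /= !dehomogXU /= expr1n. Qed.

Lemma formU_homog : formU \is n.-homog.
Proof. by rewrite !rpredD ?rpredZ ?dhomogXn. Qed.

Lemma formV_homog : formV \is n.-homog.
Proof. by rewrite !rpredD ?rpredZ ?dhomogXn. Qed.

Lemma sigma_formUV b1 b2 : act (sigz b1 b2) U = U /\ act (sigz b1 b2) V = V.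
Proof.
by rewrite !rmorphD !rmorphM /= !(fg_actK HG) act_sigz_xn act_sigz_yn rmorph1.
Qed.

Let w3L : iota w ^+ 3 = 1. Proof. by rewrite -rmorphXn w3 rmorph1. Qed.

Lemma act_s_formUV :
  act s U = iota w ^+ 2 * U / x ^+ n /\ act s V = iota w * V / x ^+ n.
Proof.
have nzxn : x ^+ n != 0 by rewrite expf_neq0.
rewrite !rmorphD !rmorphM !rmorphXn /= !(fg_actK HG) (fg_s_x HG) (fg_s_y HG) rmorph1.
rewrite div1r exprVn expr_div_n; move: w3L nzxn.
move: (iota w) (x ^+ n) (y ^+ n) => u X Y u3 nzX; split; apply: (mulIf nzX).
  transitivity (u ^+ 3 * u * Y + u * u + u ^+ 3 * X); first by rewrite u3; field.
  by rewrite divfK //; ring.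
transitivity (u * u * Y + u + u ^+ 3 * X); first by rewrite u3; field.
by rewrite divfK //; ring.
Qed.

Lemma act_wt21_formUV : act (wt 2 1) U = V /\ act (wt 2 1) V = U.
Proof.
have [wx wy] := act_wt21 n_gt3 HL HG.
rewrite !rmorphD !rmorphM !rmorphXn /= !(fg_actK HG) wx wy rmorph1.
by split; congr (_ + _); exact: addrC.
Qed.

(** With N = 3a + nq, the factor x^N that [s] gives to [omega] cancels x^(-nq) and turns the image
    y^a x^(-2a) of x^a y^a back into x^a y^a. *)
Lemma T_s_mem g g' : act s g = g' / x ^+ (n * q) ->
  T s (x ^+ a * y ^+ a * g * omega) = x ^+ a * y ^+ a * g' * omega.
Proof.
move=> sg; rewrite Tmul (T_s n_gt3 n_neq0 Hzeta HL HD HG) !rmorphM !rmorphXn /=.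
rewrite sg (fg_s_x HG) (fg_s_y HG) div1r NE c0a !exprD exprVn expr_div_n.
have := expf_neq0 a nzx; have := expf_neq0 (n * q) nzx.
move: (x ^+ a) (x ^+ (n * q)) (y ^+ a) omega => u v z o nzv nzu.
transitivity (u * z * g' * o * (u / u) ^+ 2 * (v / v)); first by rewrite expr2; ring.
by rewrite !divff // expr1n !mulr1.
Qed.

Definition polyU : {poly K} := (w - w ^+ 2) *: 'X^n + (1 - w ^+ 2)%:P.
Definition polyV : {poly K} := (w ^+ 2 - w) *: 'X^n + (1 - w)%:P.

Lemma formUE : U = evx polyU.
Proof.
rewrite yn rmorphB rmorphN rmorph1 /= -xn /polyU rmorphD /= -mul_polyC rmorphM /=.
by rewrite -xn !evxC !rmorphB rmorph1 rmorphXn /=; ring.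
Qed.

Lemma formVE : V = evx polyV.
Proof.
rewrite yn rmorphB rmorphN rmorph1 /= -xn /polyV rmorphD /= -mul_polyC rmorphM /=.
by rewrite -xn !evxC !rmorphB rmorph1 rmorphXn /=; ring.
Qed.

Lemma polyUVE r : polyU.[r] = (w - w ^+ 2) * r ^+ n + (1 - w ^+ 2) /\
  polyV.[r] = (w ^+ 2 - w) * r ^+ n + (1 - w).
Proof. by rewrite !hornerD !hornerZ !hornerXn !hornerC. Qed.

(** The point x^n = w, y^n = w^2. It separates U from V in characteristic other than 3. *)
Lemma root_w : exists r, polyU.[r] = 0 /\ polyV.[r] = 3%:R.
Proof.
have [|r /rootP] := @K_closed ('X^n - w%:P).
  by rewrite size_XnsubC // eqSS -lt0n.
rewrite !hornerE => /subr0_eq rn; exists r.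
have [-> ->] := polyUVE r; rewrite rn; split.
  by rewrite mulrBl -exprSr w3 -expr2; ring.
by rewrite mulrBl -exprSr w3 -expr2 w2; ring.
Qed.

(** The point x^n = y^n = -1/2, fixed by the exchange on n-th powers, where U = V = 3/2. There U^3 -
    V^3 vanishes and U^3 + V^3 does not. *)
Lemma root_half : exists r, polyU.[r] = polyV.[r] /\ 2%:R * polyU.[r] = 3%:R.
Proof.
have [|r /rootP] := @K_closed (2%:R *: 'X^n + 1).
  rewrite size_polyDl size_scale // size_polyXn ?size_poly1 ?ltnS //.
  by rewrite eqSS gtn_eqF.
rewrite hornerD hornerZ hornerXn hornerC => rn; exists r.
have [-> ->] := polyUVE r.
have E : 2%:R * r ^+ n = -1 by apply/eqP; rewrite -subr_eq0 opprK rn.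
split; last by rewrite mulrDr mulrCA E w2; ring.
apply: (mulfI two_neq0); rewrite !mulrDr !(mulrCA 2%:R) E w2; ring.
Qed.

Lemma polyUV_neq0 : polyU != 0 /\ polyV != 0.
Proof.
have [r [_ V3]] := root_w; have [r' [_ U3]] := root_half; split.
  by apply/eqP => U0; move: U3 three_neq0; rewrite U0 horner0 mulr0 => <-; rewrite eqxx.
by apply/eqP => V0; move: V3 three_neq0; rewrite V0 horner0 => <-; rewrite eqxx.
Qed.

Definition formA1 (l : nat) : {mpoly K[3]} := formU ^+ l * formV ^+ (q - l).

Lemma basisA1 : basis_on iota xpredT
  (fun l : 'I_q.+1 => x ^+ a * y ^+ a * dh (formA1 l) * omega) WS.
Proof.
have formE l : dh (formA1 l) = evx (polyU ^+ l * polyV ^+ (q - l)).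
  rewrite rmorphM !rmorphXn /= dh_formU dh_formV formUE formVE.
  by rewrite rmorphM !rmorphXn.
have sg b1 b2 l : act (sigz b1 b2) (dh (formA1 l)) = dh (formA1 l).
  have [e1 e2] := sigma_formUV b1 b2.
  by rewrite rmorphM !rmorphXn /= dh_formU dh_formV rmorphM !rmorphXn e1 e2.
apply: (basis_on_free (weight_basis n_gt3 n_neq0 K_closed Hzeta HL HD HG
  a_lt a_lt aE aE)).
- exact: (card_balanced n_gt3 a_lt c0_lt NE).
- move=> l; apply: (weight_space_mem n_neq0 Hzeta HL HD HG a_lt aE NE) => //.
  have -> : (n * q = n * l + n * (q - l))%N.
    by rewrite -mulnDr subnKC // -ltnS.
  by apply: dhomogM; apply: dhomogMn; rewrite ?formU_homog ?formV_homog.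
move=> c /(balanced_free n_gt3 HL (G := fun l : 'I_q.+1 => _) (fun l => formE l)) H l.
pose c' k := if insub k is Some l' then c l' else 0.
have [r [rU rV]] := root_w.
have -> : c l = c' l by rewrite /c' valK.
apply: (free_powers (A := polyU) (B := polyV) (r := r) (q := q)) => //.
- by have [] := polyUV_neq0.
- by rewrite rV.
by rewrite -[RHS]H; apply: eq_bigr => k _; rewrite /c' valK.
Qed.

Lemma T_s_A1 (l : 'I_q.+1) : T s (x ^+ a * y ^+ a * dh (formA1 l) * omega)
  = iota (w ^+ (q + l)) * (x ^+ a * y ^+ a * dh (formA1 l) * omega).
Proof.
rewrite (T_s_mem (g' := iota (w ^+ (q + l)) * dh (formA1 l))); first by ring.
have [e1 e2] := act_s_formUV.
have lq : (l <= q)%N by rewrite -ltnS.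
rewrite rmorphM !rmorphXn /= dh_formU dh_formV rmorphM !rmorphXn e1 e2.
have -> : (n * q = n * l + n * (q - l))%N by rewrite -mulnDr subnKC.
have -> : (q + l = 2 * l + (q - l))%N by lia.
rewrite !expr_div_n !exprMn !exprD -!exprM invfM; ring.
Qed.

Section Invariants.

Variables (l0 k : nat).
Hypothesis qE : (q = 2 * l0 + 3 * k)%N.

(* These are invariant under s; the family U^l V^(q-l) diagonalises s, but not
   s^2 t. *)
Definition formA2 (i : nat) : {mpoly K[3]} := (formU * formV) ^+ l0
  * ((formU ^+ 3 - formV ^+ 3) ^+ i * (formU ^+ 3 + formV ^+ 3) ^+ (k - i)).

Lemma rmorph_A2 (R S : comNzRingType) (f : {rmorphism R -> S}) u v l i j :
  f ((u * v) ^+ l * ((u ^+ 3 - v ^+ 3) ^+ i * (u ^+ 3 + v ^+ 3) ^+ j))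
  = (f u * f v) ^+ l * ((f u ^+ 3 - f v ^+ 3) ^+ i * (f u ^+ 3 + f v ^+ 3) ^+ j).
Proof. by rewrite !(rmorphXn, rmorphM, rmorphB, rmorphD). Qed.

Lemma dh_formA2 i : dh (formA2 i) = (U * V) ^+ l0
  * ((U ^+ 3 - V ^+ 3) ^+ i * (U ^+ 3 + V ^+ 3) ^+ (k - i)).
Proof.
by rewrite /formA2 rmorph_A2 /= dh_formU dh_formV.
Qed.

Lemma act_formA2 g i : act g (dh (formA2 i)) = (act g U * act g V) ^+ l0
  * ((act g U ^+ 3 - act g V ^+ 3) ^+ i * (act g U ^+ 3 + act g V ^+ 3) ^+ (k - i)).
Proof.
by rewrite dh_formA2 rmorph_A2.
Qed.

Lemma formA2_homog i : (i < k.+1)%N -> formA2 i \is (n * q).-homog.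
Proof.
rewrite ltnS => ik.
have -> : (n * q = (n + n) * l0 + ((n * 3) * i + (n * 3) * (k - i)))%N.
  by rewrite qE -mulnDr subnKC //; ring.
apply: dhomogM; first by apply: dhomogMn; rewrite dhomogM ?formU_homog ?formV_homog.
apply: dhomogM; apply: dhomogMn; [apply: rpredB|apply: rpredD];
  by apply: dhomogMn; rewrite ?formU_homog ?formV_homog.
Qed.

Lemma T_s_A2 (i : 'I_k.+1) : T s (x ^+ a * y ^+ a * dh (formA2 i) * omega)
  = x ^+ a * y ^+ a * dh (formA2 i) * omega.
Proof.
apply: T_s_mem; have [e1 e2] := act_s_formUV.
have ik : (i <= k)%N by rewrite -ltnS.
rewrite act_formA2 dh_formA2 e1 e2.
have -> : (n * q = (n + n) * l0 + ((n * 3) * i + (n * 3) * (k - i)))%N.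
  by rewrite qE -mulnDr subnKC //; ring.
rewrite (exprD x) (exprD x (n * 3 * i)) !(exprM x) exprD.
have nzX : x ^+ n != 0 by rewrite expf_neq0.
move: w3L nzX; move: (iota w) (x ^+ n) U V => u X P Q u3 nzX.
have -> : u ^+ 2 * P / X * (u * Q / X) = P * Q / (X * X).
  by transitivity (u ^+ 3 * (P * Q) / (X * X)); [field|rewrite u3 mul1r].
have -> : (u ^+ 2 * P / X) ^+ 3 = P ^+ 3 / X ^+ 3.
  rewrite expr_div_n exprMn -exprM (_ : 2 * 3 = 3 * 2)%N // exprM u3.
  by rewrite expr1n mul1r.
have -> : (u * Q / X) ^+ 3 = Q ^+ 3 / X ^+ 3.
  by rewrite expr_div_n exprMn u3 mul1r.
rewrite -mulrBl -mulrDl !expr_div_n !invfM; ring.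
Qed.

Lemma T_wt21_A2 (i : 'I_k.+1) :
  T (wt 2 1) (x ^+ a * y ^+ a * dh (formA2 i) * omega)
  = iota ((-1) ^+ (m + i)) * (x ^+ a * y ^+ a * dh (formA2 i) * omega).
Proof.
rewrite T_wt21_mem act_formA2 dh_formA2; have [-> ->] := act_wt21_formUV.
rewrite rmorphXn rmorphN1 exprD -[V ^+ 3 - U ^+ 3]opprB [V ^+ 3 + _]addrC.
rewrite [(- _) ^+ i]exprNn.
rewrite [V * U]mulrC; move: U V => u v; ring.
Qed.

(** The basis of powers of U and V shows that the invariants of [s] have dimension k + 1.
    Independence reduces, after cancelling (UV)^l0, to that of the products of powers of U^3 - V^3
    and U^3 + V^3, tested where U = V. *)
Lemma basisA2 : #|[pred l : 'I_q.+1 | w ^+ (q + l) == 1]| = k.+1 ->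
  basis_on iota xpredT
    (fun i : 'I_k.+1 => x ^+ a * y ^+ a * dh (formA2 i) * omega)
    (fun f => WS f /\ T s f = iota 1 * f).
Proof.
move=> card.
have B1 := basis_on_eigen 1 basisA1 (Tlin s) (fun l _ => T_s_A1 l).
have formE i : dh (formA2 i) = evx ((polyU * polyV) ^+ l0
   * ((polyU ^+ 3 - polyV ^+ 3) ^+ i * (polyU ^+ 3 + polyV ^+ 3) ^+ (k - i))).
  by rewrite dh_formA2 formUE formVE rmorph_A2.
apply: (basis_on_free B1).
- by rewrite -card; apply: eq_card.
- move=> i; rewrite rmorph1 mul1r; split; last exact: T_s_A2.
  apply: (weight_space_mem n_neq0 Hzeta HL HD HG a_lt aE NE).
  + exact: formA2_homog.
  + by have [e1 e2] := sigma_formUV 1 0; rewrite act_formA2 e1 e2 dh_formA2.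
  + by have [e1 e2] := sigma_formUV 0 1; rewrite act_formA2 e1 e2 dh_formA2.
move=> c /(balanced_free n_gt3 HL (G := fun l : 'I_k.+1 => _) (fun l => formE l)) H i.
have [nzU nzV] := polyUV_neq0.
pose c' j := if insub j is Some l' then c l' else 0.
have {}H : \sum_(l < k.+1) c' l *: ((polyU ^+ 3 - polyV ^+ 3) ^+ l
    * (polyU ^+ 3 + polyV ^+ 3) ^+ (k - l)) = 0.
  have nz : (polyU * polyV) ^+ l0 != 0 by rewrite expf_neq0 // mulf_neq0.
  apply: (mulfI nz); rewrite mulr0 -[RHS]H mulr_sumr; apply: eq_bigr => l _.
  by rewrite -scalerAr /c' valK.
have -> : c i = c' i by rewrite /c' valK.
have [r [rU rV]] := root_half; have [r' [r'U r'V]] := root_w.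
apply: (free_powers (r := r) _ _ _ H) => //.
- apply/eqP => /(congr1 (fun p => p.[r'])).
  rewrite hornerD hornerN !horner_exp r'U r'V horner0 expr0n sub0r => /eqP.
  by rewrite oppr_eq0 expf_eq0 (negPf three_neq0).
- by rewrite hornerD hornerN !horner_exp -rU subrr.
rewrite hornerD !horner_exp -rU -mulr2n -mulr_natl mulf_neq0 // expf_neq0 //.
by apply: contraNneq three_neq0 => U0; rewrite -rV U0 mulr0.
Qed.

End Invariants.

End Triple.

End SpecialBases.

(** * Counting *)

Section Arithmetic.

Lemma card_mod2 Q r : (r < 2)%N ->
  #|[pred l : 'I_Q | (l %% 2 == r)%N]| = ((Q + 1 - r) %/ 2)%N.
Proof.
move=> r2; rewrite -sum1_card big_mkcond /=.
elim: Q => [|Q IH]; first by rewrite big_ord0; lia.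
rewrite big_ord_recr /= IH inE /=; case: eqP; lia.
Qed.

Lemma card_mod3 Q r : (r < 3)%N ->
  #|[pred l : 'I_Q | (l %% 3 == r)%N]| = ((Q + 2 - r) %/ 3)%N.
Proof.
move=> r3; rewrite -sum1_card big_mkcond /=.
elim: Q => [|Q IH]; first by rewrite big_ord0; lia.
rewrite big_ord_recr /= IH inE /=; case: eqP; lia.
Qed.

Variables n m : nat.
Hypothesis n_gt3 : (3 < n)%N.
Hypothesis m_gt0 : (0 < m)%N.

Lemma residue_bound k : 0 <= residue n k < n%:Z.
Proof.
rewrite /residue modz_ge0 ?ltz_pmod //.
  by rewrite ltz_nat; apply: leq_trans n_gt3.
by rewrite eqz_nat; case: (n) n_gt3.
Qed.

(** Adding the residue of 1 - 3m rounds 3m - 1 up to a multiple of n, so the division is exact. The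
    same residue occurs in [alpha], which makes the two comparable. *)
Definition ceil_int : int := ((3 * m%:Z - 1 + residue n (1 - 3 * m%:Z)) %/ n)%Z.

Lemma ceil_intE : n%:Z * ceil_int = 3 * m%:Z - 1 + residue n (1 - 3 * m%:Z).
Proof.
rewrite mulrC divzK // /residue; apply/dvdz_mod0P.
by rewrite modzDmr addrA subrK subrr mod0z.
Qed.

Lemma ceilE : Num.ceil ((3 * m%:R - 1) / n%:R : rat) = ceil_int.
Proof.
have n0 : (0 : rat) < n%:R by rewrite ltr0n; apply: leq_trans n_gt3.
have /andP[w0 wn] := residue_bound (1 - 3 * m%:Z).
apply: ceil_def; rewrite ltr_pdivlMr // ler_pdivrMr //.
have -> : (3 * m%:R - 1 : rat) = (3 * m%:Z - 1)%:~R.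
  by rewrite rmorphB rmorphM.
have -> : (n%:R : rat) = n%:Z%:~R by [].
rewrite -!intrM ler_int ltr_int mulrBl mul1r [ceil_int * _]mulrC ceil_intE.
by apply/andP; lia.
Qed.

(** Let C be the ceiling, a, b the residues of -X, -Y and w that of 1 - 3m. Then n (m - C - q) = a +
    b + c + 1 - w lies strictly between -n and 3n, so m - C - q is 0, 1 or 2. If N + 1 >= n, then m
    - C >= 1, so q >= -1 and alpha is 1 - (m - C - q). Otherwise m - C = 0 and alpha itself is the
    dimension. *)
Lemma alpha_q X Y (c q : int) : 0 <= c < n%:Z ->
    m%:Z * (n%:Z - 3) = residue n (- X) + residue n (- Y) + c + n%:Z * q ->
  m%:Z - ceil_int + alpha n m X Y = if 0 <= q then q + 1 else 0.
Proof.
move=> /andP[c0 cn]; have /andP[a0 an] := residue_bound (- X).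
have /andP[b0 bn] := residue_bound (- Y).
have /andP[w0 wn] := residue_bound (1 - 3 * m%:Z).
have := ceil_intE; rewrite /alpha.
move: (residue n (- X)) (residue n (- Y)) (residue n (1 - 3 * m%:Z)) ceil_int a0 an b0 bn w0 wn.
move=> a b w C a0 an b0 bn w0 wn CE NE.
have n3 : (3 : int) < n%:Z by rewrite ltz_nat.
have m1 : (1 : int) <= m%:Z by rewrite lez_nat.
move: (n%:Z) (m%:Z) n3 m1 an bn wn cn CE NE => n' m' n3 m1 an bn wn cn CE NE.
have lt_n k j : n' * k < n' * j -> k < j by rewrite ltr_pM2l //; lia.
have E : n' * (m' - C - q) = a + b + c + 1 - w by lia.
have : -1 < m' - C - q by apply: lt_n; lia.
have : m' - C - q < 3 by apply: lt_n; lia.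
case: ifP => [N1|N1].
  have : 0 < m' - C by apply: lt_n; lia.
  case: ifP => [/andP[wa nab]|nab] M0 k3 k1.
    have : 1 < m' - C - q by apply: lt_n; lia.
    by case: ifP; lia.
  case: ifP => [/andP[aw ab]|ab].
    have : m' - C - q < 1 by apply: lt_n; lia.
    by case: ifP; lia.
  have : 0 < m' - C - q by apply: lt_n; lia.
  have : m' - C - q < 2 by apply: lt_n; lia.
  by case: ifP; lia.
move=> k3 k1.
have : m' - C < 1 by apply: lt_n; lia.
have : -1 < m' - C by apply: lt_n; nia.
case: ifP => ab M1 M0.
  have : -1 < q by apply: lt_n; lia.
  have : q < 1 by apply: lt_n; lia.
  by case: ifP; lia.
have : q < 0 by apply: lt_n; lia.
by case: ifP; lia.
Qed.

(** Write i = a + n l, with a the residue of -X. The bounds say N - n < 2i <= N, that is c + nq - n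
    < 2nl <= c + nq; since 0 <= c < n, this means 2l = q. So the set has one element if q is even
    and nonnegative, and none otherwise. *)
Lemma Jterm_q X (c q : int) : 0 <= c < n%:Z ->
    m%:Z * (n%:Z - 3) = residue n (- X) + residue n (- X) + c + n%:Z * q ->
  Jterm n m X = (n ^ 2 * ((0 <= q)%R && (2 %| q)%Z))%N.
Proof.
move=> /andP[c0 cn] NE; have /andP[a0 an] := residue_bound (- X).
have n0 : (0 < n)%N by apply: leq_trans n_gt3.
have lt_n (k j : int) : n%:Z * k < n%:Z * j -> k < j by rewrite ltr_pM2l.
have NN : m%:Z * (n%:Z - 3) = (m * (n - 3))%N by rewrite PoszM -subzn // ltnW.
have res i : (i == - X %[mod n])%Z = (residue n i == residue n (- X)) by [].
rewrite /Jterm; congr (_ * _)%N; rewrite NN in NE *.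
move: (m * (n - 3))%N NE => M ME.
case: (boolP (_ && _)) => [/andP[q0 /dvdzP[l qE]]|nq] /=; last first.
  apply: eq_card0 => i; rewrite !inE; apply/negP => /and3P[i1 i2].
  rewrite res => /eqP ri; move/negP: nq; apply.
  have iE : i%:Z = (i%:Z %/ n)%Z * n%:Z + residue n (- X) by rewrite -ri -divz_eq.
  move: (i%:Z %/ n)%Z iE => l iE.
  have l0 : -1 < l by apply: lt_n; lia.
  have ql : q = 2 * l.
    have : -1 < q - 2 * l by apply: lt_n; lia.
    have : q - 2 * l < 1 by apply: lt_n; lia.
    lia.
  by rewrite ql dvdz_mulr // andbT; lia.
have l0 : 0 <= l by lia.
have i0 : 0 <= residue n (- X) + n%:Z * l by rewrite addr_ge0 // mulr_ge0.
pose i := `|(residue n (- X) + n%:Z * l)%R|%N.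
have iE : i%:Z = residue n (- X) + n%:Z * l by rewrite gez0_abs.
have iM : (i < M./2.+1)%N by lia.
rewrite (_ : [set _ | _] = [set Ordinal iM]) ?cards1 //.
apply/setP => j; rewrite !inE; apply/and3P/eqP => [[j1 j2]|->].
  rewrite res => /eqP rj.
  have jE : j%:Z = (j%:Z %/ n)%Z * n%:Z + residue n (- X) by rewrite -rj -divz_eq.
  apply: val_inj => /=; move: (j%:Z %/ n)%Z jE => l' jE.
  have ll : l = l'.
    have : -1 < l - l' by apply: lt_n; lia.
    have : l - l' < 1 by apply: lt_n; lia.
    lia.
  by apply/eqP; rewrite -eqz_nat iE jE ll; lia.
split; rewrite /= ?res; try lia.
rewrite iE /residue mulrC addrC modzMDl modz_mod //.
Qed.

End Arithmetic.

(** * Multiplicities *)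

Section Multiplicities.

Variables (K : closedFieldType) (L : fieldType) (n : nat).
Variables (iota : {rmorphism K -> L}) (x y : L).
Variables (zeta : K) (D : L -> L).
Variables (gT : finGroupType) (act : gT -> {rmorphism L -> L}).
Variables (sigma : 'I_n -> 'I_n -> gT) (s t : gT).
Hypothesis n_gt3 : (3 < n)%N.
Hypothesis n_neq0 : n%:R != 0 :> K.
Hypothesis Hzeta : n.-primitive_root zeta.
Hypothesis HL : fermat_function_field n iota x y.
Hypothesis HD : is_ddx iota x D.
Hypothesis HG : fermat_group zeta iota x y act sigma s t.
Variable m : nat.

Local Notation sigz := (sigz sigma n_gt3).
Local Notation wt i j := (s ^+ i * t ^+ j)%g.
Local Notation N := (m * (n - 3))%N.
Local Notation holo := (holo_diff iota x y D n m).
Local Notation T g := (act_diff x D m (act g)).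
Let Tlin := act_diff_klinear D HG m.

Lemma poly_closed (q : {poly K}) : size q != 1%N -> exists a, root q a.
Proof. by move/closed_rootP. Qed.

Hypothesis two_neq0 : 2%:R != 0 :> K.
Hypothesis three_neq0 : 3%:R != 0 :> K.

Lemma card_fermat_group : #|gT| = (n * n * 6)%N.
Proof.
have := bij_eq_card (of_normal_bij n_gt3 Hzeta HL HG).
by rewrite !card_prod !card_ord => <-; rewrite -mulnA.
Qed.

Lemma six_neq0 : 6%:R != 0 :> K.
Proof. by rewrite (natrM _ 2 3) mulf_neq0. Qed.

Section Rank.

Variables (kappa lam : int) (c : nat -> nat -> K) (th : irr_index).
Local Notation ps := (psi zeta sigma s t n_gt3 kappa lam c).
Local Notation wgt := (weight zeta kappa lam).

Hypothesis c00 : c 0 0 = 1.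
Hypothesis c_mull : forall i j i' j', (i < 3)%N -> (j < 2)%N -> (i' < 3)%N ->
  (j' < 2)%N -> c i j != 0 ->
  c (wmul i j i' j').1 (wmul i j i' j').2 = c i j * c i' j'.
Hypothesis c_mulr : forall i j i' j', (i < 3)%N -> (j < 2)%N -> (i' < 3)%N ->
  (j' < 2)%N -> c i' j' != 0 ->
  c (wmul i j i' j').1 (wmul i j i' j').2 = c i j * c i' j'.
Hypothesis c_inv : forall i j u, (i < 3)%N -> (j < 2)%N -> c i j != 0 ->
  wgt (wact i j u) = wgt u.
Hypothesis c_irr : forall i j, (i < 3)%N -> (j < 2)%N -> c i j = 0 ->
  (exists u, wgt (wact i j u) != wgt u) \/
  (exists p q, [/\ (p < 3)%N, (q < 2)%N, c p q != 0,
     c (wconj i j p q).1 (wconj i j p q).2 != 0 &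
     c (wconj i j p q).1 (wconj i j p q).2 != c p q]).
Hypothesis index_neq0 : (psi_index c)%:R != 0 :> K.
Hypothesis theta_induced : forall a b (i : 'I_3) (j : 'I_2),
  \sum_(i' < 3) \sum_(j' < 2) wgt (wact i' j' (a, b))
      * c (wconj i' j' i j).1 (wconj i' j' i j).2
  = (psi_index c)%:R * theta_char n zeta th a b i j.

Let psi_ok : partial_character ps.
Proof.
exact: (fermat_partial_character n_gt3 Hzeta HL HG c00 c_mull c_mulr c_inv c_irr).
Qed.

Let order_neq0 : (psi_order ps)%:R != 0 :> K.
Proof. by rewrite (fermat_psi_order n_gt3 Hzeta HL HG) !natrM !mulf_neq0. Qed.

(** By [theta_induced] the trace test defining [theta_mult] is the test for the character induced
    from [psi]. Maschke's theorem applies because 6 n^2 is invertible in K. *)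
Lemma theta_mult_rank d (rV : mx_representation K [set: gT]%G d) :
  theta_mult zeta sigma s t rV th = \rank (psi_mx ps rV).
Proof.
have HG0 : #|gT|%:R != 0 :> K.
  by rewrite card_fermat_group !natrM !mulf_neq0 // six_neq0.
rewrite -(sum_socle_mult_psi psi_ok order_neq0 HG0 (DecSocleType rV)).
apply: eq_bigl => W.
have psiS (a b : 'I_n) (i : 'I_3) (j : 'I_2) :
    \sum_k ps (k * (sigz a b * wt i j) * k^-1)%g
    = (psi_order ps)%:R * theta_char n zeta th a b i j.
  rewrite (psi_conj_sum n_gt3 Hzeta HL HG c00 c_mull c_mulr c_inv) //.
  by rewrite theta_induced (fermat_psi_order n_gt3 Hzeta HL HG) [in RHS]natrM mulrA.
apply/forallP/forallP => H.
  move=> g; have [a [b [i [j ->]]]] := elements_normal n_gt3 Hzeta HL HG g.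
  have /forallP/(_ b)/forallP/(_ i)/forallP/(_ j)/eqP := H a.
  rewrite (sigma_sigz n_gt3 Hzeta HL HG) => ->.
  by rewrite -[in X in _ == X]mulgA psiS.
move=> a; apply/forallP => b; apply/forallP => i; apply/forallP => j.
have := H (sigz a b * wt i j)%g; rewrite psiS => /eqP/(mulfI order_neq0) <-.
by rewrite (sigma_sigz n_gt3 Hzeta HL HG) mulgA.
Qed.

Lemma theta_mult_card d (rV : mx_representation K [set: gT]%G d) (e : 'I_d -> L)
    (I : finType) (P : pred I) (bb : I -> L) (V : L -> Prop) :
    affords_holo_diff iota x y D act n m e rV ->
    basis_on iota P bb V ->
    (forall f, V f <-> holo f /\
      [/\ T (sigz 1 0) f = iota (zeta ^ kappa) * f,
          T (sigz 0 1) f = iota (zeta ^ lam) * f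
        & forall i j, (i < 3)%N -> (j < 2)%N -> c i j != 0 ->
            T (wt i j) f = iota (c i j) * f]) ->
  theta_mult zeta sigma s t rV th = #|P|.
Proof.
move=> [He Te] HB HV; rewrite theta_mult_rank.
apply: (psi_mx_rank_eigen psi_ok order_neq0 He Tlin Te (b := bb)).
apply: basis_on_eq HB => f; rewrite HV.
by split=> -[h1 /(psi_eigenP n_gt3 n_neq0 Hzeta HL HD HG m kappa lam c00) h2].
Qed.

End Rank.

End Multiplicities.

(** * Representations of dimension 6 and 3 as eigenspaces *)

Section Types.

Variables (K : closedFieldType) (L : fieldType) (n : nat).
Variables (iota : {rmorphism K -> L}) (x y : L).
Variables (zeta : K) (D : L -> L).
Variables (gT : finGroupType) (act : gT -> {rmorphism L -> L}).
Variables (sigma : 'I_n -> 'I_n -> gT) (s t : gT).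
Hypothesis n_gt3 : (3 < n)%N.
Hypothesis n_neq0 : n%:R != 0 :> K.
Hypothesis Hzeta : n.-primitive_root zeta.
Hypothesis HL : fermat_function_field n iota x y.
Hypothesis HD : is_ddx iota x D.
Hypothesis HG : fermat_group zeta iota x y act sigma s t.
Variable m : nat.

Local Notation wt i j := (s ^+ i * t ^+ j)%g.
Local Notation N := (m * (n - 3))%N.
Local Notation T g := (act_diff x D m (act g)).

Hypothesis two_neq0 : 2%:R != 0 :> K.
Hypothesis three_neq0 : 3%:R != 0 :> K.
Let K_closed := @poly_closed K.
Variables (d : nat) (e : 'I_d -> L) (rV : mx_representation K [set: gT]%G d).
Hypothesis HrV : affords_holo_diff iota x y D act n m e rV.

Let T1 f : T (wt 0 0) f = f.
Proof. by rewrite !expg0 mulg1 (act_diff1 HD HG). Qed.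

Lemma weight_neq kappa lam u v :
  (kappa * u.1 + lam * u.2 != kappa * v.1 + lam * v.2 %[mod n])%Z ->
  weight zeta kappa lam u != weight zeta kappa lam v.
Proof. by apply: contra_neq => /(zeta_eq n_gt3 Hzeta). Qed.

Lemma weight_eq kappa lam u v :
  (n%:Z %| kappa * u.1 + lam * u.2 - (kappa * v.1 + lam * v.2))%Z ->
  weight zeta kappa lam u = weight zeta kappa lam v.
Proof.
by rewrite -eqz_mod_dvd => /eqP H; apply: (zeta_mod n_gt3 Hzeta).
Qed.

Lemma mod_eq_sub (k l k' l' : int) :
  k - l = k' - l' -> (k == l %[mod n])%Z = (k' == l' %[mod n])%Z.
Proof. by rewrite !eqz_mod_dvd => ->. Qed.

Lemma mod_eq_subN (k l k' l' : int) :
  k - l = l' - k' -> (k == l %[mod n])%Z = (k' == l' %[mod n])%Z.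
Proof. by rewrite !eqz_mod_dvd => ->; rewrite -opprB rpredN. Qed.

Lemma six_sum (F : nat -> nat -> K) : \sum_(i < 3) \sum_(j < 2) F i j
  = F 0 0 + F 0 1 + (F 1 0 + F 1 1) + (F 2 0 + F 2 1).
Proof. by rewrite !big_ord_recr !big_ord0 /= !add0r. Qed.

Lemma weight_wact kappa lam u v (W := fun i j => weight zeta kappa lam (wact i j (u, v))) :
  (W 0 0 = zeta ^ (kappa * u + lam * v)) *
  (W 0 1 = zeta ^ ((- kappa - lam) * u + lam * v)) *
  (W 1 0 = zeta ^ (lam * u + (- kappa - lam) * v)) *
  (W 1 1 = zeta ^ (kappa * u + (- kappa - lam) * v)) *
  (W 2 0 = zeta ^ ((- kappa - lam) * u + kappa * v)) *
  (W 2 1 = zeta ^ (lam * u + kappa * v)).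
Proof. by rewrite /W /weight /=; do !split; congr (_ ^ _); ring. Qed.

Definition char_free (i j : nat) : K := ((i == 0%N) && (j == 0%N))%:R.

(** Validity makes the stabilizer of the weight in S_3 trivial: each nontrivial element changes the
    weight at (1, 0) or (0, 1), so Mackey's criterion is witnessed inside A. *)
Lemma mult_free kappa lam (a b : nat) :
    theta_valid n (IrrC kappa lam) -> (a < n)%N -> (b < n)%N ->
    (a%:Z + m%:Z = kappa %[mod n])%Z -> (b%:Z + m%:Z = lam %[mod n])%Z ->
  theta_mult zeta sigma s t rV (IrrC kappa lam) = #|@weight_ok n m a b|.
Proof.
move=> [kl lk kl2] an bn aE bE.
have idx : psi_index char_free = 1%N.
  by rewrite /psi_index /char_free !big_ord_recr !big_ord0 /= oner_eq0 eqxx.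
have B := weight_basis n_gt3 n_neq0 K_closed Hzeta HL HD HG an bn aE bE.
apply: (theta_mult_card n_neq0 Hzeta HL HD HG two_neq0 three_neq0
  (kappa := kappa) (lam := lam) (c := char_free) _ _ _ _ _ _ _ HrV B) => //.
- move=> i j i' j' i3 j2 i'3 j'2; rewrite /char_free.
  case: i i3 => [|i] i3 /=; last by rewrite eqxx.
  case: j j2 => [|j] j2 /=; last by rewrite eqxx.
  by move=> _; rewrite mul1r !add0n !modn_small.
- move=> i j i' j' i3 j2 i'3 j'2; rewrite /char_free.
  case: i' i'3 => [|i'] i'3 /=; last by rewrite eqxx.
  case: j' j'2 => [|j'] j'2 /=; last by rewrite eqxx.
  by move=> _; rewrite mulr1 muln0 if_same !addn0 !modn_small.
- move=> [|i] [|j] [u v] _ _ //=; by rewrite ?eqxx.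
- move=> i j i3 j2 cij; left; move: cij; rewrite /char_free.
  have sw k l : (k != l %[mod n])%Z -> (l != k %[mod n])%Z by rewrite eq_sym.
  case: i i3 => [|[|[|i]]] //= _; case: j j2 => [|[|j]] //= _ c0.
  + by move/eqP: c0; rewrite oner_eq0.
  + by exists (1, 0); apply: weight_neq; rewrite /= (mod_eq_subN (k' := lam) (l' := - (2 * kappa))) //; ring.
  + by exists (1, 0); apply: weight_neq; rewrite /= (mod_eq_subN (k' := kappa) (l' := lam)) //; ring.
  + by exists (0, 1); apply: weight_neq; rewrite /= (mod_eq_subN (k' := kappa) (l' := - (2 * lam))) //; ring.
  + by exists (0, 1); apply: weight_neq; rewrite /= (mod_eq_sub (k' := kappa) (l' := lam)) //; ring.
  + by exists (1, 0); apply: weight_neq; rewrite /= (mod_eq_subN (k' := kappa) (l' := lam)) //; ring.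
- by rewrite idx oner_neq0.
- move=> u v i j; rewrite idx mul1r.
  rewrite (six_sum (fun i' j' => weight zeta kappa lam (wact i' j' (u, v)) *
      char_free (wconj i' j' i j).1 (wconj i' j' i j).2)).
  rewrite !weight_wact /char_free /wconj /=.
  by case: i => [[|[|[|i]]] //= i3]; case: j => [[|[|j]] //= j2];
    rewrite ?mulr1 ?mulr0 ?addr0 //; ring.
move=> f; split=> [[[h1 h2] h3]|[h1 [h2 h3 _]]]; last by split.
split=> //; split=> // -[|i] [|j] _ _; rewrite ?eqxx // => _.
by rewrite T1 /char_free /= (rmorph1 iota) mul1r.
Qed.

Definition sign (rho : S3_irr) : K := if rho is Sgn then -1 else 1.

Lemma sign_sqr rho : sign rho * sign rho = 1.
Proof. by case: rho; rewrite /= ?mulrNN mulr1. Qed.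

Lemma sign_neq0 rho : sign rho != 0.
Proof. by case: rho; rewrite /= ?oppr_eq0 oner_neq0. Qed.

Lemma S3_charE rho (i : 'I_3) (j : 'I_2) : rho <> Stan ->
  S3_char K rho i j = sign rho ^+ j.
Proof. by case: rho => //= _; rewrite expr1n. Qed.

Definition char_swap rho (i j : nat) : K :=
  if (i == 0%N) && (j == 0%N) then 1
  else if (i == 2%N) && (j == 1%N) then sign rho else 0.

(** The stabilizer of (kappa, kappa) is generated by s^2 t = t s; the other four elements change the
    weight by multiples of 3 kappa. *)
Lemma mult_swap kappa rho (I : finType) (P : pred I) (bb : I -> L) :
    theta_valid n (IrrB kappa rho) ->
    basis_on iota P bb (fun f =>
      weight_space iota x y zeta D act sigma n_gt3 m kappa kappa f /\
      T (wt 2 1) f = iota (sign rho) * f) ->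
  theta_mult zeta sigma s t rV (IrrB kappa rho) = #|P|.
Proof.
move=> [nStan k0 k3] B.
(* If 3 is prime to n, then 3 kappa = 0 forces kappa = 0; if 3 divides n, it forces kappa to be 0,
   n/3 or 2n/3. All are excluded by validity. *)
have k3n : (kappa * 3 != 0 %[mod n])%Z.
  rewrite eqz_mod_dvd subr0; apply/negP => dv.
  have [d3|nd3] := boolP (3 %| n)%N; last first.
    move/negP: k0; apply; rewrite eqz_mod_dvd subr0.
    by rewrite Gauss_dvdzl // in dv; rewrite coprimezE coprime_sym prime_coprime.
  have [k1 k2] := k3 d3; have /dvdnP[h nE] := d3.
  have h1 : (n %/ 3 = h)%N by lia.
  have h2 : (2 * n %/ 3 = 2 * h)%N by lia.
  move: dv; rewrite nE PoszM => /dvdzP[j]; rewrite mulrA => /(mulIf (isT : (3 : int) != 0)) kE.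
  have nh : n%:Z = h%:Z * 3 by rewrite nE PoszM.
  have jE := divz_eq j 3; move: (j %/ 3)%Z jE => jq jE.
  have : 0 <= (j %% 3)%Z < 3 by rewrite modz_ge0 //= ltz_pmod.
  have kE' r : (j %% 3)%Z = r -> (kappa == r * h%:Z %[mod n])%Z.
    move=> jr; rewrite eqz_mod_dvd; apply/dvdzP; exists jq.
    by rewrite kE jE jr nh; ring.
  case: (j %% 3)%Z kE' => [[|[|[|r]]]|r] // /(_ _ erefl) kr _.
  - by move/negP: k0; apply; move: kr; rewrite mul0r.
  - by move/negP: k1; apply; rewrite h1 -[h%:Z]mul1r.
  - by move/negP: k2; apply; rewrite h2 PoszM.
have idx : psi_index (char_swap rho) = 2%N.
  by rewrite /psi_index /char_swap !big_ord_recr !big_ord0 /= oner_eq0 sign_neq0 eqxx.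
apply: (theta_mult_card n_neq0 Hzeta HL HD HG two_neq0 three_neq0
  (kappa := kappa) (lam := kappa) (c := char_swap rho) _ _ _ _ _ _ _ HrV B) => //.
- move=> i j i' j' i3 j2 i'3 j'2; rewrite /char_swap /wmul.
  case: i i3 => [|[|[|i]]] //= _; case: j j2 => [|[|j]] //= _; rewrite ?eqxx //;
    case: i' i'3 => [|[|[|i']]] //= _; case: j' j'2 => [|[|j']] //= _ _;
    by rewrite ?mul1r ?mulr1 ?mulr0 ?sign_sqr.
- move=> i j i' j' i3 j2 i'3 j'2; rewrite /char_swap /wmul.
  case: i' i'3 => [|[|[|i']]] //= _; case: j' j'2 => [|[|j']] //= _; rewrite ?eqxx //;
    case: i i3 => [|[|[|i]]] //= _; case: j j2 => [|[|j]] //= _ _;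
    by rewrite ?mul1r ?mulr1 ?mul0r ?sign_sqr.
- move=> i j [u v] i3 j2; rewrite /char_swap.
  case: i i3 => [|[|[|i]]] //= _; case: j j2 => [|[|j]] //= _; rewrite ?eqxx // => _.
  by rewrite /weight /=; congr (_ ^ _); ring.
- move=> i j i3 j2 cij; left; move: cij; rewrite /char_swap.
  case: i i3 => [|[|[|i]]] //= _; case: j j2 => [|[|j]] //= _ c0;
    try by move/eqP: c0; rewrite ?oner_eq0 ?(negPf (sign_neq0 _)).
  + by exists (1, 0); apply: weight_neq; rewrite /= (mod_eq_subN (k' := kappa * 3) (l' := 0)) //; ring.
  + by exists (0, 1); apply: weight_neq; rewrite /= (mod_eq_subN (k' := kappa * 3) (l' := 0)) //; ring.
  + by exists (0, 1); apply: weight_neq; rewrite /= (mod_eq_subN (k' := kappa * 3) (l' := 0)) //; ring.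
  + by exists (1, 0); apply: weight_neq; rewrite /= (mod_eq_subN (k' := kappa * 3) (l' := 0)) //; ring.
- by rewrite idx.
- move=> u v i j; rewrite idx.
  rewrite (six_sum (fun i' j' => weight zeta kappa kappa (wact i' j' (u, v)) *
      char_swap rho (wconj i' j' i j).1 (wconj i' j' i j).2)).
  rewrite !weight_wact /char_swap /wconj /= S3_charE //.
  have -> : kappa * (u + v) = kappa * u + kappa * v by ring.
  have -> : kappa * (u - 2 * v) = kappa * u + (- kappa - kappa) * v by ring.
  have -> : kappa * (v - 2 * u) = (- kappa - kappa) * u + kappa * v by ring.
  by case: i => [[|[|[|i]]] //= i3]; case: j => [[|[|j]] //= j2];
    rewrite ?mulr1 ?mulr0 ?addr0 ?add0r //; ring.
move=> f; split=> [[[[h1 h2] h3] h4]|[h1 [h2 h3 h4]]]; last first.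
  split; first by split.
  exact: (h4 2 1 isT isT (sign_neq0 rho)).
split=> //; split=> // i j; rewrite /char_swap.
case: i => [|[|[|i]]] //= _; case: j => [|[|j]] //= _; rewrite ?eqxx // => _.
by rewrite T1 rmorph1 mul1r.
Qed.

End Types.

(** * Representations of dimension 1 and 2 as eigenspaces *)

Section Types.

Variables (K : closedFieldType) (L : fieldType) (n : nat).
Variables (iota : {rmorphism K -> L}) (x y : L).
Variables (zeta : K) (D : L -> L).
Variables (gT : finGroupType) (act : gT -> {rmorphism L -> L}).
Variables (sigma : 'I_n -> 'I_n -> gT) (s t : gT).
Hypothesis n_gt3 : (3 < n)%N.
Hypothesis n_neq0 : n%:R != 0 :> K.
Hypothesis Hzeta : n.-primitive_root zeta.
Hypothesis HL : fermat_function_field n iota x y.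
Hypothesis HD : is_ddx iota x D.
Hypothesis HG : fermat_group zeta iota x y act sigma s t.
Variable m : nat.
Local Notation wt i j := (s ^+ i * t ^+ j)%g.
Local Notation N := (m * (n - 3))%N.
Local Notation T g := (act_diff x D m (act g)).
Let TM := act_diffM n_gt3 n_neq0 HL HD HG m.
Let Tlin := act_diff_klinear D HG m.
Let TZ g c f : T g (iota c * f) = iota c * T g f.
Proof. by have [_ H] := Tlin g. Qed.
Hypothesis two_neq0 : 2%:R != 0 :> K.
Hypothesis three_neq0 : 3%:R != 0 :> K.
Variables (d : nat) (e : 'I_d -> L) (rV : mx_representation K [set: gT]%G d).
Hypothesis HrV : affords_holo_diff iota x y D act n m e rV.

Local Notation WS := (weight_space iota x y zeta D act sigma n_gt3 m).

Section TypeA.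

Variable nu : nat.
Let kappa : int := (nu * n %/ 3)%N%:Z.

Lemma kappa_mul3 rho : theta_valid n (IrrA nu rho) -> kappa * 3 = nu%:Z * n%:Z.
Proof.
move=> [_ d3]; rewrite /kappa -!PoszM divnK //.
have [->|nu0] := eqVneq nu 0%N; first exact: dvdn0.
by rewrite dvdn_mull // d3 //; apply/eqP.
Qed.

(** The values at (u, v) and at its image under S_3 have exponents differing by a multiple of 3
    kappa, hence of n. *)
Lemma weight_wactA rho i j u v :
  theta_valid n (IrrA nu rho) -> (i < 3)%N -> (j < 2)%N ->
  weight zeta kappa kappa (wact i j (u, v)) = zeta ^ (kappa * (u + v)).
Proof.
move=> /kappa_mul3 k3; rewrite mulrDr -[RHS]/(weight zeta kappa kappa (u, v)).
have cong k k' (z : int) : kappa * k.1 + kappa * k.2 - (kappa * k'.1 + kappa * k'.2)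
    = kappa * 3 * z -> weight zeta kappa kappa k = weight zeta kappa kappa k'.
  move=> E; apply: (weight_eq n_gt3 Hzeta); rewrite E k3.
  by rewrite -mulrA dvdz_mull // dvdz_mulr.
case: i => [|[|[|i]]] // _; case: j => [|[|j]] // _.
- by apply: (cong _ _ (- u)) => /=; ring.
- by apply: (cong _ _ (- v)) => /=; ring.
- by apply: (cong _ _ (- v)) => /=; ring.
- by apply: (cong _ _ (- u)) => /=; ring.
- by apply: (cong _ _ 0) => /=; ring.
Qed.

Definition char_full rho (i j : nat) : K := sign K rho ^+ j.

(** Here [psi] is a linear character of the whole group. Besides the weight, an eigenvector is
    tested only on [s] and s^2 t, which generate S_3. *)
Lemma mult_full rho (I : finType) (P : pred I) (bb : I -> L) :
    rho <> Stan -> theta_valid n (IrrA nu rho) ->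
    basis_on iota P bb (fun f =>
      (WS kappa kappa f /\ T s f = iota 1 * f) /\
      T (wt 2 1) f = iota (sign K rho) * f) ->
  theta_mult zeta sigma s t rV (IrrA nu rho) = #|P|.
Proof.
move=> nStan Hv B.
have nz i j : char_full rho i j != 0 by rewrite expf_neq0 ?sign_neq0.
have idx : psi_index (char_full rho) = 6%N.
  by rewrite /psi_index !big_ord_recr !big_ord0 /= !nz.
have sgn_mod j : sign K rho ^+ (j %% 2) = sign K rho ^+ j.
  by rewrite [in RHS](divn_eq j 2) exprD mulnC exprM expr2 sign_sqr expr1n mul1r.
have mulE i j i' j' : char_full rho (wmul i j i' j').1 (wmul i j i' j').2
    = char_full rho i j * char_full rho i' j'.
  by rewrite /char_full /wmul /= sgn_mod exprD.
apply: (theta_mult_card n_neq0 Hzeta HL HD HG two_neq0 three_neq0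
  (kappa := kappa) (lam := kappa) (c := char_full rho) _ _ _ _ _ _ _ HrV B) => //.
- by move=> i j [u v] i3 j2 _; rewrite (weight_wactA _ _ Hv) // /weight /= mulrDr.
- by move=> i j _ _ /eqP; rewrite (negPf (nz i j)).
- by rewrite idx six_neq0.
- move=> u v i j; rewrite idx /= S3_charE //.
  rewrite (eq_bigr (fun=> (zeta ^ (kappa * (u + v)) * sign K rho ^+ j) *+ 2)).
    by rewrite sumr_const card_ord -mulrnA mulr_natl.
  move=> i' _; rewrite (eq_bigr (fun=> zeta ^ (kappa * (u + v)) * sign K rho ^+ j)).
    by rewrite sumr_const card_ord.
  by move=> j' _; rewrite (weight_wactA _ _ Hv) ?ltn_ord // sgn_mod.
move=> f; split=> [[[[[h1 h2] h3] h4] h5]|[h1 [h2 h3 h4]]]; last first.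
  split; last exact: (h4 2 1 isT isT (nz 2 1)).
  split; first by split.
  by have := h4 1 0 isT isT (nz 1 0); rewrite expg1 expg0 mulg1.
split=> //; split=> // i j i3 j2 _.
have Ts k : T (s ^+ k)%g f = f.
  elim: k => [|k IH]; first by rewrite expg0 (act_diff1 HD HG).
  by rewrite expgS TM IH h4 rmorph1 mul1r.
case: j j2 => [|[|j]] // _; first by rewrite mulg1 Ts rmorph1 mul1r.
(* Because s^3 = 1, t = s (s^2 t). *)
have -> : (wt i 1 = s ^+ i.+1 * wt 2 1)%g.
  by rewrite mulgA -expgD addn2 -addn3 expgD (s3 n_gt3 HL HG) mulg1.
by rewrite TM h5 TZ Ts.
Qed.

Section Rotation.

Variable w : K.
Hypothesis Hw : w ^+ 2 + w + 1 = 0.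

Lemma w_neq0 : w != 0.
Proof.
apply/eqP => w0; move: Hw; rewrite w0 expr0n /= !add0r => /eqP.
by rewrite oner_eq0.
Qed.

Lemma w_sqr_neq : w ^+ 2 != w.
Proof.
apply: contraNneq three_neq0 => E.
have w1 : w = 1 by apply: (mulfI w_neq0); rewrite mulr1 -expr2.
by rewrite -Hw w1 expr1n; apply/eqP; ring.
Qed.

Lemma w_cube : w ^+ 3 = 1.
Proof.
apply/eqP; rewrite -subr_eq0 (_ : _ - 1 = (w - 1) * (w ^+ 2 + w + 1)); last by ring.
by rewrite Hw mulr0.
Qed.

Lemma w_mod i : w ^+ (i %% 3) = w ^+ i.
Proof. by rewrite [in RHS](divn_eq i 3) exprD mulnC exprM w_cube expr1n mul1r. Qed.

Definition char_rot (i j : nat) : K := if j == 0%N then w ^+ i else 0.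

(** The reflections fix the weight, so A cannot separate the conjugates; the rotation does, since a
    reflection conjugates [s] to s^2 and w^2 != w in characteristic other than 3. *)
Lemma mult_rot (I : finType) (P : pred I) (bb : I -> L) :
    theta_valid n (IrrA nu Stan) ->
    basis_on iota P bb (fun f => WS kappa kappa f /\ T s f = iota w * f) ->
  theta_mult zeta sigma s t rV (IrrA nu Stan) = #|P|.
Proof.
move=> Hv B; have nzw i : w ^+ i != 0 by rewrite expf_neq0 ?w_neq0.
have idx : psi_index char_rot = 3%N.
  by rewrite /psi_index /char_rot !big_ord_recr !big_ord0 /= !nzw eqxx.
have w4 : w ^+ 4 = w by rewrite -w_mod.
apply: (theta_mult_card n_neq0 Hzeta HL HD HG two_neq0 three_neq0
  (kappa := kappa) (lam := kappa) (c := char_rot) _ _ _ _ _ _ _ HrV B) => //.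
- move=> i j i' j' _ j2 _ j'2; rewrite /char_rot /wmul.
  case: j j2 => [|[|j]] //= _; last by rewrite eqxx.
  by case: j' j'2 => [|[|j']] //= _ _; rewrite ?mulr0 // w_mod exprD.
- move=> i j i' j' _ j2 _ j'2; rewrite /char_rot /wmul.
  case: j' j'2 => [|[|j']] //= _; last by rewrite eqxx.
  by case: j j2 => [|[|j]] //= _ _; rewrite ?mul0r // w_mod exprD.
- by move=> i j [u v] i3 j2 _; rewrite (weight_wactA _ _ Hv) // /weight /= mulrDr.
- move=> i j i3; case: j => [|[|j]] // _.
    by move/eqP; rewrite (negPf (nzw i)).
  move=> _; right; exists 1%N, 0%N; rewrite /wconj /char_rot /= addn0 !nzw.
  by rewrite !modn_small // expr1 w_sqr_neq.
- by rewrite idx.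
- move=> u v i j; rewrite idx /=.
  rewrite (six_sum (fun i' j' => weight zeta kappa kappa (wact i' j' (u, v)) *
      char_rot (wconj i' j' i j).1 (wconj i' j' i j).2)).
  rewrite !(weight_wactA _ _ Hv) // /char_rot /wconj /=; move: (zeta ^ _) => z.
  have w2 : w ^+ 2 = - w - 1.
    by apply/eqP; rewrite -subr_eq0 -Hw; apply/eqP; ring.
  case: i => [[|[|[|i]]] //= i3]; case: j => [[|[|j]] //= j2];
    rewrite ?mulr0 ?addr0 // ?expr0 ?expr1 ?w2; ring.
move=> f; split=> [[[[h1 h2] h3] h4]|[h1 [h2 h3 h4]]]; last first.
  split; first by split.
  by have := h4 1 0 isT isT (nzw 1); rewrite expg1 expg0 mulg1.
split=> //; split=> // i j i3; rewrite /char_rot.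
case: j => [|[|j]] // _; rewrite ?eqxx // => _; rewrite expg0 mulg1 /=.
elim: i {i3} => [|i IH]; first by rewrite expg0 (act_diff1 HD HG) rmorph1 mul1r.
by rewrite expgSr TM h4 TZ IH exprSr rmorphM; ring.
Qed.

End Rotation.

End TypeA.

End Types.

Section Dimension.

Variables (n m a b c : nat) (q : int).
Local Notation N := (m * (n - 3))%N.
Hypotheses (a_lt : (a < n)%N) (b_lt : (b < n)%N) (c_lt : (c < n)%N).
Hypothesis NE : (N%:Z = a%:Z + b%:Z + c%:Z + n%:Z * q).

Lemma card_weight_q : #|@weight_ok n m a b|%:Z = if 0 <= q then q + 1 else 0.
Proof.
have n_gt0 := leq_ltn_trans (leq0n a) a_lt.
rewrite (card_weight_ok m a_lt b_lt); move: (N) NE => M.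
case: q => k ME.
  have -> : (M = a + b + c + n * k)%N by lia.
  rewrite -[(a + b + c + _)%N]addnA leq_addr addKn mulnC addnC divnMDl //.
  by rewrite divn_small // addn0 lez_nat leq0n -PoszD addn1.
have nk : (n <= n * k.+1)%N by rewrite leq_pmulr.
rewrite NegzE mulrN -PoszM in ME *.
by case: ifP => //; lia.
Qed.

Lemma weight_empty : q < 0 -> #|@weight_ok n m a b| = 0%N.
Proof. by move=> q0; have := card_weight_q; rewrite leNgt q0 => -[]. Qed.

End Dimension.

(** * Counting in dimension 3 *)

Section Types.

Variables (K : closedFieldType) (L : fieldType) (n : nat).
Variables (iota : {rmorphism K -> L}) (x y : L).
Variables (zeta : K) (D : L -> L).
Variables (gT : finGroupType) (act : gT -> {rmorphism L -> L}).
Variables (sigma : 'I_n -> 'I_n -> gT) (s t : gT).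
Hypothesis n_gt3 : (3 < n)%N.
Hypothesis n_neq0 : n%:R != 0 :> K.
Hypothesis Hzeta : n.-primitive_root zeta.
Hypothesis HL : fermat_function_field n iota x y.
Hypothesis HD : is_ddx iota x D.
Hypothesis HG : fermat_group zeta iota x y act sigma s t.
Variable m : nat.
Let n_gt0 : (0 < n)%N. Proof. by apply: leq_trans n_gt3. Qed.
Local Notation wt i j := (s ^+ i * t ^+ j)%g.
Local Notation N := (m * (n - 3))%N.
Local Notation omega := (y ^+ (m * n.-1))^-1.
Local Notation T g := (act_diff x D m (act g)).
Let Tlin := act_diff_klinear D HG m.
Hypothesis two_neq0 : 2%:R != 0 :> K.
Hypothesis three_neq0 : 3%:R != 0 :> K.
Let K_closed := @poly_closed K.
Variables (d : nat) (e : 'I_d -> L) (rV : mx_representation K [set: gT]%G d).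
Hypothesis HrV : affords_holo_diff iota x y D act n m e rV.

Local Notation dh := (dehomog iota x y).

Definition is_sgn rho : nat := if rho is Sgn then 1 else 0.

Lemma signE rho : sign K rho = (-1) ^+ is_sgn rho.
Proof. by case: rho; rewrite ?expr0 ?expr1. Qed.

Lemma sign_parity rho k l :
  ((-1) ^+ (k + l) == sign K rho) = (l %% 2 == (k + is_sgn rho) %% 2)%N.
Proof.
have m1 : (-1 == 1 :> K) = false.
  by rewrite -subr_eq0 -opprD oppr_eq0 (negPf two_neq0).
rewrite signE -signr_odd -[X in _ == X]signr_odd !modn2 !oddD.
case: (odd k); case: (odd l); case: rho => /=;
  by rewrite ?expr0 ?expr1 ?eqxx ?m1 // eq_sym m1.
Qed.

Section Diagonal.

Variables (kappa : int) (a c : nat) (q : int).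
Hypotheses (a_lt : (a < n)%N) (c_lt : (c < n)%N).
Hypothesis aE : (a%:Z + m%:Z = kappa %[mod n])%Z.
Hypothesis NE : (N%:Z = a%:Z + a%:Z + c%:Z + n%:Z * q).

(** Used for q < 0, where the weight space is zero and the explicit forms do not exist. *)
Lemma basis_on_empty (I : finType) (P : pred I) (bb : I -> L) V g mu :
    basis_on iota P bb V -> #|P| = 0%N ->
  basis_on iota P bb (fun f => V f /\ T g f = iota mu * f).
Proof.
move=> B P0; have nP i : P i = false by have := card0_eq P0 i.
have [|H1 _] := basis_on_eigen mu (T := T g) (mu := fun=> mu) B (Tlin g).
  by move=> i; rewrite nP.
split=> [f|co _ i]; last by rewrite nP.
by rewrite H1; split=> -[co ->]; exists co; apply: eq_bigl => i; rewrite nP.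
Qed.

Let WB := weight_basis n_gt3 n_neq0 K_closed Hzeta HL HD HG a_lt a_lt aE aE.

Lemma T_wt21_B (k l : nat) (E : (N = a + a + c + n * k)%N) :
  T (wt 2 1) (x ^+ a * y ^+ a * dh (formB K n k l) * omega)
  = iota ((-1) ^+ (m + l)) * (x ^+ a * y ^+ a * dh (formB K n k l) * omega).
Proof.
rewrite (T_wt21_mem n_gt3 n_neq0 Hzeta HL HD HG) dh_formB.
have [wx wy] := act_wt21 n_gt3 HL HG.
rewrite rmorphM !rmorphXn rmorphB rmorphD !rmorphXn /= wx wy.
rewrite -[y ^+ n - x ^+ n]opprB [y ^+ n + _]addrC [(- _) ^+ l]exprNn rmorphN1 [(-1) ^+ (m + l)]exprD.
move: (x ^+ n) (y ^+ n) => X Y; ring.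
Qed.

(** The form with index l has sign (-1)^(m+l). Among 0, ..., q the two parities occur equally often
    if q is odd; if q is even, the even l are one more. *)
Lemma mult_swap_q rho : theta_valid n (IrrB kappa rho) ->
  (theta_mult zeta sigma s t rV (IrrB kappa rho))%:Z * 2
  = if 0 <= q then q + 1 + (1 - 2 * ((m + is_sgn rho) %% 2)%N%:Z) * (2 %| q)%Z
    else 0.
Proof.
move=> Hv; have := NE; have := weight_empty a_lt a_lt c_lt NE; case: q => k W0 E.
  have {}E : (N = a + a + c + n * k)%N by lia.
  have B := basis_on_eigen (sign K rho) (basisB n_gt3 n_neq0 K_closed Hzeta HL HD
    HG a_lt aE c_lt E two_neq0) (Tlin (wt 2 1)) (fun l _ => T_wt21_B l E).
  rewrite (mult_swap n_neq0 Hzeta HL HD HG two_neq0 three_neq0 HrV Hv B).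
  rewrite (@eq_card _ _ [pred l : 'I_k.+1 | (l %% 2 == (m + is_sgn rho) %% 2)%N]); last first.
    by move=> l; rewrite !inE unfold_in /= sign_parity.
  have r2 : ((m + is_sgn rho) %% 2 < 2)%N by rewrite ltn_mod.
  rewrite card_mod2 //; move: (_ %% 2)%N r2 => r r2.
  rewrite lez_nat leq0n; move: (k) => j; case: (boolP (2 %| j%:Z)%Z) => dv; lia.
have B := basis_on_empty (wt 2 1) (sign K rho) WB (W0 isT).
by rewrite (mult_swap n_neq0 Hzeta HL HD HG two_neq0 three_neq0 HrV Hv B) W0.
Qed.

End Diagonal.

End Types.

(** * Counting in dimension 1 and 2 *)

Section Types.

Variables (K : closedFieldType) (L : fieldType) (n : nat).
Variables (iota : {rmorphism K -> L}) (x y : L).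
Variables (zeta : K) (D : L -> L).
Variables (gT : finGroupType) (act : gT -> {rmorphism L -> L}).
Variables (sigma : 'I_n -> 'I_n -> gT) (s t : gT).
Hypothesis n_gt3 : (3 < n)%N.
Hypothesis n_neq0 : n%:R != 0 :> K.
Hypothesis Hzeta : n.-primitive_root zeta.
Hypothesis HL : fermat_function_field n iota x y.
Hypothesis HD : is_ddx iota x D.
Hypothesis HG : fermat_group zeta iota x y act sigma s t.
Variable m : nat.
Local Notation wt i j := (s ^+ i * t ^+ j)%g.
Local Notation N := (m * (n - 3))%N.
Let Tlin := act_diff_klinear D HG m.
Hypothesis two_neq0 : 2%:R != 0 :> K.
Hypothesis three_neq0 : 3%:R != 0 :> K.
Let K_closed := @poly_closed K.
Variables (d : nat) (e : 'I_d -> L) (rV : mx_representation K [set: gT]%G d).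
Hypothesis HrV : affords_holo_diff iota x y D act n m e rV.

(* The trace of s on the forms of degree q in U and V: the sum of the
   w^(q+l), 0 <= l <= q. *)
Definition gam (q : int) : int :=
  if (q %% 3 == 0)%Z then 1 else if (q %% 3 == 1)%Z then -1 else 0.

Lemma root_of_unity3 : exists w : K, w ^+ 2 + w + 1 = 0.
Proof.
have [|w /rootP] := @K_closed ('X^2 + 'X + 1).
  rewrite -addrA size_polyDl size_polyXn // (leq_ltn_trans (size_polyD _ _)) //.
  by rewrite size_polyX size_poly1.
by rewrite !hornerD hornerXn hornerX hornerC; exists w.
Qed.

Section Count.

Variables (w : K) (Hw : w ^+ 2 + w + 1 = 0).

Lemma w_eq i j : (w ^+ i == w ^+ j) = (i %% 3 == j %% 3)%N.
Proof.
have w21 := w_sqr_neq three_neq0 Hw.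
have w1 : w != 1 by apply: contraNneq w21 => ->; rewrite expr1n.
have w2 : w ^+ 2 != 1.
  by apply: contraNneq w1 => E; rewrite -(w_cube Hw) exprS E mulr1.
rewrite -(w_mod Hw i) -(w_mod Hw j).
have : (i %% 3 < 3)%N by rewrite ltn_mod.
have : (j %% 3 < 3)%N by rewrite ltn_mod.
case: (j %% 3)%N => [|[|[|j']]] // _; case: (i %% 3)%N => [|[|[|i']]] // _;
  rewrite ?expr0 ?expr1 ?eqxx //.
- exact: negPf.
- exact: negPf.
- by rewrite eq_sym; exact: negPf.
- exact: negPf.
- by rewrite eq_sym; exact: negPf.
- by rewrite eq_sym; exact: negPf.
Qed.

Variables (nu a : nat) (q : int).
Local Notation kappa := ((nu * n %/ 3)%N%:Z).
Hypothesis a_lt : (a < n)%N.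
Hypothesis aE : (a%:Z + m%:Z = kappa %[mod n])%Z.
Hypothesis NE : (N%:Z = a%:Z + a%:Z + a%:Z + n%:Z * q).

Let WB := weight_basis n_gt3 n_neq0 K_closed Hzeta HL HD HG a_lt a_lt aE aE.
Let W0 := weight_empty a_lt a_lt a_lt NE.

(** The eigenvalue of [s] on U^l V^(q-l) is w^(q+l), so the l with q + l = 1 modulo 3 are counted,
    that is l = 1 + 2q modulo 3. *)
Lemma mult_rot_q : theta_valid n (IrrA nu Stan) ->
  (theta_mult zeta sigma s t rV (IrrA nu Stan))%:Z * 3
  = if 0 <= q then q + 1 - gam q else 0.
Proof.
move=> Hv; have := NE; have := W0; case: q => k W0' E.
  have {}E : (N = a + a + a + n * k)%N by lia.
  have B := basis_on_eigen w (basisA1 n_gt3 n_neq0 K_closed Hzeta HL HD HG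
    a_lt aE a_lt E two_neq0 Hw three_neq0) (Tlin s)
    (fun l _ => T_s_A1 n_gt3 n_neq0 Hzeta HL HD HG a_lt aE a_lt E two_neq0 Hw three_neq0 (erefl a) l).
  rewrite (mult_rot n_neq0 Hzeta HL HD HG two_neq0 three_neq0 HrV Hw Hv B).
  rewrite (@eq_card _ _ [pred l : 'I_k.+1 | (l %% 3 == (1 + 2 * k) %% 3)%N]); last first.
    by move=> l; rewrite !inE unfold_in /= -[w in _ == w]expr1 w_eq; apply/eqP/eqP; lia.
  have r3 : ((1 + 2 * k) %% 3 < 3)%N by rewrite ltn_mod.
  rewrite card_mod3 // lez_nat leq0n /gam.
  by case: eqP => k0; [|case: eqP => k1]; lia.
have B := basis_on_empty D HG m s w WB (W0' isT).
by rewrite (mult_rot n_neq0 Hzeta HL HD HG two_neq0 three_neq0 HrV Hw Hv B) W0'.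
Qed.

(** The three terms have the shape of a character average over S_3: one identity, two rotations and
    three reflections. They are obtained by counting a basis, which is valid in every admissible
    characteristic. *)
Lemma mult_full_q rho : rho <> Stan -> theta_valid n (IrrA nu rho) ->
  (theta_mult zeta sigma s t rV (IrrA nu rho))%:Z * 6
  = if 0 <= q then q + 1 + 2 * gam q
      + 3 * (1 - 2 * ((m + is_sgn rho) %% 2)%N%:Z) * (2 %| q)%Z
    else 0.
Proof.
move=> nStan Hv; have r2 : ((m + is_sgn rho) %% 2 < 2)%N by rewrite ltn_mod.
have M (I : finType) (P : pred I) bb B :=
  @mult_full _ _ _ _ _ _ _ _ _ _ _ _ _ n_gt3 n_neq0 Hzeta HL HD HG m two_neq0
    three_neq0 _ _ _ HrV nu rho I P bb nStan Hv B.
have := NE; have := W0; case: q => k W0' E; last first.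
  have B := basis_on_empty D HG m (wt 2 1) (sign K rho)
    (basis_on_empty D HG m s 1 WB (W0' isT)) (W0' isT).
  by rewrite (M _ _ _ B) W0'.
have {}E : (N = a + a + a + n * k)%N by lia.
have cardE : #|[pred l : 'I_k.+1 | w ^+ (k + l) == 1]|
    = ((k + 3 - (2 * k) %% 3) %/ 3)%N.
  have r3 : ((2 * k) %% 3 < 3)%N by rewrite ltn_mod.
  rewrite (@eq_card _ _ [pred l : 'I_k.+1 | (l %% 3 == (2 * k) %% 3)%N]).
    by rewrite card_mod3 //; congr (_ %/ 3)%N; lia.
  by move=> l; rewrite !inE -[1](expr0 w) w_eq; apply/eqP/eqP; lia.
(* For k = 1 neither U nor V is invariant under [s]; this is the only k for which k = 2 l0 + 3 j
   with l0 the residue of 2k modulo 3 fails. *)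
have [k1|k1] := eqVneq k 1%N.
  have B0 := basis_on_eigen 1 (basisA1 n_gt3 n_neq0 K_closed Hzeta HL HD HG
    a_lt aE a_lt E two_neq0 Hw three_neq0) (Tlin s)
    (fun l _ => T_s_A1 n_gt3 n_neq0 Hzeta HL HD HG a_lt aE a_lt E two_neq0 Hw three_neq0 (erefl a) l).
  have P0 : #|(fun l : 'I_k.+1 => true && (w ^+ (k + l) == 1))| = 0%N.
    by apply: etrans (etrans cardE _); [exact: eq_card|rewrite k1].
  have B := basis_on_empty D HG m (wt 2 1) (sign K rho) B0 P0.
  by rewrite (M _ _ _ B) P0 k1 /gam (_ : (2 %| 1)%Z = false) // mulr0.
have qE : (k = 2 * ((2 * k) %% 3) + 3 * ((k - 2 * ((2 * k) %% 3)) %/ 3))%N by lia.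
have card' : #|[pred l : 'I_k.+1 | w ^+ (k + l) == 1]|
    = ((k - 2 * ((2 * k) %% 3)) %/ 3).+1 by rewrite cardE; lia.
have B := basis_on_eigen (sign K rho)
  (basisA2 n_gt3 n_neq0 K_closed Hzeta HL HD HG a_lt aE a_lt E two_neq0 Hw
     three_neq0 (erefl a) qE card') (Tlin (wt 2 1))
  (fun i _ => T_wt21_A2 n_gt3 n_neq0 Hzeta HL HD HG m a w _ i).
rewrite (M _ _ _ B).
set j := (_ %/ 3)%N in qE card' B *.
rewrite (@eq_card _ _ [pred l : 'I_j.+1 | (l %% 2 == (m + is_sgn rho) %% 2)%N]); last first.
  by move=> l; rewrite !inE unfold_in /= sign_parity.
rewrite card_mod2 // lez_nat leq0n /gam; move: (_ %% 2)%N r2 => r r2.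
case: (boolP (2 %| k%:Z)%Z) => dv; case: eqP => k0; [|case: eqP => k2| |case: eqP => k2];
  by move: j qE {card' B} => j qE; lia.
Qed.

End Count.

End Types.

(** * Comparison with the closed formula *)

Section Types.

Variables (K : closedFieldType) (L : fieldType) (n : nat).
Variables (iota : {rmorphism K -> L}) (x y : L).
Variables (zeta : K) (D : L -> L).
Variables (gT : finGroupType) (act : gT -> {rmorphism L -> L}).
Variables (sigma : 'I_n -> 'I_n -> gT) (s t : gT).
Hypothesis n_gt3 : (3 < n)%N.
Hypothesis n_neq0 : n%:R != 0 :> K.
Hypothesis Hzeta : n.-primitive_root zeta.
Hypothesis HL : fermat_function_field n iota x y.
Hypothesis HD : is_ddx iota x D.
Hypothesis HG : fermat_group zeta iota x y act sigma s t.
Variable m : nat.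
Let n_gt0 : (0 < n)%N. Proof. by apply: leq_trans n_gt3. Qed.
Local Notation N := (m * (n - 3))%N.
Hypothesis two_neq0 : 2%:R != 0 :> K.
Hypothesis three_neq0 : 3%:R != 0 :> K.
Variables (d : nat) (e : 'I_d -> L) (rV : mx_representation K [set: gT]%G d).
Hypothesis HrV : affords_holo_diff iota x y D act n m e rV.

Hypothesis m_gt0 : (0 < m)%N.

Local Notation M := (m%:Z * (n%:Z - 3)).
Local Notation C := (ceil_int n m).

Let NM : M = N%:Z. Proof. by rewrite PoszM -subzn // ltnW. Qed.

Lemma residue_nat k : exists2 a : nat, (a < n)%N & residue n k = a%:Z.
Proof.
have /andP[] := residue_bound n_gt3 k.
by case: (residue n k) => // a _; rewrite ltz_nat => an; exists a.
Qed.

Lemma residue_mod k (a : nat) :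
  residue n (- (m%:Z - k)) = a%:Z -> (a%:Z + m%:Z = k %[mod n])%Z.
Proof. by move=> <-; rewrite modzDml opprB subrK. Qed.

(** Since m(n-3) = nm - k1 - k2 - k3, the integer q is m plus the floors of the -k_i / n. *)
Lemma residue_sum k1 k2 k3 : k1 + k2 + k3 = 3 * m%:Z ->
  exists q : int, M = residue n (- k1) + residue n (- k2) + residue n (- k3) + n%:Z * q.
Proof.
move=> kE; exists (m%:Z + ((- k1) %/ n)%Z + ((- k2) %/ n)%Z + ((- k3) %/ n)%Z).
have e1 := divz_eq (- k1) n; have e2 := divz_eq (- k2) n.
have e3 := divz_eq (- k3) n; rewrite /residue.
have -> : M = n%:Z * m%:Z + (- k1) + (- k2) + (- k3) by rewrite mulrBr (mulrC _ 3) -kE; ring.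
by rewrite {1}e1 {1}e2 {1}e3; ring.
Qed.

Definition dimq (q : int) : int := if 0 <= q then q + 1 else 0.

(** The right-hand side does not change when X, Y, Z are permuted, so all values of [alpha]
    occurring in one [Aterm] are equal. *)
Lemma alpha_rat X Y Z q :
    M = residue n (- X) + residue n (- Y) + residue n (- Z) + n%:Z * q ->
  (alpha n m X Y)%:~R = (dimq q)%:~R - (m%:R - C%:~R) :> rat.
Proof.
move=> E; have := alpha_q n_gt3 m_gt0 (residue_bound n_gt3 (- Z)) E.
by rewrite -/(dimq q) => <-; rewrite !rmorphD rmorphN /=; ring.
Qed.

Lemma sign_rat k : ((1 - 2 * (k %% 2)%N%:Z)%:~R : rat) = (-1) ^+ k.
Proof. by rewrite -signr_odd modn2; case: (odd k). Qed.

Lemma B_rat rho (k c q : int) : rho <> Stan -> 0 <= c < n%:Z ->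
    M = residue n (- (m%:Z - k)) + residue n (- (m%:Z - k)) + c + n%:Z * q ->
  Bterm n m (IrrB k rho)
  = (if 0 <= q then (1 - 2 * ((m + is_sgn rho) %% 2)%N%:Z) * (2 %| q)%Z else 0)%:~R.
Proof.
move=> nStan cn E; have n0 : n%:R != 0 :> rat by rewrite pnatr_eq0 -lt0n.
rewrite /Bterm (Jterm_q n_gt3 m_gt0 cn E) natrM natrX; case: ifP => _ /=; last first.
  by case: rho nStan => //= _; rewrite !mulr0.
rewrite rmorphM /= sign_rat; move: (2 %| q)%Z => bq; case: rho nStan => //= _; rewrite ?addn0 ?addn1;
  by rewrite mulrA divfK // expf_neq0.
Qed.

Lemma multiplicity_C kappa lam (th := IrrC kappa lam) : theta_valid n th ->
  (theta_mult zeta sigma s t rV th)%:R = (theta_dim th)%:R / 6%:R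
      * (m%:R - C%:~R + Aterm n m th)
    + 2%:R^-1 * Bterm n m th + 3%:R^-1 * Gterm n m th :> rat.
Proof.
move=> Hv; have [|q qE] := @residue_sum (m%:Z - kappa) (m%:Z - lam) (m%:Z + kappa + lam).
  by ring.
have [a an aE] := residue_nat (- (m%:Z - kappa)).
have [b bn bE] := residue_nat (- (m%:Z - lam)).
have [c cn cE] := residue_nat (- (m%:Z + kappa + lam)).
have -> : (theta_mult zeta sigma s t rV th)%:R = (dimq q)%:~R :> rat.
  rewrite (mult_free n_gt3 n_neq0 Hzeta HL HD HG two_neq0 three_neq0 HrV Hv an bn
    (residue_mod aE) (residue_mod bE)).
  have E : N%:Z = a%:Z + b%:Z + c%:Z + n%:Z * q by rewrite -NM qE aE bE cE.
  by rewrite /dimq -(card_weight_q an bn cn E).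
rewrite /th /= mulr0 mulr0 !addr0.
rewrite !(@alpha_rat _ _ _ q qE).
rewrite (@alpha_rat _ _ (m%:Z - kappa) q); last by rewrite qE; ring.
rewrite (@alpha_rat _ _ (m%:Z - lam) q); last by rewrite qE; ring.
rewrite (@alpha_rat _ _ (m%:Z - lam) q); last by rewrite qE; ring.
rewrite (@alpha_rat _ _ (m%:Z + kappa + lam) q); last by rewrite qE; ring.
rewrite (@alpha_rat _ _ (m%:Z - kappa) q); last by rewrite qE; ring.
by field.
Qed.

Lemma multiplicity_B kappa rho (th := IrrB kappa rho) : theta_valid n th ->
  (theta_mult zeta sigma s t rV th)%:R = (theta_dim th)%:R / 6%:R
      * (m%:R - C%:~R + Aterm n m th)
    + 2%:R^-1 * Bterm n m th + 3%:R^-1 * Gterm n m th :> rat.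
Proof.
move=> Hv; have [|q qE] := @residue_sum (m%:Z - kappa) (m%:Z - kappa) (m%:Z + 2 * kappa).
  by ring.
have [a an aE] := residue_nat (- (m%:Z - kappa)).
have [c cn cE] := residue_nat (- (m%:Z + 2 * kappa)).
have E : N%:Z = a%:Z + a%:Z + c%:Z + n%:Z * q by rewrite -NM qE aE cE.
have := mult_swap_q n_gt3 n_neq0 Hzeta HL HD HG two_neq0 three_neq0 HrV an cn
  (residue_mod aE) E Hv.
rewrite -/th => /(congr1 (fun z : int => z%:~R : rat)) mE; rewrite rmorphM /= in mE.
have nStan : rho <> Stan by have [] := Hv.
rewrite [Bterm n m th](B_rat nStan (residue_bound n_gt3 _) qE) /= mulr0 addr0.
rewrite (@alpha_rat _ _ _ q qE).
rewrite (@alpha_rat _ _ (m%:Z - kappa) q); last by rewrite qE; ring.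
rewrite (@alpha_rat _ _ (m%:Z - kappa) q); last by rewrite qE; ring.
move: mE; rewrite /dimq; case: ifP => _ mE /=.
  by apply: (mulIf (_ : 2%:R != 0)) => //; rewrite mE !rmorphD /=; field.
by apply: (mulIf (_ : 2%:R != 0)) => //; rewrite mE /=; field.
Qed.

(** Here q = m - nu modulo 3. From 0 <= m(n-3) = 3a + nq with a < n one gets q > -3, so q = 0 modulo
    3 implies q >= 0, while q = 1 modulo 3 leaves the negative value -2. The condition m(n-3) >= n
    excludes exactly this value. *)
Lemma G_rat nu (k := (nu * n %/ 3)%N%:Z) q :
    k * 3 = nu%:Z * n%:Z ->
    M = residue n (- (m%:Z - k)) + residue n (- (m%:Z - k))
      + residue n (- (m%:Z - k)) + n%:Z * q ->
  Gterm n m (IrrA nu Triv) = (if 0 <= q then gam q else 0)%:~R.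
Proof.
move=> k3 E; have [a an aE] := residue_nat (- (m%:Z - k)).
have [j jE] : exists j : int, q = m%:Z - nu%:Z - 3 * j.
  have /eqP := residue_mod aE; rewrite eqz_mod_dvd => /dvdzP[j jE].
  exists j; have n0 : n%:Z != 0 by rewrite eqz_nat -lt0n.
  apply: (mulfI n0); have -> : n%:Z * q = M - 3 * a%:Z by rewrite E aE; ring.
  have -> : a%:Z = k - m%:Z + j * n%:Z by rewrite -jE; ring.
  rewrite !mulrDr (mulrC 3 k) k3; ring.
have M0 : 0 <= M by rewrite NM.
have {}E : M = 3 * a%:Z + n%:Z * q by rewrite E aE; ring.
rewrite /Gterm; set b := (n%:Z <= _).
have -> : (3 %| m%:Z - nu%:Z)%Z = (q %% 3 == 0)%Z by apply/idP/eqP; lia.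
have -> : (3 %| m%:Z - nu%:Z + 2)%Z = (q %% 3 == 1)%Z by apply/idP/eqP; lia.
have q3 : (-3 < q) by nia.
rewrite /gam; case: eqP => [q0|q0]; first by have -> : 0 <= q by lia.
case: eqP => [q1|q1] /=; last by case: ifP.
have nq (u v : int) : u <= v -> n%:Z * u <= n%:Z * v by apply: ler_wpM2l.
case: (lerP 0 q) => q2.
  have q1' : 1 <= q by lia.
  by have -> : b by rewrite /b E; have := nq _ _ q1'; lia.
have q2' : q <= -2 by lia.
by have -> : b = false by apply/negbTE; rewrite -ltNge E; have := nq _ _ q2'; lia.
Qed.

Lemma multiplicity_A nu rho (th := IrrA nu rho) : theta_valid n th ->
  (theta_mult zeta sigma s t rV th)%:R = (theta_dim th)%:R / 6%:R
      * (m%:R - C%:~R + Aterm n m th)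
    + 2%:R^-1 * Bterm n m th + 3%:R^-1 * Gterm n m th :> rat.
Proof.
move=> Hv; have k3 := kappa_mul3 Hv; set k := (_ %/ 3)%N%:Z in k3.
have [q qE] : exists q : int, M = residue n (- (m%:Z - k)) + residue n (- (m%:Z - k))
      + residue n (- (m%:Z - k)) + n%:Z * q.
  have [|q qE] := @residue_sum (m%:Z - k) (m%:Z - k) (m%:Z + 2 * k).
    by ring.
  (* As n divides 3k, m + 2k and m - k have the same residue. *)
  exists q; rewrite {1}qE; congr (_ + _ + _); rewrite /residue.
  apply/eqP; rewrite eqz_mod_dvd (_ : _ - _ = - (k * 3)); last by ring.
  by rewrite rpredN k3 dvdz_mull.
have [a an aE] := residue_nat (- (m%:Z - k)).
have E : N%:Z = a%:Z + a%:Z + a%:Z + n%:Z * q by rewrite -NM qE aE.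
have AE : Aterm n m th = (dimq q)%:~R - (m%:R - C%:~R) by rewrite [LHS](alpha_rat qE).
have GE := G_rat k3 qE; have [w Hw] := @root_of_unity3 K.
have [S|nS] : rho = Stan \/ rho <> Stan by case: (rho); [right|right|left].
  have := Hv; rewrite /th S => Hv'.
  have := mult_rot_q n_gt3 n_neq0 Hzeta HL HD HG two_neq0 three_neq0 HrV Hw an
    (residue_mod aE) E Hv'.
  move=> /(congr1 (fun z : int => z%:~R : rat)) mE; rewrite rmorphM /= in mE.
  have -> : Gterm n m (IrrA nu Stan) = - Gterm n m (IrrA nu Triv) by [].
  have -> : Aterm n m (IrrA nu Stan) = Aterm n m th by [].
  rewrite AE GE; move: mE; rewrite /dimq; case: ifP => _ mE /=;
    apply: (mulIf (_ : 3%:R != 0)) => //; rewrite mE ?rmorphB ?rmorphD /=; by field.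
have := mult_full_q n_gt3 n_neq0 Hzeta HL HD HG two_neq0 three_neq0 HrV Hw an
    (residue_mod aE) E nS Hv.
rewrite -/th => /(congr1 (fun z : int => z%:~R : rat)) mE; rewrite rmorphM /= in mE.
have -> : Gterm n m th = Gterm n m (IrrA nu Triv) by rewrite /th; case: (rho) nS.
have -> : Bterm n m th = Bterm n m (IrrB k rho) by [].
have -> : theta_dim th = 1%N by rewrite /th; case: (rho) nS.
rewrite (B_rat nS (residue_bound n_gt3 _) qE) AE GE.
move: mE; rewrite /dimq; case: ifP => _ mE /=;
  apply: (mulIf (_ : 6%:R != 0)) => //; rewrite mE ?mulr0 ?rmorphD /= ?rmorphM /=; by field.
Qed.

End Types.

(** * The representation on the space of holomorphic differentials *)

Section Existence.

Variables (K : closedFieldType) (L : fieldType) (n : nat).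
Variables (iota : {rmorphism K -> L}) (x y : L).
Variables (zeta : K) (D : L -> L).
Variables (gT : finGroupType) (act : gT -> {rmorphism L -> L}).
Variables (sigma : 'I_n -> 'I_n -> gT) (s t : gT).
Hypothesis n_gt3 : (3 < n)%N.
Hypothesis n_neq0 : n%:R != 0 :> K.
Hypothesis Hzeta : n.-primitive_root zeta.
Hypothesis HL : fermat_function_field n iota x y.
Hypothesis HD : is_ddx iota x D.
Hypothesis HG : fermat_group zeta iota x y act sigma s t.
Variable m : nat.
Local Notation N := (m * (n - 3))%N.
Local Notation omega := (y ^+ (m * n.-1))^-1.
Local Notation holo := (holo_diff iota x y D n m).
Local Notation T g := (act_diff x D m (act g)).
Let nzx := x_neq0 n_gt3 HL.
Let TM := act_diffM n_gt3 n_neq0 HL HD HG m.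
Let Tmul g u f : T g (u * f) = act g u * T g f.
Proof. by rewrite /act_diff rmorphM mulrA. Qed.
Let Tlin := act_diff_klinear D HG m.
Let K_closed := @poly_closed K.

Lemma mono_holo i j : (i + j <= N)%N -> holo (x ^+ i * y ^+ j * omega).
Proof.
move=> ij; have -> : x ^+ i * y ^+ j
    = dehomog iota x y ('X_o0 ^+ i * 'X_o1 ^+ j * 'X_o2 ^+ (N - (i + j))).
  by rewrite !rmorphM !rmorphXn /= !dehomogXU /= expr1n mulr1.
apply: (form_holo_diff n_gt3 n_neq0 Hzeta HL HD).
rewrite -{2}(subnKC ij); apply: dhomogM; last exact: dhomogXn.
by apply: dhomogM; exact: dhomogXn.
Qed.

(** On the homogeneous exponents (i, j, N - i - j) the rotation is a cyclic shift. *)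
Lemma T_s_mono i j : (i + j <= N)%N -> T s (x ^+ i * y ^+ j * omega)
  = x ^+ (N - (i + j)) * y ^+ i * omega.
Proof.
move=> ij; rewrite Tmul (T_s n_gt3 n_neq0 Hzeta HL HD HG) rmorphM !rmorphXn /=.
rewrite (fg_s_x HG) (fg_s_y HG) div1r exprVn expr_div_n -{1}(subnK ij) !exprD.
have := expf_neq0 i nzx; have := expf_neq0 j nzx.
move: (x ^+ i) (x ^+ j) (x ^+ (_ - _)) (y ^+ i) omega => u v z o p nzv nzu.
transitivity (z * o * p * (u / u) * (v / v)); first by ring.
by rewrite !divff // !mulr1.
Qed.

Lemma T_t_mono i j : (i + j <= N)%N -> T t (x ^+ i * y ^+ j * omega)
  = iota ((-1) ^+ m) * (x ^+ (N - (i + j)) * y ^+ j * omega).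
Proof.
move=> ij; rewrite Tmul (T_t n_gt3 Hzeta HL HD HG) rmorphM !rmorphXn /=.
rewrite (fg_t_x HG) (fg_t_y HG) div1r exprVn expr_div_n -{1}(subnK ij) !exprD.
rewrite rmorphN1; have := expf_neq0 i nzx; have := expf_neq0 j nzx.
move: (x ^+ i) (x ^+ j) (x ^+ (_ - _)) (y ^+ j) omega ((-1) ^+ m) => u v z o p b nzv nzu.
transitivity (b * z * o * p * (u / u) * (v / v)); first by ring.
by rewrite !divff // !mulr1 !mulrA.
Qed.

(** The generators send each monomial of degree N to a scalar multiple of such a monomial, possibly
    with exponent of y at least n; this is why stability is tested on all monomials rather than on
    the basis. *)
Lemma holo_stable g f : holo f -> holo (T g f).
Proof.
have HB := holo_basis n_gt3 n_neq0 K_closed Hzeta HL HD m; have [sp _] := HB.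
have holo_lin c h : holo h -> holo (iota c * h).
  move=> /sp[k ->]; apply/sp; exists (fun i => c * k i); rewrite mulr_sumr.
  by apply: eq_bigr => i _; rewrite rmorphM mulrA.
have holo_add h h' : holo h -> holo h' -> holo (h + h').
  move=> /sp[k ->] /sp[k' ->]; apply/sp; exists (fun i => k i + k' i).
  by rewrite -big_split; apply: eq_bigr => i _; rewrite rmorphD mulrDl.
have holo0 : holo 0.
  by apply/sp; exists (fun=> 0); rewrite big1 // => i _; rewrite rmorph0 mul0r.
pose stab h := forall f', holo f' -> holo (T h f').
have stabM h h' : stab h -> stab h' -> stab (h * h')%g.
  by move=> Hh Hh' f' Hf'; rewrite TM; apply: Hh; apply: Hh'.
have stab1 : stab 1%g by move=> f' Hf'; rewrite (act_diff1 HD HG).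
have stabX h k : stab h -> stab (h ^+ k)%g.
  move=> Hh; elim: k => [|k IH]; first by rewrite expg0.
  by rewrite expgS; apply: stabM.
have stab_gen h : (forall i j, (i + j <= N)%N -> holo (T h (x ^+ i * y ^+ j * omega))) ->
    stab h.
  move=> Hh f' /sp[k ->]; rewrite (klinear_sum _ _ _ (Tlin h)).
  by elim/big_ind: _ => // ij Pij; apply: holo_lin; apply: Hh.
have [e1 e2] := (T_sigma_x n_gt3 Hzeta HD HG m, T_sigma_y n_gt3 Hzeta HD HG m).
have [a [b [i [j ->]]]] := elements_normal n_gt3 Hzeta HL HG g.
move: f; apply: (stabM); first apply: (stabM); last 2 first.
- apply: stabX; apply: stab_gen => k l kl; rewrite T_s_mono //.
  by apply: mono_holo; lia.
- apply: stabX; apply: stab_gen => k l kl; rewrite T_t_mono //.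
  by apply: holo_lin; apply: mono_holo; lia.
rewrite (sigz_nat n_gt3 Hzeta HL HG); apply: stabM; apply: stabX; apply: stab_gen => k l kl.
  rewrite Tmul e1 (act_sigma_x n_gt3 Hzeta HG) mulrACA -rmorphM.
  by apply: holo_lin; apply: mono_holo.
rewrite Tmul e2 (act_sigma_y n_gt3 Hzeta HG) mulrACA -rmorphM.
by apply: holo_lin; apply: mono_holo.
Qed.

(** Coordinates as columns turn the left action T (g h) = T g o T h, which rests on the chain rule,
    into a matrix representation. *)
Lemma exists_affords : exists (d : nat) (e : 'I_d -> L)
    (rV : mx_representation K [set: gT]%G d),
  affords_holo_diff iota x y D act n m e rV.
Proof.
have := basis_on_enum (holo_basis n_gt3 n_neq0 K_closed Hzeta HL HD m).
move: #|_| (fun k => _) => d e He; have [sp fr] := He.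
have eV j : holo (e j).
  by apply: (basis_on_mem (i := j) (proj1 (is_basisE _ _ _) He)).
have [M HM] := basis_on_coord (b := fun gj : gT * 'I_d => T gj.1 (e gj.2))
  (proj1 (is_basisE _ _ _) He) (fun gj => holo_stable _ (eV _)).
pose r g := \matrix_(i, j) M (g, j) i.
have Tr g j : T g (e j) = \sum_i iota (r g i j) * e i.
  by rewrite [LHS](HM (g, j)); apply: eq_bigr => i _; rewrite mxE.
have coord_inj (c c' : 'I_d -> K) :
    \sum_i iota (c i) * e i = \sum_i iota (c' i) * e i -> forall i, c i = c' i.
  move=> /eqP; rewrite -subr_eq0 -sumrB => /eqP H i; apply/eqP.
  rewrite -subr_eq0; apply/eqP; apply: (fr (fun i => c i - c' i)).
  by rewrite -[RHS]H; apply: eq_bigr => k _; rewrite rmorphB mulrBl.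
have r_repr : mx_repr [set: gT] r.
  split=> [|g h _ _]; apply/matrixP => i j.
    apply: (coord_inj (fun i => r 1%g i j) (fun i => 1%:M i j)).
    rewrite -Tr (act_diff1 HD HG) (bigD1 j) //= mxE eqxx rmorph1 mul1r.
    rewrite big1 ?addr0 // => k /negPf kj.
    by rewrite mxE kj rmorph0 mul0r.
  apply: (coord_inj (fun i => r (g * h)%g i j) (fun i => (r g *m r h) i j)).
  rewrite -Tr TM Tr (klinear_sum _ _ _ (Tlin g)).
  rewrite (eq_bigr (fun k => \sum_i iota (r g i k * r h k j) * e i)); last first.
    move=> k _; rewrite Tr mulr_sumr; apply: eq_bigr => l _.
    by rewrite rmorphM mulrA; congr (_ * _); exact: mulrC.
  rewrite exchange_big; apply: eq_bigr => l _; rewrite -mulr_suml mxE rmorph_sum.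
  by [].
by exists d, e, (MxRepresentation r_repr).
Qed.

End Existence.

Theorem theorem20
  (K : closedFieldType) (n : nat) (zeta : K)
  (Hn : (4 <= n)%N)
  (Hchar : forall p : nat, p \in [pchar K] ->
     [/\ p <> 2%N, p <> 3%N, ~~ (p %| n)%N & forall k : nat, (n - 1)%N <> (p ^ k)%N])
  (Hzeta : n.-primitive_root zeta)
  (L : fieldType) (iota : {rmorphism K -> L}) (x y : L)
  (HL : fermat_function_field n iota x y)
  (D : L -> L) (HD : is_ddx iota x D)
  (gT : finGroupType) (act : gT -> {rmorphism L -> L})
  (sigma : 'I_n -> 'I_n -> gT) (s t : gT)
  (HG : fermat_group zeta iota x y act sigma s t)
  (m : nat) (Hm : (1 <= m)%N) :
  (exists (d : nat) (e : 'I_d -> L) (rV : mx_representation K [set: gT]%G d),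
     affords_holo_diff iota x y D act n m e rV)
  /\
  forall (d : nat) (e : 'I_d -> L) (rV : mx_representation K [set: gT]%G d),
    affords_holo_diff iota x y D act n m e rV ->
    forall th : irr_index, theta_valid n th ->
      (theta_mult zeta sigma s t rV th)%:R
      = (theta_dim th)%:R / 6%:R
          * (m%:R - (Num.ceil ((3 * m%:R - 1) / n%:R : rat))%:~R + Aterm n m th)
        + 2%:R^-1 * Bterm n m th + 3%:R^-1 * Gterm n m th :> rat.
Proof.
have prime_neq0 p : prime p -> p = 2%N \/ p = 3%N -> p%:R != 0 :> K.
  move=> pp p23; apply/negP => p0; have [] := Hchar p.
    by rewrite inE pp.
  by case: p23.
have two_neq0 : 2%:R != 0 :> K by apply: prime_neq0; [|left].
have three_neq0 : 3%:R != 0 :> K by apply: prime_neq0; [|right].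
have n_neq0 : n%:R != 0 :> K.
  have n0 : (0 < n)%N by apply: leq_trans Hn.
  rewrite natf_neq0_pchar; apply/pnatP => // p _ pn.
  by apply/negP => /Hchar[_ _ /negP].
split; first exact: (exists_affords Hn n_neq0 Hzeta HL HD HG m).
move=> d e rV HrV th Hv; rewrite (ceilE Hn Hm).
case: th Hv => [nu rho|kappa rho|kappa lam] Hv.
- exact: (multiplicity_A Hn n_neq0 Hzeta HL HD HG two_neq0 three_neq0 HrV Hm Hv).
- exact: (multiplicity_B Hn n_neq0 Hzeta HL HD HG two_neq0 three_neq0 HrV Hm Hv).
- exact: (multiplicity_C Hn n_neq0 Hzeta HL HD HG two_neq0 three_neq0 HrV Hm Hv).
Qed.
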